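(* Let $1<p<\infty$ and let $T$ be a linear operator defined on scalar valued functions on $\mathbb{R}^d$ such that, for every $n\in\mathbb{N}$ and every $n\times n$ matrix $\mathrm{A}_p$ weight $W$, its canonical vector-valued extension $T\otimes\mathbf{I}_n$ is bounded on $L^p(W)$ with operator norm bounded by a constant depending only on $T,n,d,p$ and $[W]_{\mathrm{A}_p}$. Let $m\in\mathbb{N}$, let $U,V$ be $m\times m$ matrix $\mathrm{A}_p$ weights on $\mathbb{R}^d$ and let $B$ be a locally integrable $m\times m$ matrix valued function on $\mathbb{R}^d$. Then $$\|[M_B,T\otimes\mathbf{I}_m]\|_{L^p(U)\to L^p(V)}\le C\,\|B\|_{\mathrm{BMO}^p_{V,U}},$$ where $C$ depends only on $T,m,d,p,[U]_{\mathrm{A}_p}$ and $[V]_{\mathrm{A}_p}$.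
   Context: $\frac1p+\frac1{p'}=1$. $\fint_Q$ and $m_Q$ denote the unweighted average over $Q$ (entrywise for matrix functions). $\|\cdot\|$ on matrices is the operator norm. An $n\times n$ matrix weight is a measurable $n\times n$ matrix valued function $W$ on $\mathbb{R}^d$ that is positive definite a.e. $L^p(W)$ is the space of $\mathbb{C}^n$ valued functions $\vec f$ with $\|\vec f\|_{L^p(W)}=\left(\int_{\mathbb{R}^d}|W^{1/p}(x)\vec f(x)|^p\,dx\right)^{1/p}<\infty$. $W$ is a matrix $\mathrm{A}_p$ weight if $$[W]_{\mathrm{A}_p}=\sup_{Q\text{ cube}}\fint_Q\left(\fint_Q\|W^{1/p}(x)W^{-1/p}(y)\|^{p'}\,dy\right)^{p/p'}dx<\infty.$$ $T\otimes\mathbf{I}_n$ acts on $\mathbb{C}^n$ valued functions by applying $T$ to each component; $M_B$ is pointwise multiplication by $B$; $[M_B,S]=M_BS-SM_B$. $\|\cdot\|_{L^p(U)\to L^p(V)}$ is the operator norm. Finally $$\|B\|_{\mathrm{BMO}^p_{V,U}}=\sup_{Q\text{ cube}}\fint_Q\left\|(m_QV^{1/p})(B(x)-m_QB)(m_QU^{1/p})^{-1}\right\|dx.$$ *)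

(* Defs.v *)
From HB Require Import structures.
From mathcomp Require Import all_boot all_order all_algebra.
From mathcomp Require Import sesquilinear spectral complex.
From mathcomp Require Import all_classical all_reals all_analysis.

Set Implicit Arguments.
Unset Strict Implicit.
Unset Printing Implicit Defensive.

Import Order.TTheory GRing.Theory Num.Theory.
Import numFieldNormedType.Exports.
Import Normc.

Local Open Scope classical_set_scope.
Local Open Scope ring_scope.
Local Open Scope sesquilinear_scope.

(* R^d, with the product (i.e. Borel) sigma-algebra on tuples. *)
Notation Rspace R d := (d.-tuple (measurableTypeR R)).

Section lebesgue_Rd.
Variable R : realType.

Definition cons_Rd (d : nat) (z : Rspace R d * measurableTypeR R) :
  Rspace R d.+1 := [tuple of z.2 :: z.1].

Lemma measurable_cons_Rd d : measurable_fun setT (@cons_Rd d).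
Proof. exact: measurable_cons. Qed.

HB.instance Definition _ d :=
  isMeasurableFun.Build _ _ _ _ (@cons_Rd d) (@measurable_cons_Rd d).

Section step.
Variables (d : nat) (mu : {measure set (Rspace R d) -> \bar R}).

Definition lebesgue_step : set (Rspace R d.+1) -> \bar R :=
  pushforward (mu \x @lebesgue_measure R)%E (@cons_Rd d).

Let lebesgue_step0 : lebesgue_step set0 = 0%E.
Proof. exact: measure0. Qed.

Let lebesgue_step_ge0 A : (0 <= lebesgue_step A)%E.
Proof. exact: measure_ge0. Qed.

Let lebesgue_step_sigma_additive : semi_sigma_additive lebesgue_step.
Proof. exact: measure_semi_sigma_additive. Qed.

HB.instance Definition _ := isMeasure.Build _ _ _ lebesgue_step
  lebesgue_step0 lebesgue_step_ge0 lebesgue_step_sigma_additive.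
End step.

(* Lebesgue measure on R^d, as an iterated product of the one on R. *)
Fixpoint leb (d : nat) : {measure set (Rspace R d) -> \bar R} :=
  if d is d'.+1 then lebesgue_step (leb d') else \d_([tuple] : Rspace R 0).

End lebesgue_Rd.
Arguments leb {R} d.

Section matrices.
Variable R : realType.
Implicit Types m n : nat.

Definition vnorm n (v : 'cV[R[i]]_n) : R :=
  Num.sqrt (\sum_(i < n) normc (v i 0) ^+ 2).

Definition opnorm m n (A : 'M[R[i]]_(m, n)) : R :=
  sup [set vnorm (A *m v) | v in [set v | vnorm v <= 1]].

(* The order on R[i] makes [0 < z] mean that z is real and positive. *)
Definition posdefmx n (A : 'M[R[i]]_n) : Prop :=
  A \is hermsymmx /\
  forall v : 'cV[R[i]]_n, v != 0 -> 0 < (v ^t* *m A *m v) 0 0.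

(* A^s by functional calculus; the value outside the positive definite
   matrices is irrelevant, and fixed to 0 to keep the map measurable. *)
Definition mxpow n (A : 'M[R[i]]_n) (s : R) : 'M[R[i]]_n :=
  if `[< posdefmx A >] then
    let P := spectralmx A in
    invmx P *m
    diag_mx (map_mx (fun z => ((complex.Re z) `^ s)%:C%C) (spectral_diag A)) *m P
  else 0.

End matrices.

Section weights.
Variables (R : realType) (d : nat).
Implicit Types (m n : nat) (p : R) (Q : set (Rspace R d)).

Definition cube (a : Rspace R d) (l : R) : set (Rspace R d) :=
  [set x | forall i, tnth a i <= tnth x i < tnth a i + l].

Definition cubes : set (set (Rspace R d)) :=
  [set Q | exists a l, 0 < l /\ Q = cube a l].

Definition avg Q (f : Rspace R d -> \bar R) : \bar R :=
  ((fine (leb d Q))^-1%R%:E * \int[leb d]_(x in Q) f x)%E.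

Definition mxavg m n Q (A : Rspace R d -> 'M[R[i]]_(m, n)) : 'M[R[i]]_(m, n) :=
  \matrix_(i, j)
    Complex (fine (avg Q (fun x => (complex.Re (A x i j))%:E)))
            (fine (avg Q (fun x => (complex.Im (A x i j))%:E))).

Definition mx_measurable m n (A : Rspace R d -> 'M[R[i]]_(m, n)) : Prop :=
  forall i j, measurable_fun setT (fun x => complex.Re (A x i j)) /\
              measurable_fun setT (fun x => complex.Im (A x i j)).

(* Every compact set lies in a cube. *)
Definition mx_locally_integrable m n (A : Rspace R d -> 'M[R[i]]_(m, n)) : Prop :=
  mx_measurable A /\
  forall Q, cubes Q -> forall i j,
    (leb d).-integrable Q (fun x => (complex.Re (A x i j))%:E) /\
    (leb d).-integrable Q (fun x => (complex.Im (A x i j))%:E).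

Definition matrix_weight n (W : Rspace R d -> 'M[R[i]]_n) : Prop :=
  mx_measurable W /\ {ae leb d, forall x, posdefmx (W x)}.

Definition LpW_norm p n (W : Rspace R d -> 'M[R[i]]_n) (f : Rspace R d -> 'cV[R[i]]_n)
    : \bar R :=
  ((\int[leb d]_x ((vnorm (mxpow (W x) (p^-1)%R *m f x)) `^ p)%R%:E) `^ p^-1)%E.

Definition LpW p n (W : Rspace R d -> 'M[R[i]]_n) : set (Rspace R d -> 'cV[R[i]]_n) :=
  [set f | mx_measurable f /\ (LpW_norm p W f < +oo)%E].

(* p' with 1/p + 1/p' = 1 *)
Definition dual_exp p : R := (1 - p^-1)^-1.

Definition Ap_const p n (W : Rspace R d -> 'M[R[i]]_n) : \bar R :=
  ereal_sup [set avg Q (fun x =>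
      (avg Q (fun y =>
         (opnorm (mxpow (W x) p^-1 *m mxpow (W y) (- p^-1)) `^ dual_exp p)%R%:E)
       `^ (p / dual_exp p))%E)
    | Q in cubes].

Definition Ap_weight p n (W : Rspace R d -> 'M[R[i]]_n) : Prop :=
  matrix_weight W /\ (Ap_const p W < +oo)%E.

Definition BMO_norm p n (V U B : Rspace R d -> 'M[R[i]]_n) : \bar R :=
  ereal_sup [set avg Q (fun x =>
      (opnorm (mxavg Q (fun y => mxpow (V y) p^-1) *m (B x - mxavg Q B)
               *m invmx (mxavg Q (fun y => mxpow (U y) p^-1))))%:E)
    | Q in cubes].

End weights.

(* Operators are partial maps between spaces of functions on R^d; functions
   are genuine functions, so linearity is only required up to null sets. *)
Record operator (X Y : Type) := Operator { op_dom : set X; op_fun :> X -> Y }.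

Section operators.
Variables (R : realType) (d : nat).

Definition op_linear (T : operator (Rspace R d -> R[i]) (Rspace R d -> R[i]))
    : Prop :=
  op_dom T (fun=> 0) /\
  forall (a : R[i]) f g, op_dom T f -> op_dom T g ->
    op_dom T (fun x => a * f x + g x) /\
    {ae leb d, forall x, T (fun x => a * f x + g x) x = a * T f x + T g x}.

Notation voperator n :=
  (operator (Rspace R d -> 'cV[R[i]]_n) (Rspace R d -> 'cV[R[i]]_n)).

(* The extension of T acting componentwise. *)
Definition op_tensor n (T : operator (Rspace R d -> R[i]) (Rspace R d -> R[i]))
    : voperator n :=
  Operator [set f : Rspace R d -> 'cV[R[i]]_n |
             forall i, op_dom T (fun x => f x i 0)]
           (fun (f : Rspace R d -> 'cV[R[i]]_n) x => \col_i T (fun y => f y i 0) x).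

Definition op_mul n (B : Rspace R d -> 'M[R[i]]_n) : voperator n :=
  Operator setT (fun (f : Rspace R d -> 'cV[R[i]]_n) x => B x *m f x).

Definition op_comp n (S1 S2 : voperator n) : voperator n :=
  Operator [set f | op_dom S2 f /\ op_dom S1 (S2 f)] (fun f => S1 (S2 f)).

Definition op_sub n (S1 S2 : voperator n) : voperator n :=
  Operator (op_dom S1 `&` op_dom S2) (fun f x => S1 f x - S2 f x).

Definition commutator n (S1 S2 : voperator n) : voperator n :=
  op_sub (op_comp S1 S2) (op_comp S2 S1).

(* The operator norm from L^p(U) to L^p(V); it is +oo unless S is defined on
   all of L^p(U) and maps it boundedly into L^p(V). *)
Definition op_norm p n (U V : Rspace R d -> 'M[R[i]]_n) (S : voperator n)
    : \bar R :=
  ereal_inf [set M%:E | M in [set M : R | 0 <= M /\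
    forall f, LpW p U f ->
      [/\ op_dom S f, LpW p V (S f) &
          (LpW_norm p V (S f) <= M%:E * LpW_norm p U f)%E]]].

End operators.

(* Main.v *)
Require Import Defs.
From HB Require Import structures.
From mathcomp Require Import all_boot all_order all_algebra.
From mathcomp Require Import sesquilinear spectral complex.
From mathcomp Require Import all_classical all_reals all_analysis.
From mathcomp Require Import perm measurable_realfun ring lra.

(** The commutator is a corner of the operator [T] acting on vectors of twice
    the length, and the hypothesis on [T] is used for weights of that size.

    Write A = V^(1/p) and E = U^(1/p), and for t > 0 let Phi_t be the block
    matrix with rows (A, t A B) and (0, E).  There is a weight W_t with
    |W_t^(1/p) f| = |Phi_t f|, namely the power p/2 of the Gram matrix of Phi_t
    ([bweight], where B stands for t B).  For f = (B g, - g / t) one has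
    Phi_t f = (0, - E g / t), while the first block of Phi_t (T f) is
    - A ([B, T] g).  So the norm of the commutator is at most 1 / t times the
    norm of T on L^p(W_t) ([comm_op_bound]).

    The A_p constant of W_t only involves Phi_t(x) Phi_t(y)^-1, whose diagonal
    blocks are those of V and U and whose corner is
    t A(x) (B(x) - B(y)) E(y)^-1.  It is bounded by some F, depending on the
    constants of U and V, as soon as t times the BMO norm of B is small
    ([bweight_upper]).  This requires the corner to be controlled in L^p with
    respect to x and in L^p' with respect to y, whereas the BMO norm is an L^1
    quantity: the gain is the weighted John-Nirenberg estimate
    ([john_nirenberg]), applied once to B and once to its adjoint
    ([offdiag_bounds]).  It rests on the fact that the average of A over a cube
    reduces A there ([ap_reducing]).

    The norm of T on L^p(W) is bounded by a function of [W]_{A_p} that may be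
    arbitrarily irregular, so an upper bound on [W_t]_{A_p} is not enough: t is
    chosen so that [W_t]_{A_p} is exactly c0 = F + 1.  The constant depends
    continuously on t, because passing from t to l t conjugates
    Phi_t(x) Phi_t(y)^-1 by diag(l, 1) ([bweight_lip], [quasi_lipschitz_IVT]).  If c0 is attained at t,
    then t times the BMO norm is not small, and 1 / t is bounded by the BMO
    norm.  If it is not, then [W_t]_{A_p} < c0 for all t; the corner then
    vanishes almost everywhere, [W_t]_{A_p} does not depend on t
    ([bweight_rigid]), and letting t tend to infinity shows that the commutator
    vanishes.

    Since powers of matrices are defined through a spectral decomposition which
    is chosen without regard to measurability, a separate argument shows that
    they depend measurably on the matrix ([mxm_mxpow]). *)

Set Implicit Arguments.
Unset Strict Implicit.
Unset Printing Implicit Defensive.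

Import Order.TTheory GRing.Theory Num.Theory.
Import numFieldNormedType.Exports.
Import Normc.

Local Open Scope classical_set_scope.
Local Open Scope ring_scope.
Local Open Scope sesquilinear_scope.

(** * Frobenius and operator norms *)

Section l2.
Variable R : realType.

Lemma sum_sqr_ge0 (I : finType) (a : I -> R) : 0 <= \sum_i a i ^+ 2.
Proof. by apply: sumr_ge0 => i _; exact: sqr_ge0. Qed.

Lemma CauchySchwarz_sum (I : finType) (a b : I -> R) :
  (\sum_i a i * b i) ^+ 2 <= (\sum_i a i ^+ 2) * (\sum_i b i ^+ 2).
Proof.
rewrite -subr_ge0 -(@pmulr_rge0 _ 2)//.
suff -> : 2 * ((\sum_i a i ^+ 2) * (\sum_i b i ^+ 2) - (\sum_i a i * b i) ^+ 2)
   = \sum_i \sum_j (a i * b j - a j * b i) ^+ 2.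
  by apply: sumr_ge0 => i _; apply: sumr_ge0 => j _; exact: sqr_ge0.
transitivity (\sum_i \sum_j (a i ^+ 2 * b j ^+ 2 + a j ^+ 2 * b i ^+ 2
   - 2 * ((a i * b i) * (a j * b j)))); last first.
  by apply: eq_bigr => i _; apply: eq_bigr => j _; ring.
set sa := \sum_i a i ^+ 2; set sb := \sum_i b i ^+ 2; set sab := \sum_i a i * b i.
transitivity (\sum_i (a i ^+ 2 * sb + sa * b i ^+ 2 - 2 * sab * (a i * b i))).
  by rewrite sumrB big_split/= -mulr_suml -!mulr_sumr -/sa -/sb -/sab; ring.
apply: eq_bigr => i _; rewrite sumrB big_split/= -!mulr_sumr -mulr_suml -/sb -/sab -/sa.
by ring.
Qed.

Definition l2 (I : finType) (a : I -> R) := Num.sqrt (\sum_i a i ^+ 2).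

Lemma l2_ge0 (I : finType) (a : I -> R) : 0 <= l2 a.
Proof. exact: sqrtr_ge0. Qed.

Lemma l2_sq (I : finType) (a : I -> R) : l2 a ^+ 2 = \sum_i a i ^+ 2.
Proof. by rewrite sqr_sqrtr// sum_sqr_ge0. Qed.

Lemma l2_CS (I : finType) (a b : I -> R) : \sum_i a i * b i <= l2 a * l2 b.
Proof.
apply: le_trans (ler_norm _) _.
rewrite -ler_sqr ?nnegrE ?mulr_ge0 ?l2_ge0// real_normK ?num_real//.
by rewrite exprMn !l2_sq CauchySchwarz_sum.
Qed.

Lemma l2_D (I : finType) (a b c : I -> R) :
  (forall i, 0 <= c i <= a i + b i) -> l2 c <= l2 a + l2 b.
Proof.
move=> h; rewrite -ler_sqr ?nnegrE ?addr_ge0 ?l2_ge0// sqrrD !l2_sq.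
apply: (@le_trans _ _ (\sum_i (a i + b i) ^+ 2)).
  apply: ler_sum => i _; have /andP[c0 cab] := h i.
  by rewrite ler_sqr// nnegrE// (le_trans c0).
under eq_bigr do rewrite sqrrD.
rewrite !big_split/= lerD2r lerD2l [leLHS](_ : _ = (\sum_i a i * b i) *+ 2) ?lerMn2r ?sumrMnl//=.
exact: l2_CS.
Qed.

Lemma l2_le_sum (I : finType) (a : I -> R) : (forall i, 0 <= a i) ->
  l2 a <= \sum_i a i.
Proof.
move=> a0; rewrite -ler_sqr ?nnegrE ?l2_ge0 ?sumr_ge0// l2_sq expr2 mulr_sumr.
apply: ler_sum => i _; rewrite expr2 ler_wpM2r// (bigD1 i)//= lerDl.
exact: sumr_ge0.
Qed.

Lemma l2_ge (I : finType) (a : I -> R) i : 0 <= a i -> a i <= l2 a.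
Proof.
move=> a0; rewrite -ler_sqr ?nnegrE ?l2_ge0// l2_sq (bigD1 i)//= lerDl.
by apply: sumr_ge0 => j _; exact: sqr_ge0.
Qed.

End l2.

Section frobenius.
Variable R : realType.
Implicit Types (m n q : nat).

Lemma normc_ge0 (z : R[i]) : 0 <= normc z.
Proof. by case: z => a b; exact: sqrtr_ge0. Qed.

Lemma normc_sq (z : R[i]) : normc z ^+ 2 = complex.Re z ^+ 2 + complex.Im z ^+ 2.
Proof. by case: z => a b /=; rewrite sqr_sqrtr// addr_ge0 ?sqr_ge0. Qed.

Lemma normc_conj (z : R[i]) : normc (Num.conj z) = normc z.
Proof. by case: z => a b /=; rewrite sqrrN. Qed.

Lemma normc_sum (I : Type) (r : seq I) (P : pred I) (f : I -> R[i]) :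
  normc (\sum_(i <- r | P i) f i) <= \sum_(i <- r | P i) normc (f i).
Proof.
elim/big_ind2 : _ => [|x1 x2 y1 y2 h1 h2|//]; first by rewrite normc0.
by apply: le_trans (le_normcD _ _) _; exact: lerD.
Qed.

Lemma normc_real (x : R) : normc (x%:C)%C = `|x|.
Proof. by rewrite /= expr0n/= addr0 sqrtr_sqr. Qed.

Lemma normc_Re (z : R[i]) : `|complex.Re z| <= normc z.
Proof.
rewrite -ler_sqr ?nnegrE ?normc_ge0// normc_sq real_normK ?num_real//.
by rewrite lerDl sqr_ge0.
Qed.

Lemma normc_Im (z : R[i]) : `|complex.Im z| <= normc z.
Proof.
rewrite -ler_sqr ?nnegrE ?normc_ge0// normc_sq real_normK ?num_real//.
by rewrite lerDr sqr_ge0.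
Qed.

Lemma normc_le_ReIm (z : R[i]) : normc z <= `|complex.Re z| + `|complex.Im z|.
Proof.
rewrite -ler_sqr ?nnegrE ?normc_ge0 ?addr_ge0// normc_sq sqrrD.
rewrite !real_normK ?num_real// lerD2r lerDl mulrn_wge0// mulr_ge0//.
Qed.

(** The Frobenius norm.  It is equivalent to the operator norm, with constants
    depending on the size only, and being explicit in the entries it is used
    for all estimates. *)
Definition fn m n (A : 'M[R[i]]_(m, n)) : R :=
  l2 (fun ij : 'I_m * 'I_n => normc (A ij.1 ij.2)).

Lemma fn_ge0 m n (A : 'M[R[i]]_(m, n)) : 0 <= fn A.
Proof. exact: l2_ge0. Qed.

Lemma fn_sq m n (A : 'M[R[i]]_(m, n)) :
  fn A ^+ 2 = \sum_i \sum_j normc (A i j) ^+ 2.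
Proof. by rewrite l2_sq pair_big. Qed.

Lemma vnormE n (v : 'cV[R[i]]_n) : vnorm v = fn v.
Proof.
apply/eqP; rewrite -(@eqrXn2 _ 2)// ?fn_ge0 ?sqrtr_ge0//; apply/eqP.
rewrite fn_sq /vnorm sqr_sqrtr ?sum_sqr_ge0//.
by apply: eq_bigr => i _; rewrite big_ord1.
Qed.

Lemma fn_entry m n (A : 'M[R[i]]_(m, n)) i j : normc (A i j) <= fn A.
Proof. exact: (@l2_ge R _ (fun ij => normc (A ij.1 ij.2)) (i, j) (normc_ge0 _)). Qed.

Lemma fn_le_sum m n (A : 'M[R[i]]_(m, n)) : fn A <= \sum_i \sum_j normc (A i j).
Proof.
rewrite pair_big; apply: l2_le_sum => ij; exact: normc_ge0.
Qed.

Lemma fn_eq0 m n (A : 'M[R[i]]_(m, n)) : fn A = 0 -> A = 0.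
Proof.
move=> A0; apply/matrixP => i j; rewrite mxE; apply: eq0_normc.
by apply/eqP; rewrite eq_le normc_ge0 andbT -A0 fn_entry.
Qed.

Lemma fn0 m n : fn (0 : 'M[R[i]]_(m, n)) = 0.
Proof.
apply/eqP; rewrite sqrtr_eq0 big1// => ij _.
by rewrite mxE normc0 expr0n.
Qed.

Lemma fnD m n (A B : 'M[R[i]]_(m, n)) : fn (A + B) <= fn A + fn B.
Proof. by apply: l2_D => ij; rewrite normc_ge0/= mxE le_normcD. Qed.

Lemma fnZ m n (c : R[i]) (A : 'M[R[i]]_(m, n)) : fn (c *: A) = normc c * fn A.
Proof.
apply/eqP; rewrite -(@eqrXn2 _ 2)// ?mulr_ge0 ?fn_ge0 ?normc_ge0//; apply/eqP.
rewrite exprMn !fn_sq mulr_sumr; apply: eq_bigr => i _.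
by rewrite mulr_sumr; apply: eq_bigr => j _; rewrite mxE normcM exprMn.
Qed.

Lemma fnN m n (A : 'M[R[i]]_(m, n)) : fn (- A) = fn A.
Proof. by congr Num.sqrt; apply: eq_bigr => i _; rewrite mxE normcN. Qed.

Lemma fnB m n (A B : 'M[R[i]]_(m, n)) : fn (A - B) <= fn A + fn B.
Proof. by rewrite -(fnN B) fnD. Qed.

Lemma fn_tr m n (A : 'M[R[i]]_(m, n)) : fn (A ^t*) = fn A.
Proof.
apply/eqP; rewrite -(@eqrXn2 _ 2)// ?fn_ge0//; apply/eqP.
rewrite !fn_sq exchange_big/=; apply: eq_bigr => i _; apply: eq_bigr => j _.
by rewrite !mxE normc_conj.
Qed.

Lemma fnM m n q (A : 'M[R[i]]_(m, n)) (B : 'M[R[i]]_(n, q)) :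
  fn (A *m B) <= fn A * fn B.
Proof.
rewrite -ler_sqr ?nnegrE ?mulr_ge0 ?fn_ge0// exprMn !fn_sq.
rewrite [X in _ <= _ * X]exchange_big/= big_distrlr/=.
apply: ler_sum => i _; apply: ler_sum => j _.
apply: le_trans (CauchySchwarz_sum _ _).
rewrite ler_sqr ?nnegrE ?normc_ge0 ?sumr_ge0//; last first.
  by move=> k _; rewrite mulr_ge0 ?normc_ge0.
rewrite mxE; apply: le_trans (normc_sum _ _ _) _.
by apply: ler_sum => k _; rewrite normcM.
Qed.

Lemma fnM3 m n q s (A : 'M[R[i]]_(m, n)) (B : 'M[R[i]]_(n, q)) (C : 'M[R[i]]_(q, s)) :
  fn (A *m B *m C) <= fn A * fn B * fn C.
Proof.
apply: le_trans (fnM _ _) _; apply: ler_wpM2r (fnM _ _); exact: fn_ge0.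
Qed.

Lemma vnorm_sq n (v : 'cV[R[i]]_n) : ((vnorm v ^+ 2)%:C)%C = (v ^t* *m v) 0 0.
Proof.
rewrite vnormE fn_sq mxE rmorph_sum/=; apply: eq_bigr => i _.
rewrite big_ord1 normc_sq add_Re2_Im2 !mxE sqr_normc mulrC.
by [].
Qed.

End frobenius.

Section opnorm_theory.
Variable R : realType.
Implicit Types (m n q : nat).

Lemma opnorm_set_ub m n (A : 'M[R[i]]_(m, n)) :
  ubound [set vnorm (A *m v) | v in [set v | vnorm v <= 1]] (fn A).
Proof.
move=> _ [v /= v1 <-]; rewrite vnormE.
by apply: le_trans (fnM _ _) _; rewrite ler_piMr ?fn_ge0// -vnormE.
Qed.

Lemma opnorm_has_sup m n (A : 'M[R[i]]_(m, n)) :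
  has_sup [set vnorm (A *m v) | v in [set v | vnorm v <= 1]].
Proof.
split; last by exists (fn A); exact: opnorm_set_ub.
by exists (vnorm (A *m 0)); exists 0 => //=; rewrite vnormE fn0.
Qed.

Lemma opnorm_le_fn m n (A : 'M[R[i]]_(m, n)) : opnorm A <= fn A.
Proof. by apply: ge_sup; [case: (opnorm_has_sup A)|exact: opnorm_set_ub]. Qed.

Lemma opnorm_ge0 m n (A : 'M[R[i]]_(m, n)) : 0 <= opnorm A.
Proof.
have := @sup_upper_bound _ _ (opnorm_has_sup A).
apply; exists 0; rewrite /= ?mulmx0 vnormE fn0//.
Qed.

Lemma opnorm_ub m n (A : 'M[R[i]]_(m, n)) v : vnorm (A *m v) <= opnorm A * vnorm v.
Proof.
have [v0|v0] := eqVneq (vnorm v) 0.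
  have -> : v = 0 by apply: fn_eq0; rewrite -vnormE.
  by rewrite mulmx0 !vnormE !fn0 mulr0.
have vp : 0 < vnorm v by rewrite lt_def v0 vnormE fn_ge0.
have h : vnorm (((vnorm v)^-1)%:C%C *: v) <= 1.
  by rewrite vnormE fnZ normc_real ger0_norm ?invr_ge0 ?(ltW vp)// -vnormE mulVf.
have := @sup_upper_bound _ _ (opnorm_has_sup A) (vnorm (A *m (((vnorm v)^-1)%:C%C *: v))).
rewrite -scalemxAr vnormE fnZ normc_real ger0_norm ?invr_ge0 ?(ltW vp)// -vnormE.
rewrite mulrC ler_pdivrMr//; apply.
exists (((vnorm v)^-1)%:C%C *: v) => //.
by rewrite -scalemxAr vnormE fnZ normc_real ger0_norm ?invr_ge0 ?(ltW vp)// -vnormE mulrC.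
Qed.

Lemma opnorm_le m n (A : 'M[R[i]]_(m, n)) c : 0 <= c ->
  (forall v, vnorm (A *m v) <= c * vnorm v) -> opnorm A <= c.
Proof.
move=> c0 h; apply: ge_sup; first by case: (opnorm_has_sup A).
move=> _ [v /= v1 <-]; apply: le_trans (h v) _.
by rewrite -[leRHS]mulr1 ler_wpM2l.
Qed.

Lemma fn_le_opnorm m n (A : 'M[R[i]]_(m, n)) : fn A <= Num.sqrt n%:R * opnorm A.
Proof.
rewrite -ler_sqr ?nnegrE ?mulr_ge0 ?fn_ge0 ?sqrtr_ge0 ?opnorm_ge0//.
rewrite exprMn fn_sq sqr_sqrtr// exchange_big/=.
apply: (@le_trans _ _ (\sum_(j < n) opnorm A ^+ 2)); last first.
  by rewrite sumr_const card_ord mulr_natl.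
apply: ler_sum => j _.
have := opnorm_ub A (delta_mx j 0).
rewrite -colE.
have -> : vnorm (delta_mx j 0 : 'cV[R[i]]_n) = 1.
  apply/eqP; rewrite -(@eqrXn2 _ 2)// ?sqrtr_ge0// expr1n vnormE fn_sq.
  rewrite (bigD1 j)//= big_ord1 mxE !eqxx normc1 expr1n big1 ?addr0//.
  by move=> k kj; rewrite big_ord1 mxE (negbTE kj) normc0 expr0n.
rewrite mulr1 => hj; apply: (@le_trans _ _ (vnorm (col j A) ^+ 2)); last first.
  by rewrite ler_sqr ?nnegrE ?opnorm_ge0 ?sqrtr_ge0.
rewrite vnormE fn_sq; apply: ler_sum => i _; by rewrite big_ord1 mxE.
Qed.

Lemma opnormM m n q (A : 'M[R[i]]_(m, n)) (B : 'M[R[i]]_(n, q)) :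
  opnorm (A *m B) <= opnorm A * opnorm B.
Proof.
apply: opnorm_le; first by rewrite mulr_ge0 ?opnorm_ge0.
move=> v; rewrite -mulmxA; apply: le_trans (opnorm_ub _ _) _.
by rewrite -mulrA ler_wpM2l ?opnorm_ge0// opnorm_ub.
Qed.

End opnorm_theory.

(** * Functional calculus of positive definite matrices *)

Section posdef_theory.
Variable R : realType.
Implicit Types (m n : nat).

Lemma hermE n (A : 'M[R[i]]_n) : (A \is hermsymmx) <-> A ^t* = A.
Proof.
split=> [/is_hermitianmxP|h].
  by rewrite expr0 scale1r => {2}->.
by apply/is_hermitianmxP; rewrite expr0 scale1r h.
Qed.

Lemma conjC_real (x : R) : Num.conj (x%:C)%C = (x%:C)%C.
Proof. exact: conjc_real. Qed.

Definition cdiag n (d : 'I_n -> R) : 'M[R[i]]_n := diag_mx (\row_j ((d j)%:C)%C).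

Lemma cdiag_tr n (d : 'I_n -> R) : (cdiag d) ^t* = cdiag d.
Proof.
apply/matrixP => i j; rewrite !mxE rmorphMn/= conjC_real eq_sym.
by have [->|] := eqVneq i j.
Qed.

Lemma cdiagM n (d e : 'I_n -> R) : cdiag d *m cdiag e = cdiag (fun i => d i * e i).
Proof. by rewrite mulmx_diag; congr diag_mx; apply/rowP => j; rewrite !mxE rmorphM. Qed.

Lemma cdiag1 n (d : 'I_n -> R) : (forall i, d i = 1) -> cdiag d = 1%:M.
Proof.
move=> h; rewrite -diag_const_mx; congr diag_mx; apply/rowP => j.
by rewrite !mxE h.
Qed.

Lemma cdiagD n (d e : 'I_n -> R) : cdiag d + cdiag e = cdiag (fun i => d i + e i).
Proof. by apply/matrixP => i j; rewrite !mxE rmorphD/= mulrnDl. Qed.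

Lemma cdiag_form n (d : 'I_n -> R) (v : 'cV[R[i]]_n) :
  (v ^t* *m cdiag d *m v) 0 0 = ((\sum_j d j * normc (v j 0) ^+ 2)%:C)%C.
Proof.
rewrite mxE rmorph_sum/=; apply: eq_bigr => j _.
rewrite mul_mx_diag !mxE rmorphM/= normc_sq add_Re2_Im2 sqr_normc.
by rewrite mulrAC mulrC [v j 0 * _]mulrC.
Qed.

(** The matrix with eigenvalues d in the eigenbasis given by the rows of P;
    for unitary P this is the functional calculus. *)
Definition udiag n (P : 'M[R[i]]_n) (d : 'I_n -> R) := invmx P *m cdiag d *m P.

Lemma mulmx_conj (C : comUnitRingType) n (P D E : 'M[C]_n) : P \in unitmx ->
  (invmx P *m D *m P) *m (invmx P *m E *m P) = invmx P *m (D *m E) *m P.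
Proof. by move=> uP; rewrite !mulmxA mulmxK. Qed.

Lemma udiagM n (P : 'M[R[i]]_n) d e : P \in unitmx ->
  udiag P d *m udiag P e = udiag P (fun i => d i * e i).
Proof. by move=> uP; rewrite /udiag -cdiagM; exact: mulmx_conj. Qed.

Lemma udiagD n (P : 'M[R[i]]_n) d e :
  udiag P d + udiag P e = udiag P (fun i => d i + e i).
Proof. by rewrite /udiag -cdiagD mulmxDr mulmxDl. Qed.

Lemma udiag1 n (P : 'M[R[i]]_n) d : P \in unitmx -> (forall i, d i = 1) ->
  udiag P d = 1%:M.
Proof. by move=> uP d1; rewrite /udiag cdiag1// mulmx1 mulVmx. Qed.

Lemma udiag_tr n (P : 'M[R[i]]_n) d : P \is unitarymx -> (udiag P d) ^t* = udiag P d.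
Proof.
move=> uP; rewrite /udiag invmx_unitary// !trmx_mul !map_mxM/=.
by rewrite cdiag_tr trmxCK mulmxA.
Qed.

Lemma trace_udiag n (P : 'M[R[i]]_n) d : P \in unitmx ->
  \tr (udiag P d) = ((\sum_i d i)%:C)%C.
Proof.
move=> uP; rewrite /udiag -mulmxA mxtrace_mulC -mulmxA mulmxV// mulmx1.
by rewrite mxtrace_diag rmorph_sum/=; apply: eq_bigr => i _; rewrite mxE.
Qed.

Lemma det_udiag n (P : 'M[R[i]]_n) d : P \in unitmx ->
  \det (udiag P d) = ((\prod_i d i)%:C)%C.
Proof.
move=> uP; rewrite /udiag !det_mulmx mulrAC -det_mulmx mulVmx// det1 mul1r.
by rewrite det_diag rmorph_prod/=; apply: eq_bigr => i _; rewrite mxE.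
Qed.

Lemma udiag_form n (P : 'M[R[i]]_n) d (v : 'cV[R[i]]_n) : P \is unitarymx ->
  (v ^t* *m udiag P d *m v) 0 0 = ((\sum_j d j * normc ((P *m v) j 0) ^+ 2)%:C)%C.
Proof.
move=> uP; rewrite -cdiag_form /udiag invmx_unitary// !trmx_mul !map_mxM/=.
by rewrite !mulmxA.
Qed.

(** The functional calculus does not depend on the diagonalising basis: the
    change of basis S intertwines the two diagonal matrices, so each of its
    nonzero entries joins equal eigenvalues, and S still intertwines them
    after [phi] has been applied. *)
Lemma udiag_fun n (P Q : 'M[R[i]]_n) d e (phi : R -> R) :
  P \in unitmx -> Q \in unitmx -> udiag P d = udiag Q e ->
  udiag P (phi \o d) = udiag Q (phi \o e).
Proof.
move=> uP uQ h.
pose S := Q *m invmx P.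
have SE : S *m cdiag d = cdiag e *m S.
  have : Q *m (udiag P d) *m invmx P = Q *m (udiag Q e) *m invmx P by rewrite h.
  by rewrite /udiag !mulmxA mulmxK// mulmxV// mul1mx.
have SE' : S *m cdiag (phi \o d) = cdiag (phi \o e) *m S.
  apply/matrixP => i j; move/matrixP: SE => /(_ i j).
  rewrite !mul_mx_diag !mul_diag_mx !mxE -!/S => /eqP.
  rewrite mulrC -subr_eq0 -mulrBl mulf_eq0 => /orP[|/eqP ->]; last by rewrite mul0r mulr0.
  by rewrite subr_eq0 => /eqP/complexI h0; rewrite /= h0 mulrC.
have : invmx Q *m (S *m cdiag (phi \o d)) *m P = invmx Q *m (cdiag (phi \o e) *m S) *m P.
  by rewrite SE'.
rewrite /S /udiag !mulmxA (mulVmx uQ) mul1mx => ->.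
by rewrite (mulmxKV uP).
Qed.

(** The eigenvalues of a hermitian matrix, as real numbers. *)
Definition sd n (A : 'M[R[i]]_n) (j : 'I_n) : R := complex.Re (spectral_diag A 0 j).

Lemma herm_udiag n (A : 'M[R[i]]_n) : A ^t* = A -> A = udiag (spectralmx A) (sd A).
Proof.
move=> /hermE hA; have /orthomx_spectralP {1}-> : A \is normalmx.
  exact: hermitian_normalmx hA.
rewrite /udiag; congr (_ *m _ *m _); congr diag_mx; apply/rowP => j.
rewrite mxE RRe_real//.
by have /mxOverP/(_ 0 j) := hermitian_spectral_diag_real hA.
Qed.

Lemma spU n (A : 'M[R[i]]_n) : spectralmx A \is unitarymx.
Proof. exact: spectral_unitarymx. Qed.

Lemma spV n (A : 'M[R[i]]_n) : spectralmx A \in unitmx.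
Proof. exact: spectral_unit. Qed.

Lemma sum_normc_gt0 n (v : 'cV[R[i]]_n) (d : 'I_n -> R) : (forall j, 0 < d j) ->
  v != 0 -> 0 < \sum_j d j * normc (v j 0) ^+ 2.
Proof.
move=> d0 v0; rewrite lt_def sumr_ge0 ?andbT; last first.
  by move=> j _; rewrite mulr_ge0 ?sqr_ge0// ltW.
apply: contra v0; rewrite psumr_eq0; last first.
  by move=> j _; rewrite mulr_ge0 ?sqr_ge0// ltW.
move=> /allP h; apply/eqP/matrixP => j k; rewrite ord1 mxE.
have := h j (mem_index_enum _); rewrite mulf_eq0 gt_eqF//= sqrf_eq0 => /eqP.
exact: eq0_normc.
Qed.

Lemma posdef_udiag n (P : 'M[R[i]]_n) d : P \is unitarymx -> (forall j, 0 < d j) ->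
  posdefmx (udiag P d).
Proof.
move=> uP d0; split; first by apply/hermE; rewrite udiag_tr.
move=> v v0; rewrite udiag_form// ltcR; apply: sum_normc_gt0 => //.
apply: contra v0 => /eqP h.
by rewrite -(mulKmx (unitarymx_unit uP) v) h mulmx0.
Qed.

Lemma posdef_sd n (A : 'M[R[i]]_n) : posdefmx A -> forall j, 0 < sd A j.
Proof.
move=> [/hermE hA pA] j.
have uV := spV A.
pose v := invmx (spectralmx A) *m (delta_mx j 0 : 'cV_n).
have PV : spectralmx A *m v = delta_mx j 0 by rewrite /v mulKVmx.
have v0 : v != 0.
  apply/eqP => v0; move: PV; rewrite v0 mulmx0 => /matrixP/(_ j 0).
  by rewrite !mxE !eqxx => /esym/eqP; rewrite oner_eq0.
have := pA v v0; rewrite {1}(herm_udiag hA) udiag_form ?spU// PV ltcR.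
rewrite (bigD1 j)//= mxE !eqxx normc1 expr1n mulr1 big1 ?addr0//.
by move=> k kj; rewrite mxE (negbTE kj) normc0 expr0n mulr0.
Qed.

Lemma posdef_tr n (A : 'M[R[i]]_n) : posdefmx A -> A ^t* = A.
Proof. by case=> /hermE. Qed.

Lemma posdefE n (A : 'M[R[i]]_n) :
  posdefmx A <-> A ^t* = A /\ forall j, 0 < sd A j.
Proof.
split=> [pA|[hA d0]]; first by split; [exact: posdef_tr|exact: posdef_sd].
by rewrite (herm_udiag hA); apply: posdef_udiag => //; exact: spU.
Qed.

Lemma mxpowE n (A : 'M[R[i]]_n) s : posdefmx A ->
  mxpow A s = udiag (spectralmx A) (fun j => sd A j `^ s).
Proof.
move=> pA.
rewrite /mxpow.
rewrite (asboolT pA).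
cbv zeta.
rewrite /udiag.
have -> : map_mx (fun z : R[i] => (((complex.Re z) `^ s)%:C)%C) (spectral_diag A) = \row_j (((sd A j) `^ s)%:C)%C.
  by apply/rowP => j; rewrite !mxE.
by [].
Qed.

Lemma mxpowN n (A : 'M[R[i]]_n) s : ~ posdefmx A -> mxpow A s = 0.
Proof. by move=> pA; rewrite /mxpow; case: asboolP. Qed.

Lemma mxpow_posdef n (A : 'M[R[i]]_n) s : posdefmx A -> posdefmx (mxpow A s).
Proof.
move=> pA; rewrite (mxpowE _ pA); apply: posdef_udiag; first exact: spU.
by move=> j; rewrite powR_gt0// posdef_sd.
Qed.

Lemma mxpowD n (A : 'M[R[i]]_n) s t : posdefmx A ->
  mxpow A s *m mxpow A t = mxpow A (s + t).
Proof.
move=> pA; rewrite !(mxpowE _ pA) (udiagM _ _ (spV A)); apply: congr1; apply/funext => j.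
by rewrite powRD// (gt_eqF (posdef_sd pA j)) implybT.
Qed.

Lemma mxpow0 n (A : 'M[R[i]]_n) : posdefmx A -> mxpow A 0 = 1%:M.
Proof. move=> pA; rewrite (mxpowE _ pA); apply: udiag1; first exact: spV.
by move=> j; rewrite powRr0. Qed.

Lemma mxpowNK n (A : 'M[R[i]]_n) s : posdefmx A -> mxpow A s *m mxpow A (- s) = 1%:M.
Proof. by move=> pA; rewrite mxpowD// subrr mxpow0. Qed.

Lemma mxpow1 n (A : 'M[R[i]]_n) : posdefmx A -> mxpow A 1 = A.
Proof.
move=> pA; rewrite (mxpowE _ pA) [RHS](herm_udiag (posdef_tr pA)); apply: congr1.
by apply/funext => j; rewrite powRr1// ltW// posdef_sd.
Qed.

Lemma mxpowM n (A : 'M[R[i]]_n) s t : posdefmx A ->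
  mxpow (mxpow A s) t = mxpow A (s * t).
Proof.
move=> pA; have pB := mxpow_posdef s pA.
rewrite (mxpowE _ pB) (@udiag_fun n _ (spectralmx A) _ (fun j => sd A j `^ s) (fun x => x `^ t)); [|exact: spV|exact: spV|].
  by rewrite (mxpowE _ pA); apply: congr1; apply/funext => j /=; rewrite powRrM.
by rewrite -(mxpowE _ pA) -herm_udiag; last exact: posdef_tr.
Qed.

Lemma mxpow_tr n (A : 'M[R[i]]_n) s : (mxpow A s) ^t* = mxpow A s.
Proof.
have [pA|pA] := pselect (posdefmx A); first exact/posdef_tr/mxpow_posdef.
by rewrite mxpowN// trmx0 map_mx0.
Qed.

Lemma posdef_unit n (A : 'M[R[i]]_n) : posdefmx A -> A \in unitmx.
Proof.
move=> pA; have := mxpowNK 1 pA; rewrite mxpow1// => h.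
by have [] := mulmx1_unit h.
Qed.

(** Injectivity of X is what keeps the congruence definite. *)
Lemma posdef_congr m n (A : 'M[R[i]]_m) (X : 'M[R[i]]_(m, n)) : posdefmx A ->
  (forall v : 'cV_n, X *m v = 0 -> v = 0) -> posdefmx (X ^t* *m A *m X).
Proof.
move=> pA hX; split.
  apply/hermE; rewrite !trmx_mul !map_mxM/= trmxCK.
  by rewrite -[A^T ^ _]/(A ^t*) (posdef_tr pA) mulmxA.
move=> v v0; have := (pA.2 (X *m v)); rewrite trmx_mul map_mxM/= !mulmxA; apply.
by apply: contra v0 => /eqP/hX ->.
Qed.

Lemma posdef1 n : posdefmx (1%:M : 'M[R[i]]_n).
Proof.
rewrite -(@udiag1 n 1%:M (fun=> 1)) ?unitmx1//; apply: posdef_udiag => //.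
by apply/unitarymxP; rewrite trmx1 map_mx1 mulmx1.
Qed.

Lemma posdef_gram n (X : 'M[R[i]]_n) : X \in unitmx -> posdefmx (X ^t* *m X).
Proof.
move=> uX; rewrite -[X ^t*]mulmx1; apply: posdef_congr; first exact: posdef1.
by move=> v h; rewrite -(mulKmx uX v) h mulmx0.
Qed.

End posdef_theory.

(** * Measurable matrix functions *)

Section cmeasurable.
Context {dd : measure_display} {T : measurableType dd} {R : realType}.
Implicit Types (m n q : nat).

(** Measurability of the real and imaginary parts, the form in which it
    appears for the entries of matrices. *)
Definition cm (f : T -> R[i]) : Prop :=
  measurable_fun setT (fun x => complex.Re (f x)) /\
  measurable_fun setT (fun x => complex.Im (f x)).

Definition mxm m n (A : T -> 'M[R[i]]_(m, n)) : Prop := forall i j, cm (fun x => A x i j).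

Lemma measurable_inv_ge0 (f : T -> R) : (forall x, 0 <= f x) ->
  measurable_fun setT f -> measurable_fun setT (fun x => (f x)^-1).
Proof.
move=> f0 mf; rewrite (_ : (fun x => _) = (fun x => f x `^ (-1))).
  exact: (measurableT_comp (measurable_powR _) mf).
by apply/funext => x; rewrite powR_inv1.
Qed.

Lemma measurable_sqrt_ge0 (f : T -> R) : (forall x, 0 <= f x) ->
  measurable_fun setT f -> measurable_fun setT (fun x => Num.sqrt (f x)).
Proof.
move=> f0 mf; rewrite (_ : (fun x => _) = (fun x => f x `^ 2^-1)).
  exact: (measurableT_comp (measurable_powR _) mf).
by apply/funext => x; rewrite powR12_sqrt.
Qed.

Lemma cm_cst z : cm (fun=> z).
Proof. by split; exact: measurable_cst. Qed.

Lemma cm_real (f : T -> R) : measurable_fun setT f -> cm (fun x => ((f x)%:C)%C).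
Proof. by split => //=; exact: measurable_cst. Qed.

Lemma cmD f g : cm f -> cm g -> cm (fun x => f x + g x).
Proof.
move=> [f1 f2] [g1 g2]; split.
  rewrite (_ : (fun x => _) = (fun x => complex.Re (f x) + complex.Re (g x))).
    exact: measurable_funD.
  by apply/funext => x; case: (f x) (g x) => ? ? [].
rewrite (_ : (fun x => _) = (fun x => complex.Im (f x) + complex.Im (g x))).
  exact: measurable_funD.
by apply/funext => x; case: (f x) (g x) => ? ? [].
Qed.

Lemma cmN f : cm f -> cm (fun x => - f x).
Proof.
move=> [f1 f2]; split.
  rewrite (_ : (fun x => _) = (fun x => - complex.Re (f x))).
    exact: measurableT_comp.
  by apply/funext => x; case: (f x).
rewrite (_ : (fun x => _) = (fun x => - complex.Im (f x))).
  exact: measurableT_comp.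
by apply/funext => x; case: (f x).
Qed.

Lemma cmM f g : cm f -> cm g -> cm (fun x => f x * g x).
Proof.
move=> [f1 f2] [g1 g2]; split.
  rewrite (_ : (fun x => _) = (fun x => complex.Re (f x) * complex.Re (g x) -
      complex.Im (f x) * complex.Im (g x))).
    by apply: measurable_funB; exact: measurable_funM.
  by apply/funext => x; case: (f x) (g x) => ? ? [].
rewrite (_ : (fun x => _) = (fun x => complex.Re (f x) * complex.Im (g x) +
      complex.Im (f x) * complex.Re (g x))).
  by apply: measurable_funD; exact: measurable_funM.
by apply/funext => x; case: (f x) (g x) => ? ? [].
Qed.

Lemma cm_conj f : cm f -> cm (fun x => Num.conj (f x)).
Proof.
move=> [f1 f2]; split.
  rewrite (_ : (fun x => _) = (fun x => complex.Re (f x)))//.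
  by apply/funext => x; case: (f x).
rewrite (_ : (fun x => _) = (fun x => - complex.Im (f x))).
  exact: measurableT_comp.
by apply/funext => x; case: (f x).
Qed.

Lemma cm_sum (I : Type) (r : seq I) (P : pred I) (f : I -> T -> R[i]) :
  (forall i, P i -> cm (f i)) -> cm (fun x => \sum_(i <- r | P i) f i x).
Proof.
move=> h; elim: r => [|i r IH].
  by under eq_fun do rewrite big_nil; exact: cm_cst.
under eq_fun do rewrite big_cons.
by case Pi: (P i) => //; apply: cmD => //; exact: h.
Qed.

Lemma cm_prod (I : Type) (r : seq I) (P : pred I) (f : I -> T -> R[i]) :
  (forall i, P i -> cm (f i)) -> cm (fun x => \prod_(i <- r | P i) f i x).
Proof.
move=> h; elim: r => [|i r IH].
  by under eq_fun do rewrite big_nil; exact: cm_cst.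
under eq_fun do rewrite big_cons.
by case Pi: (P i) => //; apply: cmM => //; exact: h.
Qed.

Lemma measurable_normc f : cm f -> measurable_fun setT (fun x => normc (f x)).
Proof.
move=> [f1 f2].
rewrite (_ : (fun x => _) = (fun x => Num.sqrt (complex.Re (f x) ^+ 2 + complex.Im (f x) ^+ 2))).
  apply: measurable_sqrt_ge0; first by move=> x; rewrite addr_ge0 ?sqr_ge0.
  by apply: measurable_funD; exact: measurable_funX.
by apply/funext => x; case: (f x).
Qed.

Lemma cmV f : cm f -> cm (fun x => (f x)^-1).
Proof.
move=> mf.
rewrite (_ : (fun x => _) = (fun x => (((normc (f x) ^+ 2)^-1)%:C)%C * Num.conj (f x))).
  apply: cmM; last exact: cm_conj.
  apply: cm_real; apply: measurable_inv_ge0; first by move=> x; exact: sqr_ge0.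
  exact: measurable_funX (measurable_normc mf).
apply/funext => x; rewrite normc_sq; case: (f x) => a b /=.
apply/eqP; rewrite eq_complex/=; apply/andP; split; apply/eqP; rewrite ?mul0r ?subr0 ?addr0 1?mulrC//.
by rewrite !mulrN mulrC.
Qed.

Lemma cm_if (b : T -> bool) f g : measurable_fun setT b -> cm f -> cm g ->
  cm (fun x => if b x then f x else g x).
Proof.
move=> mb [f1 f2] [g1 g2]; split.
  rewrite (_ : (fun x => _) = (fun x => if b x then complex.Re (f x) else complex.Re (g x))).
    exact: measurable_fun_ifT.
  by apply/funext => x; case: ifP.
rewrite (_ : (fun x => _) = (fun x => if b x then complex.Im (f x) else complex.Im (g x))).
  exact: measurable_fun_ifT.
by apply/funext => x; case: ifP.
Qed.

Lemma mxm_cst m n (M : 'M[R[i]]_(m, n)) : mxm (fun=> M).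
Proof. by move=> i j; exact: cm_cst. Qed.

Lemma mxmD m n (A B : T -> 'M[R[i]]_(m, n)) : mxm A -> mxm B -> mxm (fun x => A x + B x).
Proof. by move=> hA hB i j; under eq_fun do rewrite mxE; exact: cmD. Qed.

Lemma mxmN m n (A : T -> 'M[R[i]]_(m, n)) : mxm A -> mxm (fun x => - A x).
Proof. by move=> hA i j; under eq_fun do rewrite mxE; exact: cmN. Qed.

Lemma mxmB m n (A B : T -> 'M[R[i]]_(m, n)) : mxm A -> mxm B -> mxm (fun x => A x - B x).
Proof. by move=> hA hB; apply: mxmD => //; exact: mxmN. Qed.

Lemma mxmM m n q (A : T -> 'M[R[i]]_(m, n)) (B : T -> 'M[R[i]]_(n, q)) :
  mxm A -> mxm B -> mxm (fun x => A x *m B x).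
Proof.
move=> hA hB i j; under eq_fun do rewrite mxE; apply: cm_sum => k _.
exact: cmM.
Qed.

Lemma mxmZ m n (c : T -> R[i]) (A : T -> 'M[R[i]]_(m, n)) : cm c -> mxm A ->
  mxm (fun x => c x *: A x).
Proof. by move=> hc hA i j; under eq_fun do rewrite mxE; exact: cmM. Qed.

Lemma mxm_tr m n (A : T -> 'M[R[i]]_(m, n)) : mxm A -> mxm (fun x => (A x) ^t*).
Proof. by move=> hA i j; under eq_fun do rewrite !mxE; exact: cm_conj. Qed.

Lemma mxm_if m n (b : T -> bool) (A B : T -> 'M[R[i]]_(m, n)) :
  measurable_fun setT b -> mxm A -> mxm B ->
  mxm (fun x => if b x then A x else B x).
Proof.
move=> mb hA hB i j.
rewrite (_ : (fun x => _) = fun x => if b x then A x i j else B x i j).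
  exact: cm_if.
by apply/funext => x; case: ifP.
Qed.

Lemma cm_det n (A : T -> 'M[R[i]]_n) : mxm A -> cm (fun x => \det (A x)).
Proof.
move=> hA; apply: cm_sum => s _; apply: cmM; first exact: cm_cst.
by apply: cm_prod => i _; exact: hA.
Qed.

Lemma cm_trace n (A : T -> 'M[R[i]]_n) : mxm A -> cm (fun x => \tr (A x)).
Proof. by move=> hA; apply: cm_sum => s _; exact: hA. Qed.

Lemma cm_eq0 f : cm f -> measurable_fun setT (fun x => f x == 0).
Proof.
move=> [f1 f2]; rewrite (_ : (fun x => _) = fun x => (complex.Re (f x) == 0) && (complex.Im (f x) == 0)).
  by apply: measurable_and; apply: measurable_fun_eqr => //; exact: measurable_cst.
by apply/funext => x; rewrite eq_complex.
Qed.

(** By Cramer's rule, and invertibility is a measurable condition on the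
    determinant. *)
Lemma mxm_inv n (A : T -> 'M[R[i]]_n) : mxm A -> mxm (fun x => invmx (A x)).
Proof.
move=> hA; rewrite /invmx; apply: mxm_if => //.
  rewrite (_ : (fun x => _) = (fun x => ~~ (\det (A x) == 0))).
    exact/measurable_neg/cm_eq0/cm_det.
  by apply/funext => x; rewrite unitmxE unitfE.
apply: mxmZ; first exact/cmV/cm_det.
move=> i j; under eq_fun do rewrite mxE; rewrite /cofactor.
apply: cmM; first exact: cm_cst.
apply: cm_det => k l; under eq_fun do rewrite !mxE; exact: hA.
Qed.

Lemma measurable_fn m n (A : T -> 'M[R[i]]_(m, n)) : mxm A ->
  measurable_fun setT (fun x => fn (A x)).
Proof.
move=> hA; apply: measurable_sqrt_ge0; first by move=> x; exact: sum_sqr_ge0.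
apply: measurable_sum => ij; apply: measurable_funX.
exact/measurable_normc/hA.
Qed.

Lemma measurable_eqmx m n (A B : T -> 'M[R[i]]_(m, n)) : mxm A -> mxm B ->
  measurable_fun setT (fun x => A x == B x).
Proof.
move=> hA hB; rewrite (_ : (fun x => _) = (fun x => fn (A x - B x) == 0)).
  apply: measurable_fun_eqr; last exact: measurable_cst.
  exact/measurable_fn/mxmB.
apply/funext => x; apply/eqP/eqP => [->|/fn_eq0/eqP]; first by rewrite subrr fn0.
by rewrite subr_eq0 => /eqP.
Qed.

(** Powers of a square matrix of any size; the ring structure on matrices
    is only available for nonzero sizes. *)
Fixpoint mpow n (A : 'M[R[i]]_n) (k : nat) : 'M[R[i]]_n :=
  if k is k'.+1 then A *m mpow A k' else 1%:M.

Lemma mxm_pow n (A : T -> 'M[R[i]]_n) k : mxm A -> mxm (fun x => mpow (A x) k).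
Proof.
by move=> hA; elim: k => [|k IH] /=; [exact: mxm_cst|exact: mxmM].
Qed.

End cmeasurable.

(** * Measurability of positivity and of the operator norm *)

Section spectral_tests.
Context {R : realType}.
Implicit Types (m n q : nat).

Lemma cvg_sumr (I : Type) (r : seq I) (P : pred I) (f : I -> nat -> R) (l : I -> R) :
  (forall i, P i -> f i k @[k --> \oo] --> l i) ->
  (\sum_(i <- r | P i) f i k) @[k --> \oo] --> \sum_(i <- r | P i) l i.
Proof. by move=> h; apply: cvg_big => //; exact: add_continuous. Qed.

(** Tests of this kind turn a bound on all eigenvalues into a countable
    condition on traces of powers, which are measurable in the matrix. *)
Lemma sumpow_lt1 n (z : 'I_n -> R) : (forall i, 0 <= z i < 1) ->
  exists k, \sum_i z i ^+ k < 1.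
Proof.
move=> hz.
have : (fun k => \sum_i z i ^+ k) @ \oo --> (\sum_(i < n) (0 : R)).
  apply: cvg_sumr => i _; apply: cvg_expr.
  by have /andP[? ?] := hz i; rewrite ger0_norm.
rewrite big1// => h.
have := cvgr_lt _ h 1 ltr01; move=> [k _ /(_ k (leqnn k)) hk]; by exists k.
Qed.

Lemma mpow_udiag n (P : 'M[R[i]]_n) d k : P \in unitmx ->
  mpow (udiag P d) k = udiag P (fun i => d i ^+ k).
Proof.
move=> uP; elim: k => [|k IH] /=.
  by apply/esym/udiag1 => // i; rewrite expr0.
rewrite IH; apply: (etrans (udiagM _ _ uP)); congr (udiag P _).
by apply/funext => i; rewrite exprS.
Qed.

Lemma tr_mpow_herm n (A : 'M[R[i]]_n) k : A ^t* = A ->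
  complex.Re (\tr (mpow A k)) = \sum_i sd A i ^+ k.
Proof.
by move=> hA; rewrite {1}(herm_udiag hA) mpow_udiag ?spV// trace_udiag ?spV.
Qed.

(** A number larger than every eigenvalue in modulus, see [pdc_gt]. *)
Definition pdc n (A : 'M[R[i]]_n) : R := 1 + fn A ^+ 2.

Lemma fn_herm_sq n (A : 'M[R[i]]_n) : A ^t* = A -> fn A ^+ 2 = \sum_i sd A i ^+ 2.
Proof.
move=> hA; rewrite -tr_mpow_herm//= mulmx1.
suff -> : \tr (A *m A) = ((fn A ^+ 2)%:C)%C by [].
rewrite fn_sq /mxtrace rmorph_sum/=; apply: eq_bigr => i _.
rewrite mxE rmorph_sum/=; apply: eq_bigr => j _.
by rewrite normc_sq add_Re2_Im2 sqr_normc -{2}hA !mxE.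
Qed.

Lemma pdc_gt n (A : 'M[R[i]]_n) i : A ^t* = A -> `|sd A i| < pdc A.
Proof.
move=> hA; apply: (@le_lt_trans _ _ (fn A)); last first.
  by rewrite /pdc; have := sqr_ge0 (fn A - 1); rewrite sqrrB1; have := fn_ge0 A; nra.
rewrite -ler_sqr ?nnegrE ?fn_ge0// fn_herm_sq// real_normK ?num_real//.
by rewrite (bigD1 i)//= lerDl sumr_ge0// => j _; exact: sqr_ge0.
Qed.

(** The eigenvalues of c - A lie in [0, 2c] when c exceeds the spectral
    radius of A, and A is positive definite exactly when they are all below
    c, that is, when the trace of (c - A)^k is less than c^k for some k. *)
Lemma posdef_test n (A : 'M[R[i]]_n) : posdefmx A <->
  A ^t* = A /\
  exists k, complex.Re (\tr (mpow (((pdc A)%:C)%C%:M - A) k)) < pdc A ^+ k.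
Proof.
have c0 : 0 < pdc A by rewrite /pdc ltr_wpDr// sqr_ge0.
suff H : A ^t* = A -> forall k, complex.Re (\tr (mpow (((pdc A)%:C)%C%:M - A) k)) =
    \sum_i (pdc A - sd A i) ^+ k.
  split=> [pA|[hA [k]]].
    have hA := posdef_tr pA; split => //.
    have [i|k hk] := @sumpow_lt1 n (fun i => (pdc A - sd A i) / pdc A).
      have := posdef_sd pA i; have := pdc_gt i hA; rewrite ltr_norml => /andP[h1 h2] h3.
      by rewrite ltr_pdivrMr// mul1r divr_ge0 ?(ltW c0)//=; lra.
    exists k; rewrite H//.
    rewrite -[ltRHS]mul1r -ltr_pdivrMr ?exprn_gt0// mulr_suml.
    by under eq_bigr do rewrite -expr_div_n.
  rewrite H// => hk; apply/posdefE; split => // j.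
  rewrite ltNge; apply/negP => dj; move: hk; apply/negP; rewrite -leNgt.
  rewrite (bigD1 j)//= -[leLHS]addr0 lerD//.
    by rewrite lerXn2r ?nnegrE; lra.
  apply: sumr_ge0 => i _; apply: exprn_ge0.
  by have := pdc_gt i hA; rewrite ltr_norml => /andP[]; lra.
move=> hA k.
have -> : ((pdc A)%:C)%C%:M - A = udiag (spectralmx A) (fun i => pdc A - sd A i).
  rewrite {2}(herm_udiag hA).
  have -> : ((pdc A)%:C)%C%:M = udiag (spectralmx A) (fun=> pdc A).
    rewrite /udiag (_ : cdiag _ = ((pdc A)%:C)%C%:M).
      by rewrite mul_mx_scalar -scalemxAl mulVmx ?spV// scalemx1.
    by rewrite -diag_const_mx; congr diag_mx; apply/rowP => j; rewrite !mxE.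
  apply/eqP; rewrite subr_eq udiagD; apply/eqP; congr udiag; apply/funext => i.
  by rewrite subrK.
by rewrite mpow_udiag ?spV// trace_udiag ?spV.
Qed.

Lemma gram_tr m n (A : 'M[R[i]]_(m, n)) : (A ^t* *m A) ^t* = A ^t* *m A.
Proof. by rewrite trmx_mul map_mxM/= trmxCK. Qed.

Lemma gram_form m n (A : 'M[R[i]]_(m, n)) v :
  vnorm (A *m v) ^+ 2 = \sum_j sd (A ^t* *m A) j *
    normc ((spectralmx (A ^t* *m A) *m v) j 0) ^+ 2.
Proof.
apply: complexI; rewrite vnorm_sq -udiag_form ?spU// -herm_udiag ?gram_tr//.
by rewrite trmx_mul map_mxM/= !mulmxA.
Qed.

Lemma unitary_vnorm n (P : 'M[R[i]]_n) v : P \is unitarymx -> vnorm (P *m v) = vnorm v.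
Proof.
move=> uP; apply/eqP; rewrite -(@eqrXn2 _ 2)// ?sqrtr_ge0//; apply/eqP.
apply: complexI; rewrite !vnorm_sq trmx_mul map_mxM/=.
by rewrite -mulmxA (mulmxA (P ^t*)) -invmx_unitary// mulVmx ?unitarymx_unit// mul1mx.
Qed.

(** The eigenvalues of the Gram matrix are values of |A v|^2 on unit
    vectors, hence nonnegative and at most the square of the operator norm. *)
Lemma sd_gram_eigvec m n (A : 'M[R[i]]_(m, n)) i :
  exists2 v : 'cV[R[i]]_n, vnorm v = 1 & vnorm (A *m v) ^+ 2 = sd (A ^t* *m A) i.
Proof.
set H := A ^t* *m A; pose e : 'cV[R[i]]_n := delta_mx i 0.
have e1 : vnorm e = 1.
  apply/eqP; rewrite -(@eqrXn2 _ 2)// ?sqrtr_ge0// expr1n vnormE fn_sq.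
  rewrite (bigD1 i)//= big_ord1 mxE !eqxx normc1 expr1n big1 ?addr0//.
  by move=> k kj; rewrite big_ord1 mxE (negbTE kj) normc0 expr0n.
exists (invmx (spectralmx H) *m e).
  by rewrite -(unitary_vnorm _ (spU H)) mulKVmx ?spV.
rewrite gram_form mulKVmx ?spV// (bigD1 i)//= mxE !eqxx normc1 expr1n mulr1.
rewrite big1 ?addr0// => k ki; rewrite mxE (negbTE ki) normc0 expr0n/= mulr0//.
Qed.

(** The squared operator norm is the largest eigenvalue of the Gram matrix. *)
Lemma opnorm_test m n (A : 'M[R[i]]_(m, n)) r : 0 < r -> (opnorm A < r <->
  exists k, complex.Re (\tr (mpow (A ^t* *m A) k)) < (r ^+ 2) ^+ k).
Proof.
move=> r0; set H := A ^t* *m A.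
have hH : H ^t* = H by exact: gram_tr.
have d0 i : 0 <= sd H i by have [v _ <-] := sd_gram_eigvec A i; exact: sqr_ge0.
split=> [h|[k]].
  have [i|k hk] := @sumpow_lt1 n (fun i => sd H i / r ^+ 2).
    rewrite divr_ge0 ?sqr_ge0//= ltr_pdivrMr ?exprn_gt0// mul1r.
    have [v v1 <-] := sd_gram_eigvec A i.
    rewrite ltr_sqr ?nnegrE ?sqrtr_ge0 ?(ltW r0)//; apply: le_lt_trans h.
    by rewrite -[leRHS]mulr1 -v1 opnorm_ub.
  exists k; rewrite tr_mpow_herm//.
  rewrite -[ltRHS]mul1r -ltr_pdivrMr ?exprn_gt0// mulr_suml.
  by under eq_bigr do rewrite -expr_div_n.
rewrite tr_mpow_herm// => hk.
have dr i : sd H i < r ^+ 2.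
  rewrite ltNge; apply/negP => dj; move: hk; apply/negP; rewrite -leNgt.
  rewrite (bigD1 i)//= -[leLHS]addr0 lerD//.
    by rewrite lerXn2r ?nnegrE ?sqr_ge0.
  by apply: sumr_ge0 => j _; apply: exprn_ge0.
pose M := \big[Order.max/0]_i sd H i.
have M0 : 0 <= M by apply: (big_ind (fun x => 0 <= x)) => // x y x0 y0; rewrite le_max x0.
have Mr : M < r ^+ 2.
  rewrite /M; elim/big_ind : _ => //; first by rewrite exprn_gt0.
  by move=> x y xr yr; rewrite gt_max xr.
have dM i : sd H i <= M by exact: le_bigmax.
apply: (@le_lt_trans _ _ (Num.sqrt M)).
  apply: opnorm_le; first exact: sqrtr_ge0.
  move=> v; rewrite -ler_sqr ?nnegrE ?mulr_ge0 ?sqrtr_ge0//.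
  rewrite exprMn gram_form -/H (sqr_sqrtr M0) -(unitary_vnorm v (spU H)).
  rewrite [vnorm _ ^+ 2]sqr_sqrtr ?sum_sqr_ge0// mulr_sumr.
  by apply: ler_sum => i _; apply: ler_wpM2r; rewrite ?sqr_ge0.
by rewrite -ltr_sqr ?nnegrE ?sqrtr_ge0 ?(ltW r0)// sqr_sqrtr.
Qed.

End spectral_tests.

Section measurable_spectral.
Context {dd : measure_display} {T : measurableType dd} {R : realType}.
Implicit Types (m n q : nat).

Lemma measurable_exists (b : nat -> T -> bool) (c : T -> bool) :
  (forall x, c x <-> exists k, b k x) ->
  (forall k, measurable_fun setT (b k)) -> measurable_fun setT c.
Proof.
move=> h mb; apply: (measurable_fun_bool true).
rewrite (_ : _ `&` _ = \bigcup_k (setT `&` (b k) @^-1` [set true])).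
  apply: bigcup_measurable => k _; exact: mb.
apply/seteqP; split=> [x [_ /h [k bk]]|x [k _ [_ /= bk]]]; first by exists k.
by split=> //; apply/h; exists k.
Qed.

Lemma measurable_posdef n (A : T -> 'M[R[i]]_n) : mxm A ->
  measurable_fun setT (fun x => `[< posdefmx (A x) >]).
Proof.
move=> mA.
have mc : measurable_fun setT (fun x => pdc (A x)).
  by apply: measurable_funD => //; exact: measurable_funX (measurable_fn mA).
rewrite (_ : (fun x => _) = (fun x => ((A x) ^t* == A x) &&
  `[< exists k, complex.Re (\tr (mpow (((pdc (A x))%:C)%C%:M - A x) k)) < pdc (A x) ^+ k >])).
  apply: measurable_and; first by apply: measurable_eqmx => //; exact: mxm_tr.
  apply: (@measurable_exists (fun k x => complex.Re (\tr (mpow (((pdc (A x))%:C)%C%:M - A x) k)) < pdc (A x) ^+ k)).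
    by move=> x; split=> /asboolP.
  move=> k; apply: measurable_fun_ltr; last exact: measurable_funX.
  apply: (proj1 (cm_trace _)); apply: mxm_pow; apply: mxmB => //.
  move=> i j; under eq_fun do rewrite mxE -mulr_natr.
  by apply: cmM; [exact: cm_real|exact: cm_cst].
apply/funext => x; apply/asboolP/andP.
  by move/posdef_test => [/eqP h1 h2]; split => //; apply/asboolP.
by move=> [/eqP h1 /asboolP h2]; apply/posdef_test.
Qed.

Lemma measurable_opnorm m n (A : T -> 'M[R[i]]_(m, n)) : mxm A ->
  measurable_fun setT (fun x => opnorm (A x)).
Proof.
move=> mA _; apply: (measurability _ (RGenInftyO.measurableE R)) => //.
move=> _ [_ [r ->] <-]; rewrite setTI.
have [r0|r0] := ltP 0 r; last first.
  rewrite (_ : _ @^-1` _ = set0)//; apply/seteqP; split=> // x /=.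
  rewrite in_itv/= => h; have := opnorm_ge0 (A x); lra.
rewrite (_ : _ @^-1` _ = setT `&` (fun x => opnorm (A x) < r) @^-1` [set true]); last first.
  by apply/seteqP; split=> [x|x []] /=; rewrite in_itv.
have : measurable_fun setT (fun x => opnorm (A x) < r).
  apply: (@measurable_exists (fun k x => complex.Re (\tr (mpow ((A x) ^t* *m A x) k)) < (r ^+ 2) ^+ k)).
    by move=> x; apply: opnorm_test.
  move=> k; apply: measurable_fun_ltr => //.
  apply: (proj1 (cm_trace _)); apply: mxm_pow; apply: mxmM => //; exact: mxm_tr.
by apply.
Qed.

End measurable_spectral.

(** * Measurability of matrix powers *)

Section newton.
Variable R : realType.

(** Newton's iteration for the square root, started above the root.  Its
    terms are rational functions of t, so they preserve measurability in
    the functional calculus. *)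
Fixpoint newton_sqrt (k : nat) (t : R) : R :=
  if k is k'.+1 then (newton_sqrt k' t + t * (newton_sqrt k' t)^-1) * 2^-1 else 1 + t.

(** One step maps an error e to e^2 / (2 x), and e <= x because the iterates
    stay above the root. *)
Lemma newton_sqrt_bound k (t : R) : 0 < t ->
  0 <= newton_sqrt k t - Num.sqrt t <= (1 + t) * 2^-1 ^+ k.
Proof.
move=> t0; set s := Num.sqrt t.
have s0 : 0 < s by rewrite sqrtr_gt0.
have st : t = s * s by rewrite -expr2 sqr_sqrtr// ltW.
elim: k => [|k IH] /=.
  rewrite expr0 mulr1 st; apply/andP; split; nra.
set x := newton_sqrt k t in IH *; move: IH => /andP[h1 h2].
have x0 : 0 < x by lra.
have -> : (x + t * x^-1) * 2^-1 - s = (x - s) * (x - s) * x^-1 * 2^-1.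
  by rewrite st; field; rewrite gt_eqF.
have xs : (x - s) * x^-1 <= 1 by rewrite ler_pdivrMr// mul1r; lra.
have xi : 0 < x^-1 by rewrite invr_gt0.
apply/andP; split; first by rewrite !mulr_ge0// ltW.
rewrite exprSr mulrA ler_wpM2r// (le_trans _ h2)//.
by rewrite -mulrA ler_piMr.
Qed.

Lemma newton_sqrt_gt0 k (t : R) : 0 < t -> 0 < newton_sqrt k t.
Proof.
move=> t0; have /andP[h _] := newton_sqrt_bound k t0.
have : 0 < Num.sqrt t by rewrite sqrtr_gt0.
lra.
Qed.

Lemma newton_sqrt_cvg (t : R) : 0 < t -> newton_sqrt k t @[k --> \oo] --> Num.sqrt t.
Proof.
move=> t0.
have h0 : ((1 + t) * 2^-1 ^+ k : R) @[k --> \oo] --> (0 : R).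
  rewrite -[X in _ --> X](mulr0 (1 + t)); apply: cvgM; first exact: cvg_cst.
  apply: cvg_expr.
  by rewrite ger0_norm ?invr_ge0// invf_lt1// ltr1n.
have h1 : (newton_sqrt k t - Num.sqrt t) @[k --> \oo] --> (0 : R).
  apply: (@squeeze_cvgr _ _ _ R (fun=> 0) (fun k => (1 + t) * 2^-1 ^+ k)) => //.
    by apply: nearW => k; exact: newton_sqrt_bound.
  exact: cvg_cst.
rewrite -[X in _ --> X]add0r.
rewrite (_ : (fun k => newton_sqrt k t) =
  (fun k => newton_sqrt k t - Num.sqrt t + Num.sqrt t)).
  by apply: cvgD => //; exact: cvg_cst.
by apply/funext => k; rewrite subrK.
Qed.

(** The 2^n-th root, by iterated square roots. *)
Definition root2 n (t : R) : R := iter n Num.sqrt t.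

Lemma root2E n (t : R) : 0 < t -> root2 n t = t `^ (2^-1 ^+ n).
Proof.
move=> t0; elim: n => [|n IH]; first by rewrite expr0 powRr1// ltW.
rewrite /root2/= -/(root2 n t) IH -powR12_sqrt ?powR_ge0// -powRrM.
by rewrite exprSr.
Qed.

(** Real powers are limits of integer powers of dyadic roots. *)
Lemma dyadic_pow_cvg (s t : R) : 0 <= s -> 0 < t ->
  (root2 n t ^+ Num.truncn (2 ^+ n * s)) @[n --> \oo] --> t `^ s.
Proof.
move=> s0 t0.
have E n : root2 n t ^+ Num.truncn (2 ^+ n * s) =
    expR ((2^-1 ^+ n * (Num.truncn (2 ^+ n * s))%:R) * ln t).
  rewrite root2E// -powR_mulrn ?powR_ge0// -powRrM /powR gt_eqF//.
under eq_fun do rewrite E.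
rewrite /powR gt_eqF//.
apply: (@continuous_cvg _ _ _ _ _ _ expR); first exact: continuous_expR.
apply: cvgM; last exact: cvg_cst.
have h0 : (2^-1 ^+ k : R) @[k --> \oo] --> (0 : R).
  apply: cvg_expr; by rewrite ger0_norm ?invr_ge0// invf_lt1// ltr1n.
have h1 : (s - 2^-1 ^+ k : R) @[k --> \oo] --> s.
  by rewrite -[X in _ --> X]subr0; apply: cvgB => //; exact: cvg_cst.
apply: (@squeeze_cvgr _ _ _ R (fun k => s - 2^-1 ^+ k) (fun=> s)) => //; last exact: cvg_cst.
apply: nearW => n.
have p0 : 0 < (2 : R) ^+ n by rewrite exprn_gt0.
have := @truncn_itv _ (2 ^+ n * s); rewrite mulr_ge0// ?(ltW p0)// => /(_ isT) /andP[k1 k2].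
rewrite exprVn [X in _ <= X <= _]mulrC; apply/andP; split.
  rewrite ler_pdivlMr// mulrBl mulVf ?gt_eqF// lerBlDr natr1 mulrC.
  exact: ltW.
by rewrite ler_pdivrMr// (mulrC s).
Qed.

End newton.

Lemma Re_mulr (R : realType) (z : R[i]) (r : R) : complex.Re (z * (r%:C)%C) = complex.Re z * r.
Proof. by case: z => a b; rewrite /= mulr0 subr0. Qed.

Lemma Im_mulr (R : realType) (z : R[i]) (r : R) : complex.Im (z * (r%:C)%C) = complex.Im z * r.
Proof. by case: z => a b; rewrite /= mulr0 add0r. Qed.

Lemma cvg_congr (R : realType) (u v : nat -> R) (a b : R) : (forall k, u k = v k) ->
  a = b -> v k @[k --> \oo] --> b -> u k @[k --> \oo] --> a.
Proof. by move=> /funext -> ->. Qed.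

Opaque spectralmx spectral_diag.

Section measurable_mxpow.
Context {dd : measure_display} {T : measurableType dd} {R : realType}.

Section good.
Variables (n : nat) (A : T -> 'M[R[i]]_n).
Hypotheses (mA : mxm A) (pA : forall x, posdefmx (A x)).

(** The functional calculus of A, through a basis that may depend on x in a
    nonmeasurable way. *)
Definition fcalc (phi : R -> R) (x : T) : 'M[R[i]]_n :=
  udiag (spectralmx (A x)) (fun j => phi (sd (A x) j)).

(** The functions [phi] for which the functional calculus of the family is
    measurable.  They contain the constants and the identity, and are closed
    under the field operations and pointwise limits, hence contain all
    real powers. *)
Definition good (phi : R -> R) : Prop := mxm (fcalc phi).

Lemma good_ext phi psi : (forall t, 0 < t -> phi t = psi t) -> good phi -> good psi.
Proof.
move=> h; rewrite /good; suff -> : fcalc phi = fcalc psi by [].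
apply/funext => x; rewrite /fcalc; apply: congr1; apply/funext => j; apply: h.
exact: posdef_sd.
Qed.

Lemma good_cst c : good (fun=> c).
Proof.
rewrite /good (_ : fcalc _ = fun=> ((c%:C)%C)%:M); first exact: mxm_cst.
apply/funext => x; rewrite /fcalc /udiag (_ : cdiag _ = ((c%:C)%C)%:M).
  by rewrite mul_mx_scalar -scalemxAl mulVmx ?spV// scalemx1.
by rewrite -diag_const_mx; congr diag_mx; apply/rowP => j; rewrite !mxE.
Qed.

Lemma good_id : good id.
Proof.
rewrite /good; suff -> : fcalc id = A by [].
apply/funext => x; apply/esym.
exact/herm_udiag/posdef_tr/pA.
Qed.

Lemma goodD phi psi : good phi -> good psi -> good (fun t => phi t + psi t).
Proof.
move=> h1 h2; rewrite /good (_ : fcalc _ = fun x => fcalc phi x + fcalc psi x).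
  exact: (mxmD h1 h2).
by apply/funext => x; rewrite /fcalc udiagD.
Qed.

Lemma goodM phi psi : good phi -> good psi -> good (fun t => phi t * psi t).
Proof.
move=> h1 h2; rewrite /good (_ : fcalc _ = fun x => fcalc phi x *m fcalc psi x).
  exact: (mxmM h1 h2).
by apply/funext => x; rewrite /fcalc (udiagM _ _ (spV _)).
Qed.

Lemma goodV phi : (forall t, 0 < t -> 0 < phi t) -> good phi -> good (fun t => (phi t)^-1).
Proof.
move=> h0 h; rewrite /good (_ : fcalc _ = fun x => invmx (fcalc phi x)).
  exact: (mxm_inv h).
apply/funext => x.
have E : fcalc phi x *m fcalc (fun t => (phi t)^-1) x = 1%:M.
  rewrite /fcalc (udiagM _ _ (spV _)); apply: udiag1; first exact: spV.
  by move=> j; rewrite mulfV// gt_eqF// h0// posdef_sd.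
have [u _] := mulmx1_unit E.
by rewrite -[LHS](mulKmx u) E mulmx1.
Qed.

Lemma goodX phi k : good phi -> good (fun t => phi t ^+ k).
Proof.
move=> h; elim: k => [|k IH].
  apply: (@good_ext (fun=> 1)); last exact: good_cst.
  by move=> t _; rewrite expr0.
apply: (@good_ext (fun t => phi t * phi t ^+ k)); last exact: (goodM h IH).
by move=> t _; rewrite exprS.
Qed.

Lemma fcalc_entry phi x i j : fcalc phi x i j =
  \sum_l invmx (spectralmx (A x)) i l * spectralmx (A x) l j * ((phi (sd (A x) l))%:C)%C.
Proof.
rewrite /fcalc /udiag mxE; apply: eq_bigr => l _.
by rewrite mul_mx_diag !mxE mulrAC.
Qed.

(** Each entry of the functional calculus is, at a given point, a fixed
    linear combination of the values of [phi] on the spectrum; no uniformity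
    or measurability of the eigenvectors enters. *)
Lemma good_lim (phi : nat -> R -> R) psi : (forall k, good (phi k)) ->
  (forall t, 0 < t -> phi k t @[k --> \oo] --> psi t) -> good psi.
Proof.
move=> h hc i j; split.
  apply: (@measurable_fun_cvg _ _ _ setT (fun k x => complex.Re (fcalc (phi k) x i j))).
    by move=> k; case: (h k i j).
  move=> x _.
  have E f : complex.Re (fcalc f x i j) = \sum_l complex.Re (invmx (spectralmx (A x)) i l * spectralmx (A x) l j) * f (sd (A x) l).
    rewrite fcalc_entry (raddf_sum (@complex.Re R : Rcomplex R -> R))/=.
    by apply: eq_bigr => l _; rewrite Re_mulr.
  apply: (cvg_congr (fun k => E (phi k)) (E psi)).
  apply: cvg_sumr => l _; apply: cvgM; first exact: cvg_cst.
  apply: hc; exact: posdef_sd.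
apply: (@measurable_fun_cvg _ _ _ setT (fun k x => complex.Im (fcalc (phi k) x i j))).
  by move=> k; case: (h k i j).
move=> x _.
have E f : complex.Im (fcalc f x i j) = \sum_l complex.Im (invmx (spectralmx (A x)) i l * spectralmx (A x) l j) * f (sd (A x) l).
  rewrite fcalc_entry (raddf_sum (@complex.Im R : Rcomplex R -> R))/=.
  by apply: eq_bigr => l _; rewrite Im_mulr.
apply: (cvg_congr (fun k => E (phi k)) (E psi)).
apply: cvg_sumr => l _; apply: cvgM; first exact: cvg_cst.
  apply: hc; exact: posdef_sd.
Qed.

Lemma good_newton phi k : (forall t, 0 < t -> 0 < phi t) -> good phi ->
  good (fun t => newton_sqrt k (phi t)).
Proof.
move=> p0 h; elim: k => [|k IH].
  by apply: (goodD _ h); exact: good_cst.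
apply: (@goodM (fun t => newton_sqrt k (phi t) + phi t * (newton_sqrt k (phi t))^-1) (fun=> 2^-1)); last exact: good_cst.
apply: (goodD IH); apply: (goodM h); apply: (goodV _ IH) => t t0.
exact/newton_sqrt_gt0/p0.
Qed.

Lemma good_root2 k : good (root2 k).
Proof.
elim: k => [|k IH]; first exact: good_id.
have r0 (t : R) : 0 < t -> 0 < root2 k t by move=> t0; rewrite root2E// powR_gt0.
apply: (@good_lim (fun l t => newton_sqrt l (root2 k t))).
  by move=> l; exact: (@good_newton (root2 k) l r0 IH).
by move=> t t0; apply: newton_sqrt_cvg; exact: r0.
Qed.

Lemma good_powR s : good (fun t => t `^ s).
Proof.
have H r : 0 <= r -> good (fun t => t `^ r).
  move=> r0; apply: (@good_lim (fun k t => root2 k t ^+ Num.truncn (2 ^+ k * r))).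
    by move=> k; apply: goodX; exact: good_root2.
  by move=> t t0; exact: dyadic_pow_cvg.
have [s0|s0] := leP 0 s; first exact: H.
apply: (@good_ext (fun t => (t `^ (- s))^-1)).
  by move=> t t0; rewrite -powRN opprK.
apply: (@goodV (fun t => t `^ (- s))); first by move=> t t0; rewrite powR_gt0.
by apply: H; rewrite oppr_ge0 ltW.
Qed.

End good.

(** Outside the positive definite matrices the power is 0, and the set of
    positive definite matrices is measurable; replacing the other matrices
    by 1 gives a family to which [good_powR] applies. *)
Lemma mxm_mxpow n (A : T -> 'M[R[i]]_n) s : mxm A -> mxm (fun x => mxpow (A x) s).
Proof.
move=> mA.
pose A' x := if `[< posdefmx (A x) >] then A x else 1%:M.
have mA' : mxm A' by apply: mxm_if; [exact: measurable_posdef|exact: mA|exact: mxm_cst].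
have pA' x : posdefmx (A' x).
  by rewrite /A'; case: asboolP => // _; exact: posdef1.
rewrite (_ : (fun x => _) = fun x => if `[< posdefmx (A x) >] then mxpow (A' x) s else 0).
  apply: mxm_if; [exact: measurable_posdef| |exact: mxm_cst].
  rewrite (_ : (fun x => _) = fcalc A' (fun t => t `^ s)); first exact: good_powR.
  by apply/funext => x; rewrite (mxpowE _ (pA' x)).
apply/funext => x; rewrite /A'; case: asboolP => // h; by rewrite (mxpowN s h).
Qed.

End measurable_mxpow.

Transparent spectralmx spectral_diag.

(** * Lebesgue measure and cubes *)

Section leb_cube.
Variable R : realType.

Lemma measurable_cube d (a : Rspace R d) (l : R) : measurable (cube a l).
Proof.
rewrite (_ : cube a l = \bigcap_(i in [set: 'I_d]) ((fun x : Rspace R d => tnth x i) @^-1` `[tnth a i, tnth a i + l[%classic)).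
  apply: fin_bigcap_measurable; first exact: finite_finset.
  move=> i _; rewrite -[X in measurable X]setTI.
  exact: (measurable_tnth i measurableT (measurable_itv _)).
apply/seteqP; split=> x /=.
  by move=> h i _ /=; rewrite in_itv/=; exact: h.
by move=> h i; have := h i I; rewrite /= in_itv.
Qed.

Lemma leb_cube d (a : Rspace R d) (l : R) : 0 <= l ->
  leb d (cube a l) = ((l ^+ d)%:E)%E.
Proof.
move=> l0; elim: d a => [|d IH] a.
  rewrite /leb/= diracE expr0 mem_set//.
  by move=> [].
have -> : leb d.+1 (cube a l) = ((leb d \x @lebesgue_measure R)%E
    (cube [tuple of behead a] l `*` `[thead a, thead a + l[%classic)).
  transitivity (pushforward (leb d \x @lebesgue_measure R)%E (@cons_Rd R d) (cube a l)); first by [].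
  rewrite /pushforward; congr ((_ \x _)%E _).
  apply/seteqP; split=> -[x y] /=.
    move=> h; split=> [i|]; last first.
      by have := h ord0; rewrite /= in_itv/= /thead !(tnth_nth 0)/=.
    have := h (lift ord0 i); by rewrite !(tnth_nth 0) /= /bump/= add1n/= !nth_behead.
  move=> [h]; rewrite in_itv/= => h0 i.
  have [->|[j ->]] : i = ord0 \/ exists j, i = lift ord0 j.
  - by case: (unliftP ord0 i) => [j ->|->]; [right; exists j|left].
  - by move: h0; rewrite /thead !(tnth_nth 0).
  - by have := h j; rewrite !(tnth_nth 0) /= /bump/= add1n/= !nth_behead.
have E : @lebesgue_measure R `[thead a, thead a + l[%classic = (l%:E)%E.
  rewrite lebesgue_measure_itv/= lte_fin ltrDl.
  case: ltP => [_|l0']; first by rewrite -EFinB addrAC subrr add0r.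
  by apply/esym; congr EFin; apply/eqP; rewrite eq_le l0 l0'.
rewrite product_measure1E; [|exact: measurable_cube|exact: measurable_itv].
rewrite IH exprSr EFinM; congr (_ * _)%E; exact: E.
Qed.

Lemma leb_sigma_finite d : sigma_finite setT (@leb R d).
Proof.
(* the cubes centred at the origin *)
exists (fun n => cube [tuple - n%:R | i < d] (2 * n%:R)).
  apply/seteqP; split=> // x _.
  pose M := \big[Order.max/0]_i `|tnth x i|.
  have M0 : 0 <= M by rewrite /M; apply: (big_ind (fun x => 0 <= x)) => // y z y0 z0; rewrite le_max y0.
  exists (Num.truncn M).+1 => // i; rewrite tnth_mktuple.
  have := truncn_itv M0 => /andP[_ h].
  have : `|tnth x i| <= M by exact: (le_bigmax _ (fun i => `|tnth x i|)).
  move=> h1; have := le_lt_trans h1 h; rewrite ltr_norml => /andP[h2 h3].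
  by apply/andP; split; lra.
move=> n; split; first exact: measurable_cube.
by rewrite leb_cube ?ltry// mulr_ge0.
Qed.

(** An alias of the Lebesgue measure, to carry the sigma-finite structure
    under which Tonelli's theorem is available. *)
Definition lebs d : set (Rspace R d) -> \bar R := leb d.
HB.instance Definition _ d := Measure.on (@lebs d).
HB.instance Definition _ d := @Measure_isSigmaFinite.Build _ _ _ (@lebs d) (@leb_sigma_finite d).

Definition sleb d : {sigma_finite_measure set (Rspace R d) -> \bar R} := @lebs d.

Lemma tonelli d (f : Rspace R d * Rspace R d -> \bar R) :
  measurable_fun setT f -> (forall x, (0 <= f x)%E) ->
  (\int[leb d]_x \int[leb d]_y f (x, y) = \int[leb d]_y \int[leb d]_x f (x, y))%E.
Proof. exact: (@fubini_tonelli _ _ (Rspace R d) (Rspace R d) R (@sleb d) (@sleb d)). Qed.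

Lemma measurable_int2 d (f : Rspace R d * Rspace R d -> \bar R) :
  measurable_fun setT f -> (forall x, (0 <= f x)%E) ->
  measurable_fun setT (fun x => \int[leb d]_y f (x, y))%E.
Proof. exact: (@measurable_fun_fubini_tonelli_F _ _ (Rspace R d) (Rspace R d) R (@sleb d)). Qed.

End leb_cube.

(** * Integrals over cubes *)

Section cube_calculus.
Variables (R : realType) (d : nat).
Notation X := (Rspace R d).

(** A cube, encoded by its corner and its side, so that it can be divided. *)
Definition Cb : Type := X * R.
Implicit Types (c : Cb) (f g : X -> R) (k : R).
Definition cset (c : Cb) : set X := cube c.1 c.2.
Definition vol (c : Cb) : R := c.2 ^+ d.
(** The 2^d subcubes of half the side, indexed by the choice of a half in each
    direction.  Cubes being half-open, they form a partition. *)
Definition child (c : Cb) (e : {ffun 'I_d -> bool}) : Cb :=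
  ([tuple tnth c.1 i + c.2 / 2 * (e i)%:R | i < d], c.2 / 2).

Lemma cubesP (Q : set X) : cubes Q <-> exists2 c : Cb, 0 < c.2 & Q = cset c.
Proof.
by split=> [[a [l [l0 ->]]]|[[a l] /= l0 ->]]; [exists (a, l)|exists a, l].
Qed.

Lemma cubes_cset (c : Cb) : 0 < c.2 -> cubes (cset c).
Proof. by move=> c0; apply/cubesP; exists c. Qed.

Lemma measurable_cset c : measurable (cset c).
Proof. exact: measurable_cube. Qed.
Hint Resolve measurable_cset : core.

Lemma vol_gt0 c : 0 < c.2 -> 0 < vol c.
Proof. by move=> c0; rewrite exprn_gt0. Qed.

Lemma leb_cset c : 0 < c.2 -> leb d (cset c) = ((vol c)%:E)%E.
Proof. by move=> /ltW c0; rewrite leb_cube. Qed.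

Lemma child_gt0 c e : 0 < c.2 -> 0 < (child c e).2.
Proof. by move=> c0; rewrite divr_gt0. Qed.

Lemma vol_child c e : vol (child c e) = (2^-1) ^+ d * vol c.
Proof. by rewrite /vol/= exprMn mulrC. Qed.

Lemma child_sub c e : 0 < c.2 -> cset (child c e) `<=` cset c.
Proof.
case: c => a l /= l0 x h i; have := h i; rewrite /= tnth_mktuple.
by case: (e i); rewrite /= ?mulr1 ?mulr0 ?addr0 => /andP[h1 h2]; apply/andP; split; lra.
Qed.

Lemma cset_children c : 0 < c.2 ->
  cset c = \big[setU/set0]_(e : {ffun 'I_d -> bool}) cset (child c e).
Proof.
move=> c0; rewrite -bigcup_seq; apply/seteqP; split=> [x xc|x [e _ xe]]; last first.
  exact: (child_sub c0 xe).
pose e := [ffun i => (tnth c.1 i + c.2 / 2 : R) <= (tnth x i : R)].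
exists e; first by rewrite /= mem_index_enum.
move=> i; rewrite /= tnth_mktuple ffunE; have /andP[h1 h2] := xc i.
by case: (leP (tnth c.1 i + c.2 / 2 : R) (tnth x i)) => h; rewrite /= ?mulr1 ?mulr0 ?addr0; apply/andP; split; lra.
Qed.

Lemma trivIset_children c : 0 < c.2 -> trivIset setT (fun e => cset (child c e)).
Proof.
move=> c0; apply/trivIsetP => e f _ _ /eqP ef; apply/seteqP; split=> // x [xe xf].
apply: ef; apply/ffunP => i.
have := xe i; have := xf i; rewrite /= !tnth_mktuple.
by case: (e i) (f i) => -[] //=; rewrite ?mulr1 ?mulr0 ?addr0 => /andP[h1 h2] /andP[h3 h4]; exfalso; lra.
Qed.

Definition int (c : Cb) (f : X -> R) : \bar R := (\int[leb d]_(x in cset c) (f x)%:E)%E.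
(** Meaningful for integrable functions only; [int] is the extended real
    integral. *)
Definition I_ (c : Cb) (f : X -> R) : R := fine (int c f).

(** [LI] stands for locally integrable; nonnegativity is included because [int]
    is only applied to such functions. *)
Definition LI (f : X -> R) : Prop :=
  [/\ measurable_fun setT f, (forall x, 0 <= f x) &
      forall c, 0 < c.2 -> (int c f < +oo)%E].

Lemma mEFin (f : X -> R) (D : set X) : measurable_fun setT f ->
  measurable_fun D (fun x => ((f x)%:E)%E).
Proof.
move=> mf; apply: measurable_funTS; exact/measurable_EFinP.
Qed.

Lemma int_ge0 c f : (forall x, 0 <= f x) -> (0 <= int c f)%E.
Proof. by move=> f0; apply: integral_ge0 => x _; rewrite lee_fin. Qed.

Lemma I_ge0 c f : (forall x, 0 <= f x) -> 0 <= I_ c f.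
Proof. by move=> f0; apply: fine_ge0; exact: int_ge0. Qed.

Lemma intE c f : 0 < c.2 -> LI f -> int c f = ((I_ c f)%:E)%E.
Proof.
move=> c0 [mf f0 ff]; rewrite fineK// ge0_fin_numE ?ff//.
exact: int_ge0.
Qed.

Lemma int_mono c f g : measurable_fun setT f -> measurable_fun setT g ->
  (forall x, 0 <= f x) -> (forall x, 0 <= g x) ->
  {ae leb d, forall x, cset c x -> f x <= g x} -> (int c f <= int c g)%E.
Proof.
move=> mf mg f0 g0 h; apply: ae_ge0_le_integral => //.
- by move=> x _; rewrite lee_fin.
- exact: mEFin.
- by move=> x _; rewrite lee_fin.
- exact: mEFin.
Qed.

Lemma LI_le f g : measurable_fun setT f -> (forall x, 0 <= f x) -> LI g ->
  {ae leb d, forall x, f x <= g x} -> LI f.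
Proof.
move=> mf f0 [mg g0 fg] h; split=> // c c0; apply: le_lt_trans (fg c c0).
apply: int_mono => //; apply: filterS h => x hx _; exact: hx.
Qed.

Lemma LI_le0 f g : measurable_fun setT f -> (forall x, 0 <= f x) -> LI g ->
  (forall x, f x <= g x) -> LI f.
Proof. by move=> mf f0 hg h; apply: (LI_le mf f0 hg); apply: aeW. Qed.

Lemma I_mono_ae c f g : 0 < c.2 -> LI f -> LI g ->
  {ae leb d, forall x, cset c x -> f x <= g x} -> I_ c f <= I_ c g.
Proof.
move=> c0 hf hg h; rewrite -lee_fin -!intE//.
by case: hf hg => [mf f0 _] [mg g0 _]; exact: int_mono.
Qed.

Lemma I_mono c f g : 0 < c.2 -> LI f -> LI g ->
  (forall x, cset c x -> f x <= g x) -> I_ c f <= I_ c g.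
Proof. by move=> c0 hf hg h; apply: I_mono_ae => //; apply: aeW. Qed.

Lemma I_eq c f g : (forall x, cset c x -> f x = g x) -> I_ c f = I_ c g.
Proof.
move=> h; rewrite /I_ /int; congr fine; apply: eq_integral => x.
by rewrite inE => /h ->.
Qed.

Lemma intD c f g : measurable_fun setT f -> measurable_fun setT g ->
  (forall x, 0 <= f x) -> (forall x, 0 <= g x) ->
  int c (fun x => f x + g x) = (int c f + int c g)%E.
Proof.
move=> mf mg f0 g0; rewrite /int -ge0_integralD//.
- by move=> x _; rewrite lee_fin.
- exact: mEFin.
- by move=> x _; rewrite lee_fin.
- exact: mEFin.
Qed.

Lemma intZ c k f : 0 <= k -> measurable_fun setT f -> (forall x, 0 <= f x) ->
  int c (fun x => k * f x) = (k%:E * int c f)%E.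
Proof.
move=> k0 mf f0; rewrite /int -ge0_integralZl_EFin//.
- by move=> x _; rewrite lee_fin.
- exact: mEFin.
Qed.

Lemma LID f g : LI f -> LI g -> LI (fun x => f x + g x).
Proof.
move=> [mf f0 hf] [mg g0 hg]; split.
- exact: measurable_funD.
- by move=> x; rewrite addr_ge0.
- by move=> c c0; rewrite intD// lte_add_pinfty ?hf ?hg.
Qed.

Lemma LIZ k f : 0 <= k -> LI f -> LI (fun x => k * f x).
Proof.
move=> k0 [mf f0 hf]; split.
- exact: measurable_funM.
- by move=> x; rewrite mulr_ge0.
- move=> c c0; rewrite intZ// intE//; exact: ltry.
Qed.

Lemma LI_cst k : 0 <= k -> LI (fun=> k).
Proof.
move=> k0; split => // c c0.
by rewrite /int (integral_cst _ (measurable_cset c) k%:E) leb_cset// -EFinM ltry.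
Qed.

Lemma I_D c f g : 0 < c.2 -> LI f -> LI g ->
  I_ c (fun x => f x + g x) = I_ c f + I_ c g.
Proof.
move=> c0 hf hg; apply: EFin_inj.
rewrite EFinD -!intE//; last exact: LID.
by case: hf hg => [mf f0 _] [mg g0 _]; exact: intD.
Qed.

Lemma I_Z c k f : 0 < c.2 -> 0 <= k -> LI f -> I_ c (fun x => k * f x) = k * I_ c f.
Proof.
move=> c0 k0 hf; apply: EFin_inj.
rewrite EFinM -!intE//; last exact: LIZ.
by case: hf => [mf f0 _]; exact: intZ.
Qed.

Lemma I_cst c k : 0 < c.2 -> I_ c (fun=> k) = k * vol c.
Proof.
move=> c0.
by rewrite /I_ /int (integral_cst _ (measurable_cset c) k%:E) leb_cset.
Qed.

Lemma int_children c f : 0 < c.2 -> measurable_fun setT f -> (forall x, 0 <= f x) ->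
  int c f = (\sum_e int (child c e) f)%E.
Proof.
move=> c0 mf f0; rewrite /int (cset_children c0) ge0_integral_bigsetU//.
- exact: index_enum_uniq.
- exact: sub_trivIset (trivIset_children c0).
- exact: mEFin.
- by move=> x _; rewrite lee_fin.
Qed.

Lemma I_children c f : 0 < c.2 -> LI f -> I_ c f = \sum_e I_ (child c e) f.
Proof.
move=> c0 hf; apply: EFin_inj; rewrite -intE// -sumEFin.
case: (hf) => [mf f0 _]; rewrite int_children//.
by apply: eq_bigr => e _; rewrite intE//; exact: child_gt0.
Qed.

Lemma card_children : #|{ffun 'I_d -> bool}| = (2 ^ d)%N.
Proof. by rewrite card_ffun card_bool card_ord. Qed.

Lemma sum_vol_children c : \sum_e vol (child c e) = vol c.
Proof.
under eq_bigr do rewrite vol_child.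
rewrite sumr_const card_children -[LHS]mulr_natl mulrA natrX exprVn mulfV ?mul1r//.
Qed.

Lemma I_child_le c e f : 0 < c.2 -> LI f -> I_ (child c e) f <= I_ c f.
Proof.
move=> c0 hf; rewrite (I_children c0 hf) (bigD1 e)//= lerDl.
by apply: sumr_ge0 => i _; apply: I_ge0; case: hf.
Qed.

End cube_calculus.

(** * Dyadic oscillation of locally integrable functions *)

Import HBSimple.

Section oscillation.
Variables (R : realType) (d : nat).
Notation X := (Rspace R d).
Notation Cb := (Cb R d).
Implicit Types (c : Cb) (f g h : X -> R) (k : R) (N : nat).
Hint Resolve measurable_cset : core.

(** [LS] stands for locally summable: no sign is imposed, unlike in [LI]. *)
Definition LS g : Prop := measurable_fun setT g /\ LI (fun x => `|g x|).

Lemma LS_integrable c g : 0 < c.2 -> LS g -> (leb d).-integrable (cset c) (EFin \o g).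
Proof.
move=> c0 [mg [_ _ hg]]; apply/integrableP; split; first exact: mEFin.
exact: hg c c0.
Qed.

Lemma LS_bounded g k : measurable_fun setT g -> (forall x, `|g x| <= k) -> LS g.
Proof.
move=> mg gk; split => //.
have k0 : 0 <= k by apply: le_trans (gk point).
apply: (@LI_le0 _ _ _ (fun=> k)) => //; last exact: LI_cst.
exact: measurableT_comp.
Qed.

Lemma LSD g h : LS g -> LS h -> LS (fun x => g x + h x).
Proof.
move=> [mg hg] [mh hh]; split; first exact: measurable_funD.
apply: (LI_le0 _ _ (LID hg hh)) => //; last by move=> x; exact: ler_normD.
by apply: measurableT_comp => //; exact: measurable_funD.
Qed.

Lemma LSZ k g : LS g -> LS (fun x => k * g x).
Proof.
move=> [mg hg]; split; first exact: measurable_funM.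
rewrite (_ : (fun x => _) = fun x => `|k| * `|g x|); first exact: LIZ.
by apply/funext => x; rewrite normrM.
Qed.

Lemma LSB g h : LS g -> LS h -> LS (fun x => g x - h x).
Proof.
move=> hg hh; rewrite (_ : (fun x => _) = fun x => g x + (-1) * h x).
  by apply: LSD => //; exact: LSZ.
by apply/funext => x; rewrite mulN1r.
Qed.

Lemma LS_cst k : LS (fun=> k).
Proof. exact: (@LS_bounded _ `|k|). Qed.

Lemma IS_D c g h : 0 < c.2 -> LS g -> LS h ->
  I_ c (fun x => g x + h x) = I_ c g + I_ c h.
Proof.
move=> c0 hg hh; rewrite /I_ /int.
have ig := LS_integrable c0 hg; have ih := LS_integrable c0 hh.
rewrite (_ : (fun x => _) = (fun x => ((EFin \o g) x + (EFin \o h) x)%E))//.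
rewrite (integralD (measurable_cset c) ig ih) fineD//; exact: (integrable_fin_num (measurable_cset c)).
Qed.

Lemma IS_Z c k g : 0 < c.2 -> LS g -> I_ c (fun x => k * g x) = k * I_ c g.
Proof.
move=> c0 hg; rewrite /I_ /int.
have ig := LS_integrable c0 hg.
rewrite (_ : (fun x => _) = (fun x => (k%:E * (EFin \o g) x)%E))//.
rewrite (integralZl (measurable_cset c) ig) fineM//; exact: (integrable_fin_num (measurable_cset c)).
Qed.

Lemma IS_B c g h : 0 < c.2 -> LS g -> LS h ->
  I_ c (fun x => g x - h x) = I_ c g - I_ c h.
Proof.
move=> c0 hg hh; rewrite (@I_eq _ _ _ _ (fun x => g x + (-1) * h x)).
  by rewrite IS_D ?IS_Z ?mulN1r//; exact: LSZ.
by move=> x _; rewrite mulN1r.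
Qed.

Lemma IS_norm c g : 0 < c.2 -> LS g -> `|I_ c g| <= I_ c (fun x => `|g x|).
Proof.
move=> c0 hg; have ig := LS_integrable c0 hg.
rewrite -lee_fin -intE//; last by case: hg.
have -> : ((`|I_ c g|)%:E = `| \int[leb d]_(x in cset c) (EFin \o g) x |)%E.
  by rewrite -(fineK (integrable_fin_num (measurable_cset c) ig)).
exact: (@le_abse_integral _ _ _ (leb d) _ (EFin \o g) (measurable_cset c) (mEFin hg.1)).
Qed.

Definition mean c g := I_ c g / vol c.

Lemma mean_cst c k : 0 < c.2 -> mean c (fun=> k) = k.
Proof. by move=> c0; rewrite /mean I_cst// mulfK// gt_eqF// vol_gt0. Qed.

(** The total oscillation of g around its means over the cubes of the N-th
    dyadic generation inside c. *)
Fixpoint osc N c g : R :=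
  if N is N'.+1 then \sum_e osc N' (child c e) g
  else I_ c (fun x => `|g x - mean c g|).

Lemma osc_ge0 N c g : 0 <= osc N c g.
Proof.
elim: N c => [|N IH] c /=; first exact: I_ge0.
by apply: sumr_ge0 => e _; exact: IH.
Qed.

Lemma LI_norm g : LS g -> LI (fun x => `|g x|).
Proof. by case. Qed.

Lemma LSBc g k : LS g -> LS (fun x => g x - k).
Proof. by move=> hg; apply: (LSB hg); exact: LS_cst. Qed.

Lemma osc0_le c g k : 0 < c.2 -> LS g ->
  osc 0 c g <= 2 * I_ c (fun x => `|g x - k|).
Proof.
move=> c0 hg /=; have v0 := vol_gt0 c0.
have E : `|k - mean c g| * vol c <= I_ c (fun x => `|g x - k|).
  rewrite -[X in _ * X]ger0_norm ?(ltW v0)// -normrM mulrBl.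
  rewrite /mean divfK ?gt_eqF// -I_cst// -IS_B//; last exact: LS_cst.
  apply: le_trans (IS_norm _ _) _ => //; first by apply: LSB => //; exact: LS_cst.
  apply: I_mono => //; [apply: LI_norm|apply: LI_norm|].
  - by apply: LSB => //; exact: LS_cst.
  - exact: LSBc.
  - by move=> x _; rewrite distrC.
rewrite mulrDl mul1r; apply: le_trans (lerD (lexx _) E).
rewrite -I_cst// -I_D//; [|exact/LI_norm/LSBc|exact: LI_cst].
apply: I_mono => //; first exact/LI_norm/LSBc.
  by apply: LID; [exact/LI_norm/LSBc|exact: LI_cst].
by move=> x _; rewrite -[g x - mean c g](subrKA k) ler_normD.
Qed.

Lemma osc_sub N c g h : 0 < c.2 -> LS g -> LS h ->
  osc N c (fun x => g x + h x) <= osc N c g + osc N c h.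
Proof.
move=> + hg hh; elim: N c => [|N IH] c c0 /=.
  rewrite -I_D//; try exact/LI_norm/LSBc.
  apply: I_mono => //; first by apply/LI_norm/LSBc/LSD.
    by apply: LID; exact/LI_norm/LSBc.
  move=> x _; rewrite /mean IS_D// mulrDl opprD addrACA; exact: ler_normD.
rewrite -big_split/=; apply: ler_sum => e _; apply: IH; exact: child_gt0.
Qed.

Lemma osc_Z N c k g : 0 < c.2 -> LS g -> osc N c (fun x => k * g x) = `|k| * osc N c g.
Proof.
move=> + hg; elim: N c => [|N IH] c c0 /=.
  rewrite -I_Z//; last exact/LI_norm/LSBc.
  apply: I_eq => x _; by rewrite /mean IS_Z// -mulrA -mulrBr normrM.
by rewrite mulr_sumr; apply: eq_bigr => e _; apply: IH; exact: child_gt0.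
Qed.

Lemma osc_L1 N c g : 0 < c.2 -> LS g -> osc N c g <= 2 * I_ c (fun x => `|g x|).
Proof.
move=> + hg; elim: N c => [|N IH] c c0.
  apply: le_trans (osc0_le 0 c0 hg) _; rewrite ler_pM2l//.
  rewrite (@I_eq _ _ _ _ (fun x => `|g x|))// => x _; by rewrite subr0.
rewrite (I_children c0 (LI_norm hg)) mulr_sumr /=.
by apply: ler_sum => e _; apply: IH; exact: child_gt0.
Qed.

Lemma osc_cst N c g k : 0 < c.2 -> (forall x, cset c x -> g x = k) -> osc N c g = 0.
Proof.
elim: N c => [|N IH] c c0 gk /=.
  have -> : mean c g = k.
    by rewrite /mean (I_eq (g := fun=> k))// I_cst// mulfK// gt_eqF// vol_gt0.
  rewrite (I_eq (g := fun=> 0)) ?I_cst ?mul0r// => x cx.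
  by rewrite gk// subrr normr0.
rewrite big1// => e _; apply: IH; first exact: child_gt0.
by move=> x ex; apply: gk; exact: (child_sub c0 ex).
Qed.

Lemma osc_eq N c g h : 0 < c.2 -> (forall x, cset c x -> g x = h x) -> osc N c g = osc N c h.
Proof.
elim: N c => [|N IH] c c0 gh /=.
  rewrite /mean (I_eq gh); apply: I_eq => x cx; by rewrite gh.
apply: eq_bigr => e _; apply: IH; first exact: child_gt0.
by move=> x ex; apply: gh; exact: (child_sub c0 ex).
Qed.

(** Multiplication by bounded functions controls oscillation, which makes the
    sets whose indicator has vanishing oscillation stable under intersection. *)
Lemma osc_mul N c g h : 0 < c.2 -> LS g -> LS h ->
  (forall x, `|g x| <= 1) -> (forall x, `|h x| <= 1) ->
  osc N c (fun x => g x * h x) <= 2 * (osc N c g + osc N c h).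
Proof.
move=> + hg hh g1 h1.
have hgh : LS (fun x => g x * h x).
  apply: (@LS_bounded _ 1); first by apply: measurable_funM; [case: hg|case: hh].
  by move=> x; rewrite normrM mulr_ile1.
elim: N c => [|N IH] c c0.
  apply: le_trans (osc0_le (mean c g * mean c h) c0 hgh) _; rewrite ler_pM2l//=.
  rewrite -I_D//; try exact/LI_norm/LSBc.
  apply: I_mono => //; first exact/LI_norm/LSBc.
    by apply: LID; exact/LI_norm/LSBc.
  move=> x _.
  have -> : g x * h x - mean c g * mean c h =
     (g x - mean c g) * mean c h + g x * (h x - mean c h) by ring.
  apply: le_trans (ler_normD _ _) _; rewrite (normrM (g x)) (normrM (g x - _)); apply: lerD.
    apply: ler_piMr => //; rewrite /mean normrM normfV ler_pdivrMr ?normr_gt0 ?gt_eqF ?vol_gt0//.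
    rewrite mul1r (ger0_norm (ltW (vol_gt0 c0))).
    apply: le_trans (IS_norm c0 hh) _; rewrite -[leRHS]mul1r -I_cst//.
    by apply: I_mono => //; [exact: LI_norm|exact: LI_cst].
  by rewrite ler_piMl.
rewrite /= -big_split/= mulr_sumr.
by apply: ler_sum => e _; apply: IH; exact: child_gt0.
Qed.

Definition slab (i : 'I_d) (t : R) : set X := [set x | tnth x i < t].

(** The indicator of a half-space is constant on all children except those
    of one of the two layers orthogonal to the i-th direction, so half of
    the volume is discarded at each generation. *)
Lemma osc_slab N c i t : 0 < c.2 ->
  osc N c (\1_(slab i t)) <= 2 * (2^-1 ^+ N * vol c).
Proof.
have ms : measurable (slab i t).
  rewrite (_ : slab i t = setT `&` (fun x : X => tnth x i) @^-1` `]-oo, t[%classic).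
    exact: (measurable_tnth i measurableT (measurable_itv _)).
  by apply/seteqP; split=> [x h|x [_]] /=; rewrite ?in_itv.
have LS1 : LS (\1_(slab i t)).
  apply: (@LS_bounded _ 1); first exact: measurable_indic.
  by move=> x; rewrite indicE; case: (_ \in _); rewrite ?normr1 ?normr0.
elim: N c => [|N IH] c c0.
  rewrite expr0 mul1r; apply: le_trans (osc_L1 0 c0 LS1) _; rewrite ler_pM2l//.
  rewrite -[leRHS]mul1r -I_cst//; apply: I_mono => //; [exact: LI_norm|exact: LI_cst|].
  by move=> x _; rewrite indicE; case: (_ \in _); rewrite ?normr1 ?normr0.
pose b := (tnth c.1 i + c.2 / 2 : R) < t.
rewrite /= (bigID (fun e : {ffun 'I_d -> bool} => e i == b))/=.
rewrite [X in _ + X]big1 ?addr0; last first.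
  move=> e eib; have ce0 := child_gt0 e c0.
  apply: (@osc_cst _ _ _ (b%:R)) => // x xe; rewrite indicE; congr (_%:R).
  have := xe i; rewrite /= tnth_mktuple => /andP[h1 h2].
  case: (boolP b) eib h1 h2; rewrite /b => bt.
    rewrite eqb_id => /negbTE ->; rewrite mulr0 addr0 => h1 h2.
    by rewrite mem_set// /slab/=; lra.
  rewrite eqbF_neg negbK => ->; rewrite mulr1 => h1 h2.
  by rewrite memNset// /slab/=; apply/negP; rewrite -leNgt; rewrite -leNgt in bt; lra.
apply: (@le_trans _ _ (\sum_(e : {ffun 'I_d -> bool} | e i == b) 2 * (2^-1 ^+ N * vol (child c e)))).
  by apply: ler_sum => e _; apply: IH; exact: child_gt0.
rewrite -2!mulr_sumr exprSr -!mulrA ler_pM2l// ler_pM2l ?exprn_gt0 ?invr_gt0//.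
pose flip (e : {ffun 'I_d -> bool}) := [ffun j => if j == i then ~~ e j else e j].
have flipK : involutive flip.
  move=> e; apply/ffunP => j; rewrite !ffunE; case: eqP => // _; exact: negbK.
have E : \sum_(e : {ffun 'I_d -> bool} | e i != b) vol (child c e) =
         \sum_(e : {ffun 'I_d -> bool} | e i == b) vol (child c e).
  rewrite (reindex_inj (inv_inj flipK))/=; apply: eq_big => e.
    by rewrite ffunE eqxx; case: (e i) (b) => -[].
  by rewrite !vol_child.
have := sum_vol_children c; rewrite (bigID (fun e : {ffun 'I_d -> bool} => e i == b))/= E => <-.
by lra.
Qed.

Definition D0 c g : Prop := forall eps : R, 0 < eps ->
  exists N, forall n, (N <= n)%N -> osc n c g <= eps.

Lemma D0_lin c g h k : 0 < c.2 -> LS g -> LS h -> D0 c g -> D0 c h ->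
  D0 c (fun x => g x + k * h x).
Proof.
move=> c0 hg hh Dg Dh eps e0.
have k1 : 0 < `|k| + 1 by rewrite ltr_wpDl.
have [N1 H1] := Dg (eps / 2) ltac:(by rewrite divr_gt0).
have [N2 H2] := Dh (eps / 2 / (`|k| + 1)) ltac:(by rewrite !divr_gt0).
exists (maxn N1 N2) => n; rewrite geq_max => /andP[/H1 h1 /H2 h2].
apply: le_trans (osc_sub n c0 hg (LSZ k hh)) _; rewrite osc_Z//.
have : `|k| * osc n c h <= eps / 2.
  apply: (@le_trans _ _ ((`|k| + 1) * osc n c h)).
    by rewrite ler_wpM2r ?osc_ge0// lerDl.
  by rewrite mulrC -ler_pdivlMr.
lra.
Qed.

Lemma D0_approx c g : 0 < c.2 -> LS g ->
  (forall eps : R, 0 < eps -> exists h, [/\ LS h, D0 c h & I_ c (fun x => `|g x - h x|) <= eps]) ->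
  D0 c g.
Proof.
move=> c0 hg H eps e0.
have [h [hh Dh gh]] := H (eps / 4) ltac:(by rewrite divr_gt0).
have [N HN] := Dh (eps / 2) ltac:(by rewrite divr_gt0).
exists N => n /HN h1.
rewrite (@osc_eq _ _ _ (fun x => h x + (g x - h x)))//; last first.
  by move=> x _; rewrite addrC subrK.
apply: le_trans (osc_sub n c0 hh (LSB hg hh)) _.
have := osc_L1 n c0 (LSB hg hh); lra.
Qed.

Lemma LS_indic (E : set X) : measurable E -> LS (\1_E).
Proof.
move=> mE; apply: (@LS_bounded _ 1); first exact: measurable_indic.
by move=> x; rewrite indicE; case: (_ \in _); rewrite ?normr1 ?normr0.
Qed.

(** The sets whose indicator has vanishing oscillation in c: they form a
    sigma-algebra containing the half-spaces, hence contain all measurable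
    sets. *)
Definition good_set c : set (set X) := [set E | measurable E /\ D0 c (\1_E)].

Lemma D0_cst c k : 0 < c.2 -> D0 c (fun=> k).
Proof.
by move=> c0 eps e0; exists 0%N => n _; rewrite (@osc_cst _ _ _ k)// ltW.
Qed.

Lemma good_setC c E : 0 < c.2 -> good_set c E -> good_set c (~` E).
Proof.
move=> c0 [mE DE]; split; first exact: measurableC.
rewrite (_ : \1_(~` E) = fun x => 1 + (-1) * (\1_E x : R)).
  by apply: D0_lin => //; [exact: LS_cst|exact: LS_indic|exact: D0_cst].
apply/funext => x; rewrite !indicE in_setC.
by case: (_ \in _); rewrite /= ?mulr1 ?mulr0 ?addr0 ?subrr// addrC subrr.
Qed.

Lemma good_setI c E F : 0 < c.2 -> good_set c E -> good_set c F -> good_set c (E `&` F).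
Proof.
move=> c0 [mE DE] [mF DF]; split; first exact: measurableI.
move=> eps e0.
have [N1 H1] := DE (eps / 4) ltac:(by rewrite divr_gt0).
have [N2 H2] := DF (eps / 4) ltac:(by rewrite divr_gt0).
exists (maxn N1 N2) => n; rewrite geq_max => /andP[/H1 h1 /H2 h2].
have i1 A (x : X) : `|\1_A x : R| <= 1.
  by rewrite indicE; case: (_ \in _); rewrite ?normr1 ?normr0.
have := osc_mul n c0 (LS_indic mE) (LS_indic mF) (i1 E) (i1 F).
rewrite -(@osc_eq _ _ (\1_(E `&` F)))//; first lra.
by move=> x _; rewrite !indicE in_setI -natrM mulnb.
Qed.

Lemma good_setU c E F : 0 < c.2 -> good_set c E -> good_set c F -> good_set c (E `|` F).
Proof.
move=> c0 hE hF; rewrite -[_ `|` _]setCK setCU; apply: good_setC => //.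
by apply: good_setI => //; exact: good_setC.
Qed.

Lemma good_set_bigcup c (F : (set X)^nat) : 0 < c.2 -> (forall n, good_set c (F n)) ->
  good_set c (\bigcup_n F n).
Proof.
move=> c0 hF.
have mF : measurable (\bigcup_n F n) by apply: bigcupT_measurable => n; case: (hF n).
split => //; apply: D0_approx => //; first exact: LS_indic.
move=> eps e0.
pose G n := \big[setU/set0]_(i < n) F i.
have gG n : good_set c (G n).
  rewrite /G; elim: n => [|n IH]; last first.
    by rewrite big_ord_recr/=; apply: good_setU.
  rewrite big_ord0 -setCT; apply: good_setC => //; split => //.
  by rewrite indicT; apply: D0_cst.
have mG n : measurable (G n) by case: (gG n).
have GF n : G n `<=` \bigcup_n F n.
  by move=> x; rewrite /G -bigcup_mkord => -[k _ Fk]; exists k.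
have mc := measurable_cset c.
have cvg1 : (leb d \o (fun n => cset c `&` G n)) n @[n --> \oo] -->
    leb d (\bigcup_n (cset c `&` G n)).
  apply: nondecreasing_cvg_mu.
  - by move=> n; exact: measurableI.
  - by apply: bigcupT_measurable => n; exact: measurableI.
  - move=> n m nm; apply/subsetPset => x [cx]; split => //; move: b.
    rewrite /G -!bigcup_mkord => -[k /= kn Fk]; exists k => //=.
    exact: leq_trans nm.
have GFe : \bigcup_n (cset c `&` G n) = \bigcup_n F n `&` cset c.
  apply/seteqP; split=> [x [n _ [cx Gx]]|x [[n _ Fx] cx]].
    by split => //; exact: (GF n).
  exists n.+1 => //; split => //; rewrite /G -bigcup_mkord; exists n => //=.
have IE E : measurable E -> leb d (E `&` cset c) = ((I_ c (\1_E))%:E)%E.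
  move=> mE; rewrite -intE//; last first.
    have := LI_norm (LS_indic mE); rewrite (_ : (fun x => _) = \1_E)//.
    by apply/funext => x; rewrite ger0_norm// indicE; case: (_ \in _).
  by rewrite /int integral_indic.
rewrite GFe IE// in cvg1.
have cvg2 : I_ c (\1_(G n)) @[n --> \oo] --> I_ c (\1_(\bigcup_n F n)).
  have E2 : (fun n => I_ c (\1_(G n))) = fine \o (leb d \o (fun n => cset c `&` G n)).
    by apply/funext => n /=; rewrite setIC IE.
  rewrite E2; exact: fine_cvg cvg1.
have [n _ /(_ n (leqnn n)) /= hn] := cvgr_gt _ cvg2 (I_ c (\1_(\bigcup_n F n)) - eps) ltac:(by rewrite ltrBlDr ltrDl).
exists (\1_(G n)); split; [exact: LS_indic|by case: (gG n)|].
rewrite (@I_eq _ _ _ _ (fun x => \1_(\bigcup_n F n) x - \1_(G n) x)); last first.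
  move=> x _; rewrite ger0_norm// !indicE subr_ge0.
  have [xG|] := boolP (x \in G n); last by move=> _; case: (_ \in _).
  by rewrite (mem_set (GF n x _)) ?lexx//; rewrite inE in xG.
rewrite IS_B//; try exact: LS_indic.
by move: hn; rewrite ltrBlDr => /ltW; rewrite lerBlDr addrC.
Qed.

Lemma good_slab c i t : 0 < c.2 -> good_set c (slab i t).
Proof.
move=> c0; split.
  rewrite (_ : slab i t = setT `&` (fun x : X => tnth x i) @^-1` `]-oo, t[%classic).
    exact: (measurable_tnth i measurableT (measurable_itv _)).
  by apply/seteqP; split=> [x h|x [_]] /=; rewrite ?in_itv.
move=> eps e0; have v0 := vol_gt0 c0.
have : (2^-1 ^+ k : R) @[k --> \oo] --> (0 : R).
  by apply: cvg_expr; rewrite ger0_norm ?invr_ge0// invf_lt1// ltr1n.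
move=> /cvgr_lt /(_ (eps / (2 * vol c))) [].
  by rewrite divr_gt0// mulr_gt0.
move=> N _ HN; exists N => n /HN /= h; apply: le_trans (osc_slab n i t c0) _.
by move: h; rewrite ltr_pdivlMr ?mulr_gt0// => /ltW; rewrite mulrCA.
Qed.

Lemma good_measurable c E : 0 < c.2 -> measurable E -> good_set c E.
Proof.
move=> c0.
have g0 : good_set c set0.
  by split => //; rewrite indic0; exact: D0_cst.
have sg : sigma_algebra setT (good_set c).
  split => //; first by move=> A gA; rewrite setTD; exact: good_setC.
  by move=> A gA; exact: good_set_bigcup.
move: E; apply: smallest_sub => // E.
rewrite -bigcup_seq/= => -[i _ [B mB <-]]; rewrite setTI.
have : (@RGenInftyO.G R).-sigma.-measurable B by rewrite -RGenInftyO.measurableE.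
move: B {mB}.
suff H : <<s @RGenInftyO.G R >> `<=` [set B | good_set c ((fun x : X => tnth x i) @^-1` B)].
  by move=> B; exact: H.
apply: smallest_sub; last first.
  move=> _ [t ->] /=.
  rewrite (_ : _ @^-1` _ = slab i t); first exact: good_slab.
  by apply/seteqP; split=> x /=; rewrite in_itv.
split => /=; first by rewrite preimage_set0.
  by move=> A gA; rewrite setTD preimage_setC; exact: good_setC.
by move=> A gA; rewrite preimage_bigcup; exact: good_set_bigcup.
Qed.

(** An L^1 form of the Lebesgue differentiation theorem along the dyadic
    subcubes of c.  By density of simple functions it reduces to indicators
    of measurable sets. *)
Lemma osc_cvg0 c g : 0 < c.2 -> LS g -> D0 c g.
Proof.
move=> c0 hg; apply: D0_approx => // eps e0.
have [h [ih _ ch]] := approximation_sfun_integrable (measurable_cset c) (LS_integrable c0 hg).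
move/fine_cvgP : ch => [[N1 _ H1] H2].
have [N2 _ H3] := cvgr_lt _ H2 eps e0.
pose N := maxn N1 N2.
have F1 := H1 N (leq_maxl _ _); have /= F2 := H3 N (leq_maxr _ _).
exists (h N).
pose r := finmap.enum_fset (fset_set (range (h N))).
pose A i := (h N) @^-1` [set r`_i].
have mA i : measurable (A i).
  rewrite -[X in measurable X]setTI.
  by apply: (measurable_funP (h N)) => //; exact: measurable_set1.
have H n : LS (fun x => \sum_(i < n) r`_i * \1_(A i) x) /\
    D0 c (fun x => \sum_(i < n) r`_i * \1_(A i) x).
  elim: n => [|n [IH1 IH2]].
    have -> : (fun x : X => \sum_(i < 0) r`_i * \1_(A i) x) = fun=> 0.
      by apply/funext => x; rewrite big_ord0.
    by split; [exact: LS_cst|exact: D0_cst].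
  have -> : (fun x : X => \sum_(i < n.+1) r`_i * \1_(A i) x) =
    fun x => \sum_(i < n) r`_i * \1_(A i) x + r`_n * \1_(A n) x.
    by apply/funext => x; rewrite big_ord_recr.
  split; first by apply: LSD => //; apply: LSZ; exact: LS_indic.
  apply: D0_lin => //; first exact: LS_indic.
  by case: (good_measurable c0 (mA n)).
have [LSh Dh] : LS (h N) /\ D0 c (h N).
  have -> : (h N : X -> R) = fun x => \sum_(i < size r) r`_i * \1_(A i) x.
    by apply/funext => x; exact: fimfunEord.
  exact: H.
split => //.
exact: ltW.
Qed.

End oscillation.

(** * Means of matrix functions *)

Section power_inequalities.
Variable R : realType.
Implicit Types (p q r s : R).

Lemma powR_le p r s : 0 <= p -> 0 <= r -> r <= s -> r `^ p <= s `^ p.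
Proof.
by move=> p0 r0 rs; apply: ge0_ler_powR => //; rewrite nnegrE// (le_trans r0).
Qed.

Lemma powRK p r : 0 < p -> 0 <= r -> (r `^ p^-1) `^ p = r.
Proof. by move=> p0 r0; rewrite -powRrM mulVf ?gt_eqF// powRr1. Qed.

(** The factor in front of r^p can be taken as close to 1 as wanted, at the
    price of a large constant in front of s^p. *)
Lemma powRD_eps p e : 0 < p -> 0 < e -> exists2 C : R, 0 <= C &
  forall r s, 0 <= r -> 0 <= s -> (r + s) `^ p <= (1 + e) * r `^ p + C * s `^ p.
Proof.
move=> p0 e0; pose t := (1 + e) `^ p^-1; pose dl := t - 1.
have e1 : 0 <= 1 + e by rewrite addr_ge0// ltW.
have tp : t `^ p = 1 + e by rewrite powRK.
have d0 : 0 < dl.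
  rewrite subr_gt0 ltNge; apply/negP => t1.
  have : t `^ p <= 1 `^ p by apply: powR_le; rewrite ?powR_ge0// ltW.
  by rewrite tp powR1; lra.
have t0 : 0 <= t by exact: powR_ge0.
exists ((1 + dl^-1) `^ p); first exact: powR_ge0.
move=> r s r0 s0; have [h|h] := leP s (dl * r).
  rewrite ler_wpDr ?mulr_ge0 ?powR_ge0//.
  rewrite -tp -powRM//; apply: powR_le; rewrite ?addr_ge0 ?(ltW p0)//.
  by rewrite /dl in h; lra.
rewrite ler_wpDl ?mulr_ge0 ?powR_ge0//.
have di0 : 0 <= dl^-1 by rewrite invr_ge0 ltW.
rewrite -powRM ?addr_ge0//; apply: powR_le; rewrite ?addr_ge0 ?(ltW p0)//.
rewrite mulrDl mul1r addrC lerD2l mulrC ler_pdivlMr// mulrC ltW//.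
Qed.

(** Either h is so large that e h^q >= 1, or h is bounded and b is at most
    a constant times k. *)
Lemma powR_young p q e : 0 < p -> 0 < q -> 0 < e -> exists2 C : R, 0 < C &
  forall b h k, 0 <= b -> 0 <= h -> 0 <= k -> b <= h * k ->
    b `^ p <= e * (b `^ p * h `^ q) + C * k `^ p.
Proof.
move=> p0 q0 e0; pose H := (e^-1) `^ q^-1.
have ei : 0 < e^-1 by rewrite invr_gt0.
have Hq : H `^ q = e^-1 by rewrite powRK// ltW.
exists (H `^ p); first by rewrite !powR_gt0.
move=> b h k b0 h0 k0 bhk; have [hl|hl] := leP H h.
  rewrite ler_wpDr ?mulr_ge0 ?powR_ge0// mulrCA ler_peMr ?powR_ge0//.
  rewrite mulrC -ler_pdivrMr// mul1r -Hq; apply: powR_le => //; first exact: ltW.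
  exact: powR_ge0.
rewrite ler_wpDl ?mulr_ge0 ?powR_ge0 ?(ltW e0)// -powRM ?powR_ge0//.
apply: powR_le => //; first exact: ltW.
by apply: le_trans bhk _; rewrite ler_wpM2r// ltW.
Qed.

End power_inequalities.

Section matrix_mean.
Variables (R : realType) (d : nat).
Notation X := (Rspace R d).
Notation Cb := (Cb R d).
Implicit Types (c : Cb) (m n : nat).

Definition CLS (f : X -> R[i]) := LS (fun x => complex.Re (f x)) /\ LS (fun x => complex.Im (f x)).
Definition MLS m n (F : X -> 'M[R[i]]_(m, n)) := forall i j, CLS (fun x => F x i j).

Definition cmean c (f : X -> R[i]) : R[i] :=
  Complex (mean c (fun x => complex.Re (f x))) (mean c (fun x => complex.Im (f x))).

Definition mxmean m n c (F : X -> 'M[R[i]]_(m, n)) : 'M[R[i]]_(m, n) :=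
  \matrix_(i, j) cmean c (fun x => F x i j).

Lemma ReD (z w : R[i]) : complex.Re (z + w) = complex.Re z + complex.Re w.
Proof. by case: z w => ? ? []. Qed.
Lemma ImD (z w : R[i]) : complex.Im (z + w) = complex.Im z + complex.Im w.
Proof. by case: z w => ? ? []. Qed.
Lemma ReM (z w : R[i]) : complex.Re (z * w) =
  complex.Re z * complex.Re w + - complex.Im z * complex.Im w.
Proof. by case: z w => ? ? [? ?] /=; rewrite mulNr. Qed.
Lemma ImM (z w : R[i]) : complex.Im (z * w) =
  complex.Re z * complex.Im w + complex.Im z * complex.Re w.
Proof. by case: z w => ? ? []. Qed.

Lemma CLS_D f g : CLS f -> CLS g -> CLS (fun x => f x + g x).
Proof.
move=> [f1 f2] [g1 g2]; split.
  by under eq_fun do rewrite ReD; exact: LSD.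
by under eq_fun do rewrite ImD; exact: LSD.
Qed.

Lemma CLS_Z z f : CLS f -> CLS (fun x => z * f x).
Proof.
move=> [f1 f2]; split.
  by under eq_fun do rewrite ReM; apply: LSD; exact: LSZ.
by under eq_fun do rewrite ImM; apply: LSD; exact: LSZ.
Qed.

Lemma CLS_cst z : CLS (fun=> z).
Proof. by split; exact: LS_cst. Qed.

Lemma cmean_D c f g : 0 < c.2 -> CLS f -> CLS g ->
  cmean c (fun x => f x + g x) = cmean c f + cmean c g.
Proof.
move=> c0 [f1 f2] [g1 g2]; apply/eqP; rewrite eq_complex/= /mean.
under [X in I_ c X]eq_fun do rewrite ReD.
rewrite IS_D// mulrDl eqxx/=.
by under eq_fun do rewrite ImD; rewrite IS_D// mulrDl.
Qed.

Lemma cmean_Z c z f : 0 < c.2 -> CLS f ->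
  cmean c (fun x => z * f x) = z * cmean c f.
Proof.
move=> c0 [f1 f2]; apply/eqP; rewrite eq_complex ReM ImM/= /mean.
under [X in I_ c X]eq_fun do rewrite ReM.
rewrite IS_D ?IS_Z//; try exact: LSZ.
rewrite mulrDl -!mulrA eqxx/=.
under eq_fun do rewrite ImM.
rewrite IS_D ?IS_Z//; try exact: LSZ.
by rewrite mulrDl -!mulrA.
Qed.

Lemma cmean_cst c z : 0 < c.2 -> cmean c (fun=> z) = z.
Proof. by move=> c0; rewrite /cmean !mean_cst//; case: z. Qed.

Lemma CLS_sum (I : Type) (r : seq I) (f : I -> X -> R[i]) :
  (forall i, CLS (f i)) -> CLS (fun x => \sum_(i <- r) f i x).
Proof.
move=> h; elim: r => [|i r IH].
  by under eq_fun do rewrite big_nil; exact: CLS_cst.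
by under eq_fun do rewrite big_cons; exact: CLS_D.
Qed.

Lemma cmean_sum c (I : Type) (r : seq I) (f : I -> X -> R[i]) : 0 < c.2 ->
  (forall i, CLS (f i)) -> cmean c (fun x => \sum_(i <- r) f i x) = \sum_(i <- r) cmean c (f i).
Proof.
move=> c0 h; elim: r => [|i r IH].
  by under eq_fun do rewrite big_nil; rewrite big_nil cmean_cst.
under eq_fun do rewrite big_cons.
by rewrite cmean_D// ?IH ?big_cons//; exact: CLS_sum.
Qed.

Lemma MLS_D m n (F G : X -> 'M[R[i]]_(m, n)) : MLS F -> MLS G -> MLS (fun x => F x + G x).
Proof. by move=> hF hG i j; under eq_fun do rewrite mxE; exact: CLS_D. Qed.

Lemma MLS_cst m n (M : 'M[R[i]]_(m, n)) : MLS (fun=> M).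
Proof. by move=> i j; exact: CLS_cst. Qed.

Lemma MLS_Bc m n (F : X -> 'M[R[i]]_(m, n)) M : MLS F -> MLS (fun x => F x - M).
Proof. by move=> hF; apply: MLS_D => //; exact: MLS_cst. Qed.

Lemma MLS_mulL m n q (L : 'M[R[i]]_(m, n)) (F : X -> 'M[R[i]]_(n, q)) :
  MLS F -> MLS (fun x => L *m F x).
Proof.
by move=> hF i j; under eq_fun do rewrite mxE; apply: CLS_sum => k; exact: CLS_Z.
Qed.

Lemma MLS_mulR m n q (L : 'M[R[i]]_(n, q)) (F : X -> 'M[R[i]]_(m, n)) :
  MLS F -> MLS (fun x => F x *m L).
Proof.
move=> hF i j; under eq_fun do rewrite mxE; apply: CLS_sum => k.
by under eq_fun do rewrite mulrC; exact: CLS_Z.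
Qed.

Lemma mxmean_mulL m n q c (L : 'M[R[i]]_(m, n)) (F : X -> 'M[R[i]]_(n, q)) :
  0 < c.2 -> MLS F -> mxmean c (fun x => L *m F x) = L *m mxmean c F.
Proof.
move=> c0 hF; apply/matrixP => i j; rewrite !mxE.
under eq_fun do rewrite mxE; rewrite cmean_sum//; last by move=> k; exact: CLS_Z.
by apply: eq_bigr => k _; rewrite mxE cmean_Z.
Qed.

Lemma mxmean_mulR m n q c (L : 'M[R[i]]_(n, q)) (F : X -> 'M[R[i]]_(m, n)) :
  0 < c.2 -> MLS F -> mxmean c (fun x => F x *m L) = mxmean c F *m L.
Proof.
move=> c0 hF; apply/matrixP => i j; rewrite !mxE.
under eq_fun do rewrite mxE; rewrite cmean_sum//; last first.
  by move=> k; under eq_fun do rewrite mulrC; exact: CLS_Z.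
apply: eq_bigr => k _; rewrite mxE mulrC -cmean_Z//; congr cmean.
by apply/funext => x; rewrite mulrC.
Qed.

Lemma mxmean_Bc m n c (F : X -> 'M[R[i]]_(m, n)) M : 0 < c.2 -> MLS F ->
  mxmean c (fun x => F x - M) = mxmean c F - M.
Proof.
move=> c0 hF; apply/matrixP => i j; rewrite !mxE.
under eq_fun do rewrite !mxE.
by rewrite cmean_D ?cmean_cst//; exact: CLS_cst.
Qed.

Lemma mxm_MLS m n (F : X -> 'M[R[i]]_(m, n)) : MLS F -> mxm F.
Proof. by move=> h i j; have [[? _] [? _]] := h i j. Qed.

Lemma LI_sum (I : Type) (r : seq I) (f : I -> X -> R) :
  (forall i, LI (f i)) -> LI (fun x => \sum_(i <- r) f i x).
Proof.
move=> h; elim: r => [|i r IH].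
  by under eq_fun do rewrite big_nil; exact: LI_cst.
by under eq_fun do rewrite big_cons; exact: LID.
Qed.

(** A norm that is additive over the real entries, so that its integrals are sums
    of scalar oscillations. *)
Definition l1 m n (M : 'M[R[i]]_(m, n)) : R :=
  \sum_i \sum_j (`|complex.Re (M i j)| + `|complex.Im (M i j)|).

Lemma fn_le_l1 m n (M : 'M[R[i]]_(m, n)) : fn M <= l1 M.
Proof.
apply: le_trans (fn_le_sum _) _; apply: ler_sum => i _; apply: ler_sum => j _.
exact: normc_le_ReIm.
Qed.

Lemma LI_l1 m n (F : X -> 'M[R[i]]_(m, n)) : MLS F -> LI (fun x => l1 (F x)).
Proof.
move=> hF; apply: LI_sum => i; apply: LI_sum => j; have [h1 h2] := hF i j.
by apply: LID; exact: LI_norm.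
Qed.

Lemma LI_fn m n (F : X -> 'M[R[i]]_(m, n)) : MLS F -> LI (fun x => fn (F x)).
Proof.
move=> hF; apply: (LI_le0 _ _ (LI_l1 hF)).
- exact: measurable_fn (mxm_MLS hF).
- by move=> x; exact: fn_ge0.
- by move=> x; exact: fn_le_l1.
Qed.

Lemma MLS_fn m n (F : X -> 'M[R[i]]_(m, n)) : mxm F -> LI (fun x => fn (F x)) -> MLS F.
Proof.
move=> mF h i j; have [m1 m2] := mF i j; split; split=> //.
  apply: (LI_le0 _ _ h) => //; first exact: measurableT_comp.
  by move=> x; apply: le_trans (normc_Re _) (fn_entry _ _ _).
apply: (LI_le0 _ _ h) => //; first exact: measurableT_comp.
by move=> x; apply: le_trans (normc_Im _) (fn_entry _ _ _).
Qed.

Lemma mean_norm c g : 0 < c.2 -> LS g -> `|mean c g| <= mean c (fun x => `|g x|).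
Proof.
move=> c0 hg; have v0 := vol_gt0 c0; rewrite /mean normrM (ger0_norm (x := (vol c)^-1)) ?invr_ge0 ?(ltW v0)//.
by rewrite ler_wpM2r ?invr_ge0 ?(ltW v0)//; exact: IS_norm.
Qed.

Lemma mean_mono c f g : 0 < c.2 -> LI f -> LI g -> (forall x, cset c x -> f x <= g x) ->
  mean c f <= mean c g.
Proof.
move=> c0 hf hg h; rewrite ler_wpM2r ?invr_ge0 ?(ltW (vol_gt0 c0))//.
exact: I_mono.
Qed.

(** The triangle inequality for the mean, entry by entry, which costs the
    number of real entries. *)
Lemma fn_mxmean m n c (F : X -> 'M[R[i]]_(m, n)) : 0 < c.2 -> MLS F ->
  fn (mxmean c F) <= (m * n).*2%:R * mean c (fun x => fn (F x)).
Proof.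
move=> c0 hF; apply: le_trans (fn_le_l1 _) _; rewrite /l1.
apply: (@le_trans _ _ (\sum_(i < m) \sum_(j < n) 2 * mean c (fun x => fn (F x)))).
  apply: ler_sum => i _; apply: ler_sum => j _; rewrite mxE/= mulrDl mul1r.
  have [h1 h2] := hF i j; apply: lerD; apply: le_trans (mean_norm c0 _) _ => //;
    apply: mean_mono => //; try exact: LI_norm; try exact: LI_fn.
    by move=> x _; apply: le_trans (normc_Re _) (fn_entry _ _ _).
  by move=> x _; apply: le_trans (normc_Im _) (fn_entry _ _ _).
by rewrite !sumr_const !card_ord -mulrnA -[leLHS]mulr_natl -muln2 (natrM _ (m * n)) (mulnC n) -mulrA.
Qed.

End matrix_mean.

(** * A weighted John-Nirenberg estimate at finite depth *)

Section calderon_zygmund.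
Variables (R : realType) (d : nat).
Notation X := (Rspace R d).
Notation Cb := (Cb R d).
Implicit Types (c P : Cb) (F : X -> R).

(** The additivity shared by integrals, volumes and the functionals [J], by which a
    single decomposition of a cube splits all of them. *)
Definition family (T : nat -> Cb -> R) : Prop :=
  forall n c, 0 < c.2 -> T n.+1 c = \sum_e T n (child c e).

Lemma family_I f : LI f -> family (fun _ c => I_ c f).
Proof. by move=> hf n c c0; exact: I_children. Qed.

Lemma family_vol : family (fun _ c => vol c).
Proof. by move=> n c c0; rewrite sum_vol_children. Qed.

(** A stopping time.  The cube is divided N times at most, and a subcube is
    set aside as soon as the mean of F on it exceeds l.  The list [Bd] holds
    the stopped cubes with the number of generations left below them, the list
    [G] the cubes of the last generation that were never stopped.  The
    mean on a stopped cube is at most 2^d l because its parent was not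
    stopped.  The last clause says that [G] and [Bd] partition c, in a form
    that can be used for the integral of any function, for the volume and for
    [J] at once. *)
Lemma calderon_zygmund F (l : R) N c : LI F -> 0 < c.2 -> I_ c F <= l * vol c ->
  exists (G : seq Cb) (Bd : seq (Cb * nat)),
  [/\ (forall P, P \in G -> 0 < P.2 /\ I_ P F <= l * vol P),
      (forall z, z \in Bd -> [/\ 0 < z.1.2, (z.2 < N)%N, l * vol z.1 < I_ z.1 F &
         I_ z.1 F <= 2 ^+ d * l * vol z.1]) &
      forall T, family T ->
        T N c = \sum_(P <- G) T 0%N P + \sum_(z <- Bd) T z.2 z.1].
Proof.
move=> hF; elim: N c => [|N IH] c c0 hc.
  exists [:: c], [::]; split=> [P|//|T hT].
    by rewrite inE => /eqP ->.
  by rewrite big_seq1 big_nil addr0.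
have H (e : {ffun 'I_d -> bool}) : exists GB : seq Cb * seq (Cb * nat),
  [/\ (forall P, P \in GB.1 -> 0 < P.2 /\ I_ P F <= l * vol P),
      (forall z, z \in GB.2 -> [/\ 0 < z.1.2, (z.2 < N.+1)%N, l * vol z.1 < I_ z.1 F &
         I_ z.1 F <= 2 ^+ d * l * vol z.1]) &
      forall T, family T ->
        T N (child c e) = \sum_(P <- GB.1) T 0%N P + \sum_(z <- GB.2) T z.2 z.1].
  have ce0 := child_gt0 e c0.
  have [h|h] := leP (I_ (child c e) F) (l * vol (child c e)).
    have [G [Bd [h1 h2 h3]]] := IH _ ce0 h.
    exists (G, Bd); split => // z /h2 [? zN ? ?]; split => //; exact: ltnW.
  exists ([::], [:: (child c e, N)]); split=> [//|z|T hT]; last first.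
    by rewrite big_seq1 big_nil add0r.
  rewrite inE => /eqP -> /=; split => //.
  apply: le_trans (I_child_le e c0 hF) _; apply: le_trans hc _.
  rewrite vol_child exprVn; have : (2 ^+ d : R) != 0 by rewrite expf_neq0.
  set t := 2 ^+ d => t0; suff -> : t * l * (t^-1 * vol c) = l * vol c by [].
  by field.
have [S HS] := choice H.
exists (flatten [seq (S e).1 | e <- index_enum {ffun 'I_d -> bool}]),
  (flatten [seq (S e).2 | e <- index_enum {ffun 'I_d -> bool}]); split.
- move=> P /flatten_mapP[e _ /= hP]; have [h _ _] := HS e; exact: h.
- move=> z /flatten_mapP[e _ /= hz]; have [_ h _] := HS e; exact: h.
- move=> T hT; rewrite hT// !big_flatten !big_map -big_split/=.
  by apply: eq_bigr => e _; have [_ _ ->] := HS e.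
Qed.

End calderon_zygmund.

Lemma LI_ext (R : realType) d (f g : Rspace R d -> R) : (forall x, f x = g x) -> LI f -> LI g.
Proof. by move=> /funext ->. Qed.

(** The arithmetic of the induction step in [JN_discrete].  The suffixes G and B
    refer to the cubes that are never stopped and to the stopped ones.  The
    quantities v, h, sg and u are the volume and the integrals of |b E'|^q, |E D|^p
    and |A a'|^p, while bp is |b D|^p and J the quantity to estimate.  The point is
    that the stopped cubes carry at most the fraction 1 - c0 of sg, so that the
    factor 1 + c0 lost on them is compensated: (1 + c0)(1 - c0) = 1 - c0^2. *)
Lemma jn_arith (R : realType) (K Cy c0 Ce L C2 Cs bp vc VG VB SG SB sgc hc UG UB uc JT JG JB : R) :
  0 < K -> 0 < Cy -> c0 = (4 * K * Cy)^-1 -> 0 <= Ce -> 0 <= L ->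
  C2 = (1 + Ce) * L * K * (4 * Cy) -> Cs = C2 / c0 ^+ 2 ->
  0 <= bp -> 0 <= vc -> 0 <= SG -> 0 <= SB -> 0 <= UG -> 0 <= UB ->
  vc = VG + VB -> sgc = SG + SB -> uc = UG + UB -> JT = JG + JB ->
  hc <= K * vc -> uc <= K * vc -> VB <= 2^-1 * vc ->
  bp * VG <= (4 * K)^-1 * bp * hc + Cy * SG ->
  sgc <= K * (bp * vc) -> JG <= L * bp * UG ->
  JB <= (1 + c0) * Cs * SB + Ce * (L * bp) * UB -> JT <= Cs * sgc.
Proof.
move=> K0 Cy0 c0E Ce0 L0 C2E CsE bp0 vc0 SG0 SB0 UG0 UB0 Ev Es Eu EJ hhc huc VB2 young hsg hJG hJB.
have c0p : 0 < c0 by rewrite c0E invr_gt0 !mulr_gt0.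
have C20 : 0 <= C2 by rewrite C2E !mulr_ge0 ?addr_ge0 ?(ltW K0) ?(ltW Cy0).
have Cs0 : 0 <= Cs by rewrite CsE divr_ge0 ?sqr_ge0.
have e40 : 0 < (4 * K)^-1 by rewrite invr_gt0 mulr_gt0.
pose v := bp * vc.
have v0 : 0 <= v by rewrite mulr_ge0.
have vSG : v <= 4 * Cy * SG.
  have h1 : (4 * K)^-1 * bp * hc <= v / 4.
    apply: (@le_trans _ _ ((4 * K)^-1 * bp * (K * vc))).
      by rewrite ler_wpM2l ?mulr_ge0 ?(ltW e40).
    by rewrite /v le_eqVlt; apply/orP; left; apply/eqP; field; rewrite gt_eqF.
  have h2 : bp * VG >= v / 2 by rewrite /v -mulrA ler_wpM2l//; lra.
  lra.
have sgSG : c0 * sgc <= SG.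
  rewrite c0E mulrC ler_pdivrMr ?mulr_gt0//.
  apply: le_trans hsg _; apply: (@le_trans _ _ (K * (4 * Cy * SG))).
    by rewrite ler_wpM2l// ltW.
  by rewrite le_eqVlt; apply/orP; left; apply/eqP; ring.
have Lb0 : 0 <= L * bp by rewrite mulr_ge0.
have tot : JT <= (1 + c0) * Cs * SB + (1 + Ce) * (L * bp) * uc.
  rewrite EJ; apply: le_trans (lerD hJG hJB) _.
  rewrite Eu addrCA lerD2l.
  have : 0 <= Ce * (L * bp) * UG by rewrite !mulr_ge0.
  have : 0 <= L * bp * UB by rewrite !mulr_ge0.
  lra.
apply: le_trans tot _.
have h1 : (1 + Ce) * (L * bp) * uc <= C2 * sgc.
  apply: (@le_trans _ _ ((1 + Ce) * (L * bp) * (K * vc))).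
    by rewrite ler_wpM2l// mulr_ge0// addr_ge0.
  rewrite (_ : _ * (K * vc) = (1 + Ce) * L * K * v); last by rewrite /v; ring.
  rewrite C2E -[leRHS]mulrA ler_wpM2l ?mulr_ge0 ?addr_ge0 ?(ltW K0)//.
  apply: le_trans vSG _; rewrite ler_wpM2l ?mulr_ge0 ?(ltW Cy0)//.
  by rewrite Es lerDl.
have h2 : (1 + c0) * Cs * SB <= (1 + c0) * Cs * ((1 - c0) * sgc).
  rewrite ler_wpM2l ?mulr_ge0 ?addr_ge0 ?(ltW c0p)//; lra.
have h3 : Cs * c0 ^+ 2 = C2 by rewrite CsE divfK// expf_neq0// gt_eqF.
have h4 : (1 + c0) * Cs * ((1 - c0) * sgc) = Cs * sgc - Cs * c0 ^+ 2 * sgc by ring.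
rewrite h4 h3 in h2; lra.
Qed.

Section john_nirenberg.
Variables (R : realType) (d m : nat) (p q K : R).
Hypotheses (p1 : 1 <= p) (q0 : 0 < q) (K0 : 0 < K).
Notation X := (Rspace R d).
Notation Cb := (Cb R d).
Notation MX := (X -> 'M[R[i]]_m).
Implicit Types (c P : Cb) (M D : 'M[R[i]]_m).

(** The constant matrix a'(c) normalises A on the cube c, in the mean of
    order s. *)
Definition upper_reducing (s : R) (A : MX) (a' : Cb -> 'M[R[i]]_m) : Prop :=
  mxm A /\ forall c, 0 < c.2 ->
    (int c (fun x => ((fn (A x *m a' c)) `^ s)%R) <= ((K * vol c)%:E))%E.

(** Any constant matrix M can replace the normalising one, since
    A M = (A a') (a M). *)
Lemma LI_upper s A a a' : 0 < s -> upper_reducing s A a' -> (forall c, 0 < c.2 -> a' c *m a c = 1%:M) ->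
  forall M, LI (fun x => (fn (A x *m M)) `^ s).
Proof.
move=> s0 [mA hA] ha M.
have mf L : measurable_fun setT (fun x => (fn (A x *m L)) `^ s).
  apply: (measurableT_comp (measurable_powR _)).
  by apply: measurable_fn; apply: mxmM => //; exact: mxm_cst.
split; [exact: mf|by move=> x; exact: powR_ge0|] => c c0.
apply: (@le_lt_trans _ _ (int c (fun x => (fn (a c *m M)) `^ s * (fn (A x *m a' c)) `^ s))).
  apply: int_mono => //.
  - by apply: measurable_funM => //; exact: mf.
  - by move=> x; exact: powR_ge0.
  - by move=> x; rewrite mulr_ge0 ?powR_ge0.
  apply: aeW => x _; rewrite -powRM ?fn_ge0//; apply: powR_le; rewrite ?fn_ge0 ?(ltW s0)//.
  have -> : A x *m M = (A x *m a' c) *m (a c *m M).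
    by rewrite mulmxA -(mulmxA (A x)) ha// mulmx1.
  by rewrite mulrC; exact: fnM.
rewrite intZ ?powR_ge0//; last by move=> x; exact: powR_ge0.
apply: (@le_lt_trans _ _ (((fn (a c *m M)) `^ s)%R%:E * (K * vol c)%:E)%E).
  by apply: lee_wpmul2l; rewrite ?lee_fin ?powR_ge0//; exact: hA.
by rewrite -EFinM ltry.
Qed.

Lemma I_upper s A a a' c : 0 < s -> upper_reducing s A a' -> (forall c, 0 < c.2 -> a' c *m a c = 1%:M) ->
  0 < c.2 -> I_ c (fun x => (fn (A x *m a' c)) `^ s) <= K * vol c.
Proof.
move=> s0 hA ha c0; rewrite -lee_fin -intE//; first by case: hA => _; exact.
exact: (LI_upper s0 hA ha).
Qed.

(** The integral of |A (B_N - M) D|^p over c, where B_N is the conditional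
    expectation of B on the cubes of the N-th generation. *)
Fixpoint J (A B : MX) D N c M : R :=
  if N is N'.+1 then \sum_e J A B D N' (child c e) M
  else I_ c (fun x => (fn (A x *m (mxmean c B - M) *m D)) `^ p).

(** Two weights A and E, with E' inverse to E, their normalising matrices and
    a function B whose oscillation, measured by these matrices, is at most 1
    on every cube.  The matrices a and b are the inverses of a' and b'.  In the
    application they are averages of A and E. *)
Record jn_data (A E E' B : MX) (a a' b b' : Cb -> 'M[R[i]]_m) : Prop := JnData {
  jA : upper_reducing p A a';
  jE : upper_reducing p E b';
  jE' : upper_reducing q (fun x => (E' x) ^t*) (fun c => (b c) ^t*);
  ja : forall c, 0 < c.2 -> a' c *m a c = 1%:M;
  jb : forall c, 0 < c.2 -> b' c *m b c = 1%:M;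
  jEE : {ae leb d, forall x, E' x *m E x = 1%:M};
  jB : MLS B;
  jBMO : forall c, 0 < c.2 ->
    I_ c (fun x => fn (a c *m (B x - mxmean c B) *m b' c)) <= vol c }.

Section fixed_data.
Variables (A E E' B : MX) (a a' b b' : Cb -> 'M[R[i]]_m).
Hypothesis jn : jn_data A E E' B a a' b b'.

Let p0 : 0 < p. Proof. exact: lt_le_trans p1. Qed.

Lemma LI_A M : LI (fun x => (fn (A x *m M)) `^ p).
Proof. exact: (LI_upper p0 (jA jn) (ja jn)). Qed.

Lemma LI_A2 M D : LI (fun x => (fn (A x *m M *m D)) `^ p).
Proof.
by apply: (LI_ext _ (LI_A (M *m D))) => x; rewrite mulmxA.
Qed.

Lemma LI_E M : LI (fun x => (fn (E x *m M)) `^ p).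
Proof. exact: (LI_upper p0 (jE jn) (jb jn)). Qed.

Lemma jb_tr c : 0 < c.2 -> (b c) ^t* *m (b' c) ^t* = 1%:M.
Proof.
move=> c0; have := congr1 (fun M => M ^t*) (jb jn c0).
by rewrite trmx_mul map_mxM/= trmx1 map_mx1.
Qed.

Lemma LI_E' M : LI (fun x => (fn (M *m E' x)) `^ q).
Proof.
apply: (LI_ext _ (@LI_upper q _ (fun c => (b' c) ^t*) _ q0 (jE' jn) jb_tr (M ^t*))) => x.
by rewrite -map_mxM/= -trmx_mul fn_tr.
Qed.

Lemma I_A c : 0 < c.2 -> I_ c (fun x => (fn (A x *m a' c)) `^ p) <= K * vol c.
Proof. exact: (I_upper p0 (jA jn) (ja jn)). Qed.

Lemma I_E c : 0 < c.2 -> I_ c (fun x => (fn (E x *m b' c)) `^ p) <= K * vol c.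
Proof. exact: (I_upper p0 (jE jn) (jb jn)). Qed.

Lemma I_E' c : 0 < c.2 -> I_ c (fun x => (fn (b c *m E' x)) `^ q) <= K * vol c.
Proof.
move=> c0; apply: le_trans (@I_upper q _ (fun c => (b' c) ^t*) _ _ q0 (jE' jn) jb_tr c0).
rewrite le_eqVlt; apply/orP; left; apply/eqP; apply: I_eq => x _.
by rewrite -map_mxM/= -trmx_mul fn_tr.
Qed.

Lemma family_J D M : family (fun N c => J A B D N c M).
Proof. by []. Qed.

(** Replacing the reference value M by M' changes [J] by the contribution of
    the constant M' - M; the factor 1 + e is what makes the induction on
    the depth close. *)
Lemma J_shift N c M M' D e C : 0 < c.2 -> 0 < e ->
  0 <= C -> (forall r s, 0 <= r -> 0 <= s -> (r + s) `^ p <= (1 + e) * r `^ p + C * s `^ p) ->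
  J A B D N c M <= (1 + e) * J A B D N c M' + C * I_ c (fun x => (fn (A x *m (M' - M) *m D)) `^ p).
Proof.
move=> + e0 C0 hC; have e1 : 0 <= 1 + e by rewrite addr_ge0// ltW.
elim: N c => [|N IH] c c0.
  rewrite /= -!I_Z//; try exact: LI_A2.
  rewrite -I_D//; try by apply: LIZ => //; exact: LI_A2.
  apply: I_mono => //; first exact: LI_A2.
    by apply: LID; apply: LIZ => //; exact: LI_A2.
  move=> x _; apply: le_trans (hC _ _ (fn_ge0 _) (fn_ge0 _)).
  apply: powR_le; rewrite ?fn_ge0 ?(ltW p0)//.
  rewrite (_ : mxmean c B - M = (mxmean c B - M') + (M' - M)); last by rewrite subrKA.
  by rewrite mulmxDr mulmxDl fnD.
rewrite (I_children c0 (LI_A2 _ _)) /= !mulr_sumr -big_split/=.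
by apply: ler_sum => e' _; apply: IH; exact: child_gt0.
Qed.

Let kap : R := (m * m).*2%:R.

(** The stopping quantity controls the change of the mean of B from a cube
    to a subcube. *)
Lemma mean_change c P : 0 < c.2 -> 0 < P.2 ->
  fn (a c *m (mxmean P B - mxmean c B) *m b' c) <=
  kap * (I_ P (fun x => fn (a c *m (B x - mxmean c B) *m b' c)) / vol P).
Proof.
move=> c0 P0; have hB := jB jn.
have h1 : MLS (fun x => B x - mxmean c B) by exact: MLS_Bc.
have h2 : MLS (fun x => a c *m (B x - mxmean c B)) by exact: MLS_mulL.
have h3 : MLS (fun x => a c *m (B x - mxmean c B) *m b' c) by exact: MLS_mulR.
rewrite -mxmean_Bc// -mxmean_mulL// -mxmean_mulR//; exact: fn_mxmean.
Qed.

Lemma term_bound c P D t : 0 < c.2 -> 0 < P.2 -> 0 <= t ->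
  I_ P (fun x => fn (a c *m (B x - mxmean c B) *m b' c)) <= t * vol P ->
  I_ P (fun x => (fn (A x *m (mxmean P B - mxmean c B) *m D)) `^ p) <=
  (kap * t * fn (b c *m D)) `^ p * I_ P (fun x => (fn (A x *m a' c)) `^ p).
Proof.
move=> c0 P0 t0 h; rewrite -I_Z ?powR_ge0//; last exact: LI_A.
apply: I_mono => //; first exact: LI_A2.
  by apply: LIZ; [exact: powR_ge0|exact: LI_A].
move=> x _; rewrite -powRM ?fn_ge0 ?mulr_ge0 ?fn_ge0//.
apply: powR_le; rewrite ?fn_ge0 ?(ltW p0)//.
set N := mxmean P B - mxmean c B.
have -> : A x *m N *m D = (A x *m a' c) *m (a c *m N *m b' c) *m (b c *m D).
  rewrite !mulmxA -(mulmxA (A x) (a' c)) (ja jn c0) mulmx1.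
  by rewrite -(mulmxA _ (b' c)) (jb jn c0) mulmx1.
apply: le_trans (fnM3 _ _ _) _.
have -> : kap * t * fn (b c *m D) * fn (A x *m a' c) =
  fn (A x *m a' c) * (kap * t) * fn (b c *m D) by ring.
apply: ler_wpM2r; first exact: fn_ge0.
apply: ler_wpM2l; first exact: fn_ge0.
apply: le_trans (mean_change c0 P0) _.
by rewrite ler_wpM2l ?ler0n// ler_pdivrMr ?vol_gt0.
Qed.

End fixed_data.

Let kap : R := (m * m).*2%:R.

Lemma sum_LI_le (I : eqType) (r : seq I) (f g : I -> R) (k : R) :
  (forall i, i \in r -> f i <= k * g i) -> \sum_(i <- r) f i <= k * \sum_(i <- r) g i.
Proof.
move=> h; rewrite mulr_sumr big_seq [leRHS]big_seq; apply: ler_sum => i ir; exact: h.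
Qed.

Lemma sum_mem_ge0 (I : eqType) (r : seq I) (f : I -> R) :
  (forall i, i \in r -> 0 <= f i) -> 0 <= \sum_(i <- r) f i.
Proof. by move=> h; rewrite big_seq; apply: sumr_ge0. Qed.

(** The volume is absorbed by the integral of |E D|^p, at the price of a small
    multiple of the integral of the dual quantity: b D = (b E') (E D).  This
    plays the role of the A_infinity property of the scalar weights |E D|^p. *)
Lemma young_cube A E E' B a a' b b' c P D e Cy : jn_data A E E' B a a' b b' ->
  0 < c.2 -> 0 < P.2 -> 0 < e -> 0 <= Cy ->
  (forall b h k, 0 <= b -> 0 <= h -> 0 <= k -> b <= h * k ->
    b `^ p <= e * (b `^ p * h `^ q) + Cy * k `^ p) ->
  (fn (b c *m D)) `^ p * vol P <=
    e * (fn (b c *m D)) `^ p * I_ P (fun x => (fn (b c *m E' x)) `^ q) +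
    Cy * I_ P (fun x => (fn (E x *m D)) `^ p).
Proof.
move=> jn c0 P0 e0 C0 hy; set be := fn (b c *m D).
have eb0 : 0 <= e * be `^ p by rewrite mulr_ge0 ?powR_ge0// ltW.
have L1 : LI (fun x => e * be `^ p * (fn (b c *m E' x)) `^ q).
  by apply: LIZ => //; exact: (LI_E' jn).
have L2 : LI (fun x => Cy * (fn (E x *m D)) `^ p) by apply: LIZ => //; exact: (LI_E jn).
rewrite -(I_cst _ P0) -(I_Z P0 eb0 (LI_E' jn _)) -(I_Z P0 C0 (LI_E jn _)) -(I_D P0 L1 L2).
apply: I_mono_ae => //; first by apply: LI_cst; exact: powR_ge0.
  exact: LID.
apply: filterS (jEE jn) => x hx _; rewrite -mulrA.
apply: hy; rewrite ?fn_ge0//.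
rewrite /be (_ : b c *m D = (b c *m E' x) *m (E x *m D)); first exact: fnM.
by rewrite mulmxA -(mulmxA (b c)) hx mulmx1.
Qed.

Lemma sigma_upper A E E' B a a' b b' c D : jn_data A E E' B a a' b b' -> 0 < c.2 ->
  I_ c (fun x => (fn (E x *m D)) `^ p) <= K * ((fn (b c *m D)) `^ p * vol c).
Proof.
move=> jn cp; have p0 : 0 < p by exact: lt_le_trans p1.
have bp := powR_ge0 (fn (b c *m D)) p.
rewrite mulrCA.
apply: (@le_trans _ _ ((fn (b c *m D)) `^ p * I_ c (fun x => (fn (E x *m b' c)) `^ p))).
  rewrite -(I_Z cp bp (LI_E jn _)).
  apply: (I_mono cp (LI_E jn _) (LIZ bp (LI_E jn _))) => x _.
  rewrite -powRM ?fn_ge0//; apply: powR_le; rewrite ?fn_ge0 ?(ltW p0)//.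
  have -> : E x *m D = (E x *m b' c) *m (b c *m D).
    by rewrite mulmxA -(mulmxA (E x)) (jb jn cp) mulmx1.
  by rewrite mulrC fnM.
by apply: ler_wpM2l => //; exact: (I_E jn cp).
Qed.

(** By induction on the depth N.  The Calderon-Zygmund decomposition of c is
    applied to the normalised oscillation of B at level 2, so that the stopped
    cubes fill at most half of c.  On the cubes that are not stopped, B_N differs
    from its mean over c by a bounded amount; on the stopped ones the induction
    hypothesis applies after a change of mean.  The stopped cubes cannot carry
    almost all of the mass of |E D|^p, by [young_cube], so the estimate is
    reproduced with the same constant. *)
Lemma JN_discrete : exists2 Cs, 0 <= Cs &
  forall A E E' B a a' b b', jn_data A E E' B a a' b b' ->
  forall N c D, 0 < c.2 ->
    J A B D N c (mxmean c B) <= Cs * I_ c (fun x => (fn (E x *m D)) `^ p).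
Proof.
have p0 : 0 < p by exact: lt_le_trans p1.
have e40 : 0 < (4 * K)^-1 by rewrite invr_gt0 mulr_gt0.
have [Cy Cy0 hy] := powR_young p0 q0 e40.
pose c0 := (4 * K * Cy)^-1.
have c0p : 0 < c0 by rewrite invr_gt0 !mulr_gt0.
have [Ce Ce0 he] := powRD_eps p0 c0p.
pose L := (kap * (2 ^+ d * 2)) `^ p.
have L0 : 0 <= L by exact: powR_ge0.
pose C2 := (1 + Ce) * L * K * (4 * Cy).
have C20 : 0 <= C2 by rewrite /C2 !mulr_ge0 ?addr_ge0 ?(ltW K0) ?(ltW Cy0).
have Cs0 : 0 <= C2 / c0 ^+ 2 by rewrite divr_ge0 ?sqr_ge0.
exists (C2 / c0 ^+ 2) => //.
move=> A E E' B a a' b b' jn.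
set Cs := C2 / c0 ^+ 2 in Cs0 *.
elim/ltn_ind => N IH c D cp.
have vc := vol_gt0 cp.
pose F x := fn (a c *m (B x - mxmean c B) *m b' c).
have LF : LI F by apply: LI_fn; apply: MLS_mulR; apply: MLS_mulL; apply: MLS_Bc; exact: (jB jn).
have IF : I_ c F <= vol c by exact: (jBMO jn cp).
have IF2 : I_ c F <= 2 * vol c by apply: le_trans IF _; rewrite ler_peMl ?(ltW vc)// ler1n.
have [G [Bd [hG hBd hT]]] := calderon_zygmund N LF cp IF2.
pose be := fn (b c *m D).
have bep : 0 <= be `^ p by exact: powR_ge0.
pose sg P := I_ P (fun x => (fn (E x *m D)) `^ p).
pose h P := I_ P (fun x => (fn (b c *m E' x)) `^ q).
pose u P := I_ P (fun x => (fn (A x *m a' c)) `^ p).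
have sg0 P : 0 <= sg P by apply: I_ge0 => x; exact: powR_ge0.
have h0 P : 0 <= h P by apply: I_ge0 => x; exact: powR_ge0.
have u0 P : 0 <= u P by apply: I_ge0 => x; exact: powR_ge0.
have Es : sg c = \sum_(P <- G) sg P + \sum_(z <- Bd) sg z.1.
  exact: hT _ (family_I (LI_E jn D)).
have Eh : h c = \sum_(P <- G) h P + \sum_(z <- Bd) h z.1.
  exact: hT _ (family_I (LI_E' jn _)).
have Eu : u c = \sum_(P <- G) u P + \sum_(z <- Bd) u z.1.
  exact: hT _ (family_I (LI_A jn _)).
have EF : I_ c F = \sum_(P <- G) I_ P F + \sum_(z <- Bd) I_ z.1 F.
  exact: hT _ (family_I LF).
have Ev : vol c = \sum_(P <- G) vol P + \sum_(z <- Bd) vol z.1.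
  exact: hT _ (@family_vol _ _).
have EJ : J A B D N c (mxmean c B) = \sum_(P <- G) J A B D 0 P (mxmean c B) +
   \sum_(z <- Bd) J A B D z.2 z.1 (mxmean c B).
  exact: hT _ (@family_J _ _ _ _).
set SG := \sum_(P <- G) sg P in Es; set SB := \sum_(z <- Bd) sg z.1 in Es.
set VG := \sum_(P <- G) vol P in Ev; set VB := \sum_(z <- Bd) vol z.1 in Ev.
(* the mean of F exceeds 2 on the stopped cubes and is at most 1 on c *)
have VB2 : VB <= 2^-1 * vol c.
  rewrite mulrC ler_pdivlMr// mulrC.
  apply: le_trans IF; rewrite EF.
  apply: (@le_trans _ _ (\sum_(z <- Bd) I_ z.1 F)).
    rewrite /VB mulr_sumr big_seq [leRHS]big_seq; apply: ler_sum => z zB.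
    by have [_ _ /ltW] := hBd z zB.
  by rewrite lerDr; apply: sum_mem_ge0 => P _; case: LF => ? F0 _; exact: I_ge0.
have hc : h c <= K * vol c by exact: (I_E' jn cp).
have uc : u c <= K * vol c by exact: (I_A jn cp).
have young : be `^ p * VG <= (4 * K)^-1 * be `^ p * h c + Cy * SG.
  apply: (@le_trans _ _ ((4 * K)^-1 * be `^ p * (\sum_(P <- G) h P) + Cy * SG)).
    rewrite /VG /SG !mulr_sumr -big_split/= big_seq [leRHS]big_seq.
    apply: ler_sum => P /hG[P0 _].
    exact: (young_cube D jn cp P0 e40 (ltW Cy0) hy).
  rewrite lerD2r; apply: ler_wpM2l; first exact: (mulr_ge0 (ltW e40) bep).
  by rewrite Eh lerDl; apply: sum_mem_ge0 => z _; exact: h0.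
have sgc : sg c <= K * (be `^ p * vol c) by exact: (sigma_upper D jn cp).
(* B has changed its mean by a bounded amount on every selected cube *)
have tb P t : 0 < P.2 -> 0 <= t -> t <= 2 ^+ d * 2 -> I_ P F <= t * vol P ->
    I_ P (fun x => (fn (A x *m (mxmean P B - mxmean c B) *m D)) `^ p) <= L * be `^ p * u P.
  move=> P0 t0 tl hP; have tbd := term_bound jn D cp P0 t0 hP; apply: (le_trans tbd).
  apply: ler_wpM2r; first exact: u0.
  have kp : 0 <= kap by exact: ler0n.
  rewrite /L -powRM; [|by rewrite !mulr_ge0|exact: fn_ge0].
  apply: powR_le; [exact: ltW|by rewrite !mulr_ge0 ?fn_ge0|].
  by apply: ler_wpM2r; [exact: fn_ge0|apply: ler_wpM2l].
have d1 : 1 <= 2 ^+ d :> R by rewrite exprn_ege1// ler1n.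
have JG : \sum_(P <- G) J A B D 0 P (mxmean c B) <= L * be `^ p * \sum_(P <- G) u P.
  apply: sum_LI_le => P /hG[P0 hP]; apply: (tb P 2) => //.
  by rewrite ler_peMl.
have JB : \sum_(z <- Bd) J A B D z.2 z.1 (mxmean c B) <=
    (1 + c0) * Cs * SB + Ce * (L * be `^ p) * \sum_(z <- Bd) u z.1.
  rewrite /SB !mulr_sumr -big_split/= big_seq [leRHS]big_seq.
  apply: ler_sum => z /hBd[z0 zN _ hz].
  apply: le_trans (J_shift jn z.2 (mxmean c B) (mxmean z.1 B) D z0 c0p Ce0 he) _.
  apply: lerD.
    by rewrite -mulrA ler_wpM2l ?addr_ge0 ?(ltW c0p)// IH.
  rewrite -mulrA ler_wpM2l//.
  by apply: (tb _ (2 ^+ d * 2)) => //; rewrite mulr_ge0// (le_trans ler01).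
have sum0 (r : seq Cb) (f : Cb -> R) : (forall P, 0 <= f P) -> 0 <= \sum_(P <- r) f P.
  by move=> f0; apply: sum_mem_ge0 => P _; exact: f0.
have sum0' (r : seq (Cb * nat)) (f : Cb -> R) : (forall P, 0 <= f P) -> 0 <= \sum_(z <- r) f z.1.
  by move=> f0; apply: sum_mem_ge0 => P _; exact: f0.
exact: (jn_arith K0 Cy0 erefl Ce0 L0 erefl erefl bep (ltW vc) (sum0 G sg sg0)
  (sum0' Bd sg sg0) (sum0 G u u0) (sum0' Bd u u0) Ev Es Eu EJ hc uc VB2 young sgc JG JB).
Qed.

End john_nirenberg.

(** * The weighted John-Nirenberg estimate *)

Section jn_limit.
Variables (R : realType) (d m : nat) (p q K : R).
Hypotheses (p1 : 1 <= p) (q0 : 0 < q) (K0 : 0 < K).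
Notation X := (Rspace R d).
Notation Cb := (Cb R d).
Notation MX := (X -> 'M[R[i]]_m).
Implicit Types (c P : Cb) (M D : 'M[R[i]]_m).

Definition oscM N c (B : MX) : R := \sum_i \sum_j
  (osc N c (fun x => complex.Re (B x i j)) + osc N c (fun x => complex.Im (B x i j))).

Lemma family_oscM B : family (fun N c => oscM N c B).
Proof.
move=> N c c0; rewrite /oscM [RHS]exchange_big/=; apply: eq_bigr => i _.
by rewrite [RHS]exchange_big/=; apply: eq_bigr => j _; rewrite big_split.
Qed.

Lemma I_sum c (I : Type) (r : seq I) (f : I -> X -> R) : 0 < c.2 ->
  (forall i, LI (f i)) -> I_ c (fun x => \sum_(i <- r) f i x) = \sum_(i <- r) I_ c (f i).
Proof.
move=> c0 hf; elim: r => [|i r IH].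
  by under eq_fun do rewrite big_nil; rewrite I_cst// mul0r big_nil.
under eq_fun do rewrite big_cons.
by rewrite (I_D c0 (hf i) (LI_sum r hf)) IH big_cons.
Qed.

Lemma I_l1_osc c B : 0 < c.2 -> MLS B -> I_ c (fun x => l1 (B x - mxmean c B)) = oscM 0 c B.
Proof.
move=> c0 hB.
have L1 i j : LI (fun x => `|complex.Re ((B x - mxmean c B) i j)|).
  by apply: LI_norm; have [] := MLS_Bc (mxmean c B) hB i j.
have L2 i j : LI (fun x => `|complex.Im ((B x - mxmean c B) i j)|).
  by apply: LI_norm; have [] := MLS_Bc (mxmean c B) hB i j.
rewrite /l1 I_sum//; last by move=> i; apply: LI_sum => j; apply: LID.
apply: eq_bigr => i _; rewrite I_sum//; last by move=> j; apply: LID.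
apply: eq_bigr => j _; rewrite I_D//; congr (_ + _); apply: I_eq => x _; rewrite !mxE.
  by case: (B x i j).
by case: (B x i j).
Qed.

Lemma oscM_cvg c B : 0 < c.2 -> MLS B -> forall eps : R, 0 < eps ->
  exists N, oscM N c B <= eps.
Proof.
move=> c0 hB eps e0.
have : forall eps : R, 0 < eps -> exists N, forall n, (N <= n)%N -> oscM n c B <= eps.
  move=> e ep.
  have Hs (I : finType) (u : I -> nat -> R) : (forall i (e : R), 0 < e -> exists N, forall n, (N <= n)%N -> u i n <= e) ->
      forall e : R, 0 < e -> exists N, forall n, (N <= n)%N -> \sum_i u i n <= e.
    move=> hu e1 e10.
    have k0 : 0 < (#|I|.+1%:R : R) by rewrite ltr0n.
    have /choice[N hN] : forall i, exists N, forall n, (N <= n)%N -> u i n <= e1 / #|I|.+1%:R.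
      by move=> i; apply: hu; rewrite divr_gt0.
    exists (\max_i N i)%N => n hn.
    apply: (@le_trans _ _ (\sum_(i : I) e1 / #|I|.+1%:R)).
      apply: ler_sum => i _; apply: hN; apply: leq_trans hn; exact: leq_bigmax.
    rewrite sumr_const -[leLHS]mulr_natr mulrAC ler_pdivrMr// ler_wpM2l ?(ltW e10)//.
    by rewrite ler_nat.
  apply: (Hs) => // i; apply: (Hs) => j e2 e20.
  have [h1 h2] := hB i j.
  have e22 : 0 < e2 / 2 by rewrite divr_gt0.
  have [N1 H1] := osc_cvg0 c0 h1 e22; have [N2 H2] := osc_cvg0 c0 h2 e22.
  exists (maxn N1 N2) => n; rewrite geq_max => /andP[/H1 k1 /H2 k2]; lra.
by move=> /(_ eps e0)[N hN]; exists N; exact: hN.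
Qed.

Section fixed_data.
Variables (A E E' B : MX) (a a' b b' : Cb -> 'M[R[i]]_m).
Hypothesis jn : jn_data p q K A E E' B a a' b b'.

Let p0 : 0 < p. Proof. exact: lt_le_trans p1. Qed.

Let F M D := fun x => fn (A x *m (B x - M) *m D).

Lemma measurable_F M D : measurable_fun setT (F M D).
Proof.
apply: measurable_fn; apply: mxmM; last exact: mxm_cst.
apply: mxmM; first by case: (jA jn).
by apply: mxmB; [exact: mxm_MLS (jB jn)|exact: mxm_cst].
Qed.

(** Where A and A (B - M) D are bounded by v; these sets exhaust the space as v
    grows. *)
Definition trunc M D (v : R) : set X := [set x | fn (A x) <= v /\ F M D x <= v].

Lemma measurable_trunc M D v : measurable (trunc M D v).
Proof.
have h : measurable_fun setT (fun x => (fn (A x) <= v) && (F M D x <= v)).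
  apply: measurable_and; apply: measurable_fun_ler => //.
    by apply: measurable_fn; case: (jA jn).
  exact: measurable_F.
rewrite (_ : trunc M D v = setT `&` (fun x => (fn (A x) <= v) && (F M D x <= v)) @^-1` [set true]).
  exact: h.
by apply/seteqP; split=> [x [h1 h2]|x [_ /andP[]]] //; split => //=; rewrite h1 h2.
Qed.

Definition tF M D v x := \1_(trunc M D v) x * (F M D x) `^ p.

Lemma measurable_tF M D v : measurable_fun setT (tF M D v).
Proof.
apply: measurable_funM; first exact: measurable_indic (measurable_trunc _ _ _).
exact: (measurableT_comp (measurable_powR _) (measurable_F M D)).
Qed.

Lemma tF_ge0 M D v x : 0 <= tF M D v x.
Proof. by rewrite mulr_ge0// powR_ge0. Qed.

Lemma LI_tF M D v : 0 <= v -> LI (tF M D v).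
Proof.
move=> v0; apply: (@LI_le0 _ _ _ (fun=> v `^ p) (measurable_tF M D v) (tF_ge0 M D v)).
  exact: (LI_cst _ (powR_ge0 v p)).
move=> x; rewrite /tF indicE; have [xt|] := boolP (x \in _); last by rewrite mul0r powR_ge0.
rewrite mul1r; apply: powR_le; rewrite ?fn_ge0 ?(ltW p0)//.
by rewrite inE in xt; case: xt.
Qed.

(** On the truncated set the difference s between |A (B - M) D| and
    |A (B_N - M) D| is at most v, so s^p <= v^(p - 1) s, and its integral is
    controlled by the L^1 distance from B to B_N. *)
Lemma trunc_bound N c M D v C : 0 < c.2 -> 0 < v -> 0 <= C ->
  (forall r s, 0 <= r -> 0 <= s -> (r + s) `^ p <= (1 + 1) * r `^ p + C * s `^ p) ->
  I_ c (tF M D v) <= (1 + 1) * J p A B D N c M +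
    C * (v `^ (p - 1) * (v * fn D)) * oscM N c B.
Proof.
move=> + v0 C0 hC.
have k0 : 0 <= C * (v `^ (p - 1) * (v * fn D)).
  by rewrite !mulr_ge0 ?powR_ge0 ?fn_ge0 ?(ltW v0).
elim: N c => [|N IH] c c0.
  have LB : LI (fun x => l1 (B x - mxmean c B)) by apply/LI_l1/MLS_Bc; exact: (jB jn).
  have LA := LI_A2 p1 jn (mxmean c B - M) D.
  have two0 : 0 <= 1 + 1 :> R by [].
  rewrite -(I_l1_osc c0 (jB jn)) /= -(I_Z c0 k0 LB) -(I_Z c0 two0 LA).
  rewrite -(I_D c0 (LIZ two0 LA) (LIZ k0 LB)).
  apply: (I_mono c0 (LI_tF M D (ltW v0)) (LID (LIZ two0 LA) (LIZ k0 LB))) => x _.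
  set g := fn (A x *m (mxmean c B - M) *m D).
  have l0 : 0 <= l1 (B x - mxmean c B) by exact: le_trans (fn_ge0 _) (fn_le_l1 _).
  rewrite /tF indicE; have [xt|] := boolP (x \in _); last first.
    by rewrite mul0r addr_ge0// mulr_ge0 ?powR_ge0.
  rewrite mul1r; rewrite inE in xt; case: xt => Av Fv.
  have g0 : 0 <= g by exact: fn_ge0.
  have [Fg|gF] := leP (F M D x) g.
    apply: (@le_trans _ _ (g `^ p)); first by apply: powR_le; rewrite ?fn_ge0 ?(ltW p0).
    apply: ler_wpDr; first by rewrite mulr_ge0.
    by rewrite mulrDl mul1r lerDl powR_ge0.
  pose s := F M D x - g.
  have s0 : 0 <= s by rewrite subr_ge0 ltW.
  have sv : s <= v by rewrite /s; lra.
  have sB : s <= v * fn D * l1 (B x - mxmean c B).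
    have h1 : F M D x <= g + fn (A x *m (B x - mxmean c B) *m D).
      have E0 : A x *m (B x - M) *m D = A x *m (mxmean c B - M) *m D +
          A x *m (B x - mxmean c B) *m D.
        by rewrite -mulmxDl -mulmxDr (addrC (mxmean c B - M)) subrKA.
      by rewrite /F E0; exact: fnD.
    have h2 : fn (A x *m (B x - mxmean c B) *m D) <= v * l1 (B x - mxmean c B) * fn D.
      apply: le_trans (fnM3 _ _ _) _; apply: ler_wpM2r; first exact: fn_ge0.
      by apply: ler_pM => //; rewrite ?fn_ge0//; exact: fn_le_l1.
    rewrite mulrAC in h2; rewrite /s; lra.
  have -> : F M D x = g + s by rewrite /s addrC subrK.
  apply: le_trans (hC _ _ g0 s0) _; rewrite lerD2l -!mulrA.
  apply: ler_wpM2l => //.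
  have -> : s `^ p = s `^ (p - 1) * s.
    have [->|sn0] := eqVneq s 0; first by rewrite mulr0 powR0// gt_eqF.
    rewrite -[X in _ * X](powRr1 s0) -powRD ?subrK//.
    by rewrite sn0 implybT.
  apply: ler_pM => //; first exact: powR_ge0.
    by apply: powR_le => //; rewrite subr_ge0.
  by rewrite mulrA.
rewrite (I_children c0 (LI_tF M D (ltW v0))) (family_oscM B N c0) /= !mulr_sumr -big_split/=.
by apply: ler_sum => e _; apply: IH; exact: child_gt0.
Qed.

End fixed_data.

(** At fixed truncation B_N tends to B in L^1 by [osc_cvg0], so [JN_discrete]
    passes to the limit; then the truncation is removed by monotone
    convergence. *)
Theorem john_nirenberg : exists2 Cs, 0 <= Cs &
  forall A E E' B a a' b b', jn_data p q K A E E' B a a' b b' ->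
  forall c D, 0 < c.2 ->
    (int c (fun x => (fn (A x *m (B x - mxmean c B) *m D) `^ p)%R) <=
     (Cs * I_ c (fun x => (fn (E x *m D) `^ p)%R))%:E)%E.
Proof.
have p0 : 0 < p by exact: lt_le_trans p1.
have [Cs Cs0 H] := @JN_discrete R d m p q K p1 q0 K0.
have [C C0 hC] := @powRD_eps R p 1 p0 ltr01.
exists ((1 + 1) * Cs); first by rewrite mulr_ge0.
move=> A E E' B a a' b b' jn c D c0; set M := mxmean c B.
set sg := I_ c _.
have bnd v : 0 < v -> I_ c (tF A B M D v) <= (1 + 1) * Cs * sg.
  move=> v0; apply/ler_addgt0Pl => eps e0.
  pose k := C * (v `^ (p - 1) * (v * fn D)).
  have k0 : 0 <= k by rewrite !mulr_ge0 ?powR_ge0 ?fn_ge0 ?(ltW v0).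
  have k1 : 0 < k + 1 by rewrite ltr_wpDl.
  have [N hN] := oscM_cvg c0 (jB jn) (divr_gt0 e0 k1).
  apply: le_trans (trunc_bound jn N M D c0 v0 C0 hC) _.
  rewrite addrC; apply: lerD.
    rewrite -/k; apply: (@le_trans _ _ ((k + 1) * oscM N c B)).
      rewrite ler_wpM2r ?lerDl// /oscM; apply: sumr_ge0 => i _; apply: sumr_ge0 => j _.
      by rewrite addr_ge0 ?osc_ge0.
    by rewrite mulrC -ler_pdivlMr.
  by rewrite -mulrA ler_wpM2l//; exact: H jn N c D c0.
pose f x := (fn (A x *m (B x - M) *m D)) `^ p.
pose g n x := ((tF A B M D n.+1%:R x)%:E)%E.
have cg x : g n x @[n --> \oo] --> ((f x)%:E)%E.
  apply: cvg_near_cst.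
  exists (Num.truncn (Num.max (fn (A x)) (fn (A x *m (B x - M) *m D)))).+1 => // n /= hn.
  rewrite /g /tF indicE mem_set ?mul1r//.
  have h0 : 0 <= Num.max (fn (A x)) (fn (A x *m (B x - M) *m D)) by rewrite le_max fn_ge0.
  have /andP[_ h1] := truncn_itv h0.
  have h2 : Num.max (fn (A x)) (fn (A x *m (B x - M) *m D)) <= n.+1%:R.
    by apply: le_trans (ltW h1) _; rewrite ler_nat; exact: leq_trans hn _.
  by move: h2; rewrite ge_max => /andP[].
have mg n : measurable_fun (cset c) (g n).
  by apply: mEFin; exact: (measurable_tF jn).
have g0 n x : cset c x -> (0 <= g n x)%E.
  by move=> _; rewrite lee_fin; exact: tF_ge0.
have ndg x : cset c x -> nondecreasing_seq (g ^~ x).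
  move=> _ n1 n2 n12; rewrite lee_fin /tF; apply: ler_wpM2r; first exact: powR_ge0.
  rewrite !indicE ler_nat; case: (boolP (x \in trunc A B M D n1.+1%:R)) => //.
  rewrite inE => -[h1 h2]; rewrite mem_set//.
  have : n1.+1%:R <= n2.+1%:R :> R by rewrite ler_nat.
  by move=> h3; split; [exact: le_trans h3|exact: le_trans h3].
rewrite (_ : int c _ = \int[leb d]_(x in cset c) (limn (g ^~ x)))%E; last first.
  by apply: eq_integral => x _; apply/esym/cvg_lim => //; exact: cg.
rewrite (monotone_convergence _ (measurable_cset c) mg g0 ndg).
apply: lime_le.
  apply: ereal_nondecreasing_is_cvgn => n1 n2 n12 /=.
  have := @ge0_le_integral _ _ _ (leb d) _ (measurable_cset c) _ _ (g0 n1) (mg n1) (mg n2).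
  apply=> x cx.
  exact: ndg.
apply: nearW => n.
have v0 : 0 < n.+1%:R :> R by rewrite ltr0n.
rewrite -/(int c (tF A B M D n.+1%:R)) (intE c0 (LI_tF jn M D (ltW v0))) lee_fin.
exact: bnd.
Qed.

End jn_limit.

(** * Points at which an A_p kernel is controlled *)

Section good_point.
Variables (R : realType) (d : nat).
Notation X := (Rspace R d).
Notation Cb := (Cb R d).
Notation mu := (@leb R d).
Implicit Types (c : Cb).

Lemma chebyshev (D : set X) (f : X -> \bar R) (a : R) : measurable D -> 0 < a ->
  measurable_fun setT f -> (forall x, (0 <= f x)%E) ->
  (a%:E * mu (D `&` [set x | a%:E < f x]) <= \int[mu]_(x in D) f x)%E.
Proof.
move=> mD a0 mf f0.
have mE : measurable (D `&` [set x | (a%:E < f x)%E]).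
  apply: measurableI => //; rewrite -[X in measurable X]setTI.
  exact: emeasurable_fun_o_infty.
have mfD E : measurable_fun E f by exact: measurable_funTS.
apply: (@le_trans _ _ (\int[mu]_(x in D `&` [set x | (a%:E < f x)%E]) f x)%E); last first.
  by apply: ge0_subset_integral => //; exact: mfD.
rewrite -integral_cst//; apply: ge0_le_integral => //.
- by move=> x _; rewrite lee_fin ltW.
- by move=> x [_ /= /ltW].
Qed.

(** In the form used to find a point where several functions are at most four
    times their means: the exceptional sets fill a quarter of the volume each. *)
Lemma chebyshev_vol (D : set X) (f : X -> \bar R) (a : R) (V : R) : measurable D -> 0 < a -> 0 <= V ->
  measurable_fun setT f -> (forall x, (0 <= f x)%E) ->
  (\int[mu]_(x in D) f x <= (a * V)%:E)%E ->
  (mu (D `&` [set x | (4 * a)%:E < f x]) <= (V / 4)%:E)%E.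
Proof.
move=> mD a0 V0 mf f0 h.
have a4 : 0 < 4 * a by rewrite mulr_gt0.
have := le_trans (chebyshev mD a4 mf f0) h.
rewrite -lee_pdivlMl// => /le_trans; apply.
rewrite -EFinM lee_fin le_eqVlt; apply/orP; left; apply/eqP; field.
by rewrite gt_eqF.
Qed.

Lemma measurable_memb (D : set X) : measurable D -> measurable_fun setT (fun x : X => x \in D).
Proof.
move=> mD; apply: (measurable_fun_bool true).
rewrite (_ : _ `&` _ = D)//; apply/seteqP; split=> [x [_ /=]|x xD]; first by move=> /set_mem.
by split => //=; rewrite mem_set.
Qed.

Lemma measurable_int2_set (f : X * X -> R) (E : set X) : measurable E ->
  measurable_fun setT f -> (forall z, 0 <= f z) ->
  measurable_fun setT (fun x => \int[mu]_(y in E) (f (x, y))%:E)%E.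
Proof.
move=> mE mf f0.
pose F z : \bar R := if z.2 \in E then (f z)%:E else 0%E.
have mF : measurable_fun setT F.
  apply: measurable_fun_ifT; [|exact/measurable_EFinP|exact: measurable_cst].
  exact: measurableT_comp (measurable_memb mE) measurable_snd.
have F0 z : (0 <= F z)%E by rewrite /F; case: ifP => //; rewrite lee_fin.
have := measurable_int2 mF F0.
suff -> : (fun x => \int[mu]_y F (x, y))%E = (fun x => \int[mu]_(y in E) (f (x, y))%:E)%E by [].
by apply/funext => x; rewrite [RHS]integral_mkcond.
Qed.

Lemma tonelli_set (f : X * X -> R) (D E : set X) : measurable D -> measurable E ->
  measurable_fun setT f -> (forall z, 0 <= f z) ->
  (\int[mu]_(x in D) \int[mu]_(y in E) (f (x, y))%:E =
   \int[mu]_(y in E) \int[mu]_(x in D) (f (x, y))%:E)%E.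
Proof.
move=> mD mE mf f0.
pose F z : \bar R := if (z.1 \in D) && (z.2 \in E) then (f z)%:E else 0%E.
have mF : measurable_fun setT F.
  apply: measurable_fun_ifT; [|exact/measurable_EFinP|exact: measurable_cst].
  apply: measurable_and.
    exact: measurableT_comp (measurable_memb mD) measurable_fst.
  exact: measurableT_comp (measurable_memb mE) measurable_snd.
have F0 z : (0 <= F z)%E by rewrite /F; case: ifP => //; rewrite lee_fin.
have := tonelli mF F0.
have -> : (\int[mu]_x \int[mu]_y F (x, y) = \int[mu]_(x in D) \int[mu]_(y in E) (f (x, y))%:E)%E.
  rewrite [RHS]integral_mkcond; apply: eq_integral => x _.
  rewrite patchE /F/=; case: (x \in D) => /=; last by rewrite integral0.
  by rewrite [RHS]integral_mkcond.
move=> ->; rewrite [RHS]integral_mkcond; apply: eq_integral => y _.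
rewrite patchE /F/=; case: (y \in E) => /=.
  rewrite [RHS]integral_mkcond; apply: eq_integral => x _.
  by rewrite patchE andbT.
by under eq_integral do rewrite andbF; rewrite integral0.
Qed.

Lemma le_poweR (x y : \bar R) (r : R) : 0 <= r -> (0 <= x)%E -> (x <= y)%E ->
  (x `^ r <= y `^ r)%E.
Proof.
move=> r0 x0 xy; apply: gt0_ler_poweR => //; rewrite in_itv/= ?x0 ?leey//.
by rewrite (le_trans x0 xy).
Qed.

Lemma poweRK (x : \bar R) (r : R) : 0 < r -> (0 <= x)%E -> ((x `^ r) `^ r^-1 = x)%E.
Proof. by move=> r0 x0; rewrite -poweRrM mulfV ?gt_eqF// poweRe1. Qed.

Lemma le_measureU3 (D A B E : set X) : measurable D -> measurable A -> measurable B ->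
  measurable E -> D `<=` A `|` B `|` E -> (mu D <= mu A + mu B + mu E)%E.
Proof.
move=> mD mA mB mE sub; have mAB := measurableU _ _ mA mB.
apply: (@le_trans _ _ (mu (A `|` B `|` E))).
  by apply: le_measure; rewrite ?inE//; exact: measurableU.
apply: (@le_trans _ _ (mu (A `|` B) + mu E)%E); first exact: measureU2.
by apply: leeD => //; exact: measureU2.
Qed.

(** Both bounds hold at suitable points by Chebyshev's inequality.  For the first
    one this is immediate.  For the second one, x0 is moreover chosen so that
    k(y, x0) is bounded for most y, which is possible by Tonelli's theorem; taking
    the mean of k(x, z) <= k(x, y) k(y, z) with z = x0 over these y bounds
    k(x, x0)^q by a multiple of the mean of k(x, y)^q. *)
Lemma good_point (p q s : R) : 0 < p -> 0 < q -> 0 <= s -> exists2 C : R, 0 <= C &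
  forall (k : X * X -> R) (G : set X) c,
  measurable_fun setT k -> (forall z, 0 <= k z) -> {ae mu, forall y, G y} ->
  (forall x y z, G y -> k (x, z) <= k (x, y) * k (y, z)) -> 0 < c.2 ->
  (\int[mu]_(x in cset c) ((vol c)^-1%:E * \int[mu]_(y in cset c) ((k (x, y)) `^ q)%R%:E) `^ (p / q)
     <= (s * vol c)%:E)%E ->
  exists x0, [/\ G x0, (\int[mu]_(y in cset c) ((k (x0, y)) `^ q)%R%:E <= (C * vol c)%:E)%E &
     (\int[mu]_(x in cset c) ((k (x, x0)) `^ p)%R%:E <= (C * vol c)%:E)%E].
Proof.
move=> p0 q0 s0.
have e0 : 0 < p / q by rewrite divr_gt0.
pose s1 := s + 1.
have s10 : 0 < s1 by rewrite ltr_wpDl.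
pose c1 := (4 * s1) `^ (p / q)^-1.
have c10 : 0 < c1 by apply: powR_gt0; rewrite mulr_gt0.
pose C := c1 + (32 * c1) `^ (p / q) * s.
exists C; first by rewrite addr_ge0 ?(ltW c10)// mulr_ge0 ?powR_ge0.
move=> k G c mk k0 hG ksub cp hint.
have v0 := vol_gt0 cp.
have mc := measurable_cset c.
pose f z := (k z) `^ q.
have mf : measurable_fun setT f by exact: (measurableT_comp (measurable_powR _) mk).
have f0 z : 0 <= f z by exact: powR_ge0.
pose h x := (\int[mu]_(y in cset c) (f (x, y))%:E)%E.
have mh : measurable_fun setT h by exact: measurable_int2_set.
have h0 x : (0 <= h x)%E by apply: integral_ge0 => y _; rewrite lee_fin.
pose H x := ((vol c)^-1%:E * h x)%E.
have mH : measurable_fun setT H by apply: emeasurable_funM => //; exact: measurable_cst.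
have H0 x : (0 <= H x)%E by rewrite mule_ge0// lee_fin invr_ge0 ltW.
have hH x : h x = ((vol c)%:E * H x)%E.
  by rewrite /H muleA -EFinM divff ?mul1e// gt_eqF.
pose He x := (H x `^ (p / q))%E.
have mHe : measurable_fun setT He by exact: (measurableT_comp (measurable_poweR _) mH).
have He0 x : (0 <= He x)%E by exact: poweR_ge0.
have iHe : (\int[mu]_(x in cset c) He x <= (s1 * vol c)%:E)%E.
  by apply: (le_trans hint); rewrite lee_fin ler_pM2r// lerDl.
have ch1 := chebyshev_vol mc s10 (ltW v0) mHe He0 iHe.
pose S := cset c `&` [set x | (He x <= (4 * s1)%:E)%E].
have mS : measurable S.
  apply: measurableI => //; rewrite -[X in measurable X]setTI.
  exact: emeasurable_fun_infty_c.
have hS x : S x -> (h x <= (vol c * c1)%:E)%E.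
  move=> [_ /= hx]; rewrite hH EFinM lee_pmul2l ?lte_fin//.
  rewrite -(poweRK e0 (H0 x)) /c1 -poweR_EFin; apply: le_poweR.
  - by rewrite invr_ge0 ltW.
  - exact: He0.
  - exact: hx.
pose g y := (\int[mu]_(x in S) (f (x, y))%:E)%E.
have mg : measurable_fun setT g.
  apply: (@measurable_int2_set (fun z => f (z.2, z.1))) => //.
  by apply: measurableT_comp => //; exact: measurable_swap.
have g0 y : (0 <= g y)%E by apply: integral_ge0 => z _; rewrite lee_fin.
have leSc : (mu S <= (vol c)%:E)%E.
  by rewrite -leb_cset//; apply: le_measure; rewrite ?inE//; exact: subIsetl.
have ig : (\int[mu]_(y in cset c) g y <= ((c1 * vol c) * vol c)%:E)%E.
  rewrite /g -(tonelli_set mS mc mf f0) -/(h _).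
  apply: (@le_trans _ _ (\int[mu]_(x in S) (cst (vol c * c1)%:E x))%E).
    have := @ge0_le_integral _ _ _ mu S mS h (cst (vol c * c1)%:E)%E.
    apply; [by move=> x _; exact: h0|exact: measurable_funTS|exact: measurable_cst|].
    by move=> x; exact: hS.
  rewrite integral_cst// (mulrC c1) (EFinM _ (vol c)); apply: lee_wpmul2l => //.
  by rewrite lee_fin mulr_ge0// ltW.
have cv0 : 0 < c1 * vol c by rewrite mulr_gt0.
have ch2 := chebyshev_vol mc cv0 (ltW v0) mg g0 ig.
have [N [mN N0 GN]] := hG.
have cS : cset c `<=` S `|` (cset c `&` [set x | ((4 * s1)%:E < He x)%E]).
  move=> x cx; have [hl|hl] := leP (He x) (4 * s1)%:E; first by left; split.
  by right; split.
have mA1 : measurable (cset c `&` [set x | ((4 * s1)%:E < He x)%E]).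
  apply: measurableI => //; rewrite -[X in measurable X]setTI.
  exact: emeasurable_fun_o_infty.
have mA2 : measurable (cset c `&` [set x | ((4 * (c1 * vol c))%:E < g x)%E]).
  apply: measurableI => //; rewrite -[X in measurable X]setTI.
  exact: emeasurable_fun_o_infty.
have [x0 [Sx0 gx0 Gx0]] : exists x0, [/\ S x0, (g x0 <= (4 * (c1 * vol c))%:E)%E & G x0].
  apply/not_existsP => hno.
  have sub : cset c `<=` (cset c `&` [set x | ((4 * s1)%:E < He x)%E]) `|`
     (cset c `&` [set x | ((4 * (c1 * vol c))%:E < g x)%E]) `|` N.
    move=> x cx; have [Sx|A1x] := cS x cx; last by left; left.
    have [hl|hl] := leP (g x) (4 * (c1 * vol c))%:E; last by left; right.
    right; apply: GN => Gx; exact: (hno x).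
  have h1 := le_measureU3 mc mA1 mA2 mN sub.
  rewrite leb_cset// N0 adde0 in h1.
  have := le_trans h1 (leeD ch1 ch2).
  rewrite -EFinD lee_fin; lra.
have c16 : 0 < 4 * c1 by rewrite mulr_gt0.
have mfx y : measurable_fun setT (fun x => (f (x, y))%:E).
  apply/measurable_EFinP; exact: measurable_fun_pair1.
have mfy x : measurable_fun setT (fun y => (f (x, y))%:E).
  apply/measurable_EFinP; exact: measurable_fun_pair2.
have ffx y x : (0 <= (f (x, y))%:E)%E by rewrite lee_fin.
have gx0' : (\int[mu]_(x in S) (f (x, x0))%:E <= (4 * c1 * vol c)%:E)%E.
  by rewrite -mulrA.
have ch3 := chebyshev_vol mS c16 (ltW v0) (mfx x0) (ffx x0) gx0'.
set t := 4 * (4 * c1) in ch3.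
have t0 : 0 < t by rewrite mulr_gt0.
pose Tb := S `&` [set x | (t%:E < (f (x, x0))%:E)%E].
pose T := S `&` [set x | ((f (x, x0))%:E <= t%:E)%E].
have mT : measurable T.
  apply: measurableI => //; rewrite -[X in measurable X]setTI.
  exact: emeasurable_fun_infty_c.
have mTb : measurable Tb.
  apply: measurableI => //; rewrite -[X in measurable X]setTI.
  exact: emeasurable_fun_o_infty.
have muT : ((vol c / 2)%:E <= mu T)%E.
  have sub : cset c `<=` T `|` Tb `|` (cset c `&` [set x | ((4 * s1)%:E < He x)%E]).
    move=> x cx; have [Sx|A1x] := cS x cx; last by right.
    left; have [hl|hl] := leP (f (x, x0))%:E t%:E; [by left|by right].
  have h1 := le_measureU3 mc mT mTb mA1 sub.
  rewrite leb_cset// in h1.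
  have h2 := le_trans h1 (leeD (leeD (lexx _) ch3) ch1).
  have : (mu T < +oo)%E.
    apply: (@le_lt_trans _ _ (vol c)%:E); last exact: ltry.
    apply: le_trans leSc; apply: le_measure; rewrite ?inE//; exact: subIsetl.
  have := measure_ge0 mu T.
  move: h2; case: (mu T) => [r| |]//.
  by rewrite -!EFinD !lee_fin => ? ? ?; lra.
have key x : ((f (x, x0))%:E <= (2 * t)%:E * H x)%E.
  have : ((f (x, x0))%:E * mu T <= t%:E * h x)%E.
    have mtf E : measurable_fun E (fun y => t%:E * (f (x, y))%:E)%E.
      by apply: measurable_funTS; apply: emeasurable_funM => //; exact: measurable_cst.
    have <- := @ge0_integralZl_EFin _ _ _ mu _ mc (fun y => (f (x, y))%:E)
      (fun y _ => ffx y x) (measurable_funTS (mfy x)) t (ltW t0).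
    rewrite -integral_cst//.
    apply: (@le_trans _ _ (\int[mu]_(y in T) (t%:E * (f (x, y))%:E))%E).
        apply: (@ae_ge0_le_integral _ _ _ mu _ mT (cst (f (x, x0))%:E)).
        - by move=> y _; exact: ffx.
        - exact: measurable_cst.
        - by move=> y _; rewrite mule_ge0// lee_fin ltW.
        - exact: mtf.
        apply: filterS hG => y Gy [_ /=]; rewrite lee_fin => hy.
        rewrite -EFinM lee_fin /f; apply: (@le_trans _ _ (f (y, x0) * f (x, y))).
          by rewrite -powRM// mulrC; apply: powR_le; rewrite ?(ltW q0)//; exact: ksub.
        by apply: ler_wpM2r.
    have hsub := @ge0_subset_integral _ _ _ mu T (cset c) mT mc _ (mtf (cset c)).
    apply: hsub.
      by move=> y _; rewrite mule_ge0// lee_fin ltW.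
    by move=> y [[]].
  move=> h1; have h2 : ((f (x, x0))%:E * (vol c / 2)%:E <= t%:E * h x)%E.
    by apply: le_trans h1; apply: lee_wpmul2l.
  rewrite -(@lee_pmul2r _ (vol c / 2)%:E) ?fin_numE//; last by rewrite lte_fin divr_gt0.
  apply: le_trans h2 _; rewrite hH muleA -EFinM.
  rewrite muleAC -EFinM le_eqVlt; apply/orP; left; apply/eqP; congr (_%:E * _)%E.
  by field.
exists x0; split => //.
  have [_ /=] := Sx0 => _; apply: (le_trans (hS _ Sx0)).
  rewrite lee_fin mulrC; apply: ler_wpM2r; first exact: ltW.
  by rewrite lerDl mulr_ge0// powR_ge0.
have te : t = 16 * c1 by rewrite /t; ring.
apply: (@le_trans _ _ (\int[mu]_(x in cset c) (((32 * c1) `^ (p / q))%:E * He x))%E).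
  apply: ge0_le_integral => //.
  - by move=> x _; rewrite lee_fin powR_ge0.
  - apply: measurable_funTS; apply/measurable_EFinP.
    apply: (measurableT_comp (measurable_powR _)); exact: measurable_fun_pair1.
  - by apply: measurable_funTS; apply: emeasurable_funM => //; exact: measurable_cst.
  move=> x _; have := le_poweR (ltW e0) (ffx x0 x) (key x).
  rewrite poweRM ?lee_fin ?mulr_ge0 ?(ltW c10)// !poweR_EFin.
  rewrite (_ : 2 * t = 32 * c1); last by rewrite te; ring.
  by rewrite /f -powRrM mulrC divfK// gt_eqF.
rewrite (@ge0_integralZl_EFin _ _ _ mu _ mc He (fun x _ => He0 x) (measurable_funTS mHe) _ (powR_ge0 _ _)).
apply: (@le_trans _ _ (((32 * c1) `^ (p / q))%:E * (s * vol c)%:E)%E).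
  by apply: lee_wpmul2l => //; rewrite lee_fin powR_ge0.
by rewrite -EFinM lee_fin mulrA ler_wpM2r ?(ltW v0)// lerDr ltW.
Qed.

End good_point.

(** * Determinants and inverses *)

Section determinant_bounds.
Variable R : realType.
Implicit Types (n : nat).

Lemma normc_prod (I : Type) (r : seq I) (P : pred I) (f : I -> R[i]) :
  normc (\prod_(i <- r | P i) f i) = \prod_(i <- r | P i) normc (f i).
Proof.
elim/big_rec2 : _ => [|i y1 y2 _ <-]; first by rewrite normc1.
by rewrite normcM.
Qed.

Lemma normc_sign k : normc ((-1) ^+ k : R[i]) = 1.
Proof.
by elim: k => [|k IH]; rewrite ?expr0 ?normc1// exprS normcM IH normcN normc1 mulr1.
Qed.

Lemma normc_det_le n (M : 'M[R[i]]_n) t : (forall i j, normc (M i j) <= t) ->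
  normc (\det M) <= (n`!)%:R * t ^+ n.
Proof.
move=> h; apply: le_trans (normc_sum _ _ _) _.
apply: (@le_trans _ _ (\sum_(s : 'S_n) t ^+ n)); last first.
  by rewrite sumr_const card_Sn mulr_natl.
apply: ler_sum => s _; rewrite normcM normc_sign mul1r normc_prod.
rewrite -[X in _ <= _ ^+ X](card_ord n) -prodr_const.
by apply: ler_prod => i _; rewrite normc_ge0 h.
Qed.

(** Each eigenvalue is at most the trace. *)
Lemma posdef_det_trace n (N : 'M[R[i]]_n) : posdefmx N ->
  normc (\det N) <= complex.Re (\tr N) ^+ n.
Proof.
move=> pN; have d0 i := ltW (posdef_sd pN i).
rewrite (herm_udiag (posdef_tr pN)) det_udiag ?spV// trace_udiag ?spV//.
rewrite normc_real ger0_norm ?prodr_ge0//= -[X in _ <= _ ^+ X](card_ord n) -prodr_const.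
apply: ler_prod => i _; rewrite d0/= (bigD1 i)//= lerDl.
exact: sumr_ge0.
Qed.

(** By Cramer's rule, the determinant of Y being the inverse of that of X. *)
Lemma inv_bound n (X Y : 'M[R[i]]_n) t dl : X *m Y = 1%:M -> 0 <= t -> fn X <= t ->
  normc (\det Y) <= dl -> fn Y <= (n * n)%:R * (dl * (((n.-1)`!)%:R * t ^+ n.-1)).
Proof.
move=> XY t0 Xt Ydl; have [uX uY] := mulmx1_unit XY.
have dXY : \det X * \det Y = 1 by rewrite -det_mulmx XY det1.
have dX : (\det X)^-1 = \det Y.
  have dX0 : \det X != 0 by rewrite -unitfE -unitmxE.
  by apply: (mulfI dX0); rewrite mulfV// dXY.
have YE : Y = \det Y *: \adj X.
  by rewrite -dX -[LHS](mulKmx uX) XY mulmx1 /invmx uX.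
apply: le_trans (fn_le_sum _) _.
apply: (@le_trans _ _ (\sum_(i < n) \sum_(j < n) (dl * (((n.-1)`!)%:R * t ^+ n.-1)))); last first.
  by rewrite !sumr_const card_ord -mulrnA -[leLHS]mulr_natl.
apply: ler_sum => i _; apply: ler_sum => j _.
rewrite YE mxE normcM; apply: ler_pM => //; rewrite ?normc_ge0//.
rewrite mxE normcM normc_sign mul1r; apply: normc_det_le => k l.
by rewrite !mxE; apply: le_trans (fn_entry _ _ _) Xt.
Qed.

End determinant_bounds.

Section weight_kernel.
Variables (R : realType) (d : nat).
Notation X := (Rspace R d).
Notation Cb := (Cb R d).
Notation mu := (@leb R d).
Implicit Types (c : Cb).

Lemma mxm_comp d1 d2 (T1 : measurableType d1) (T2 : measurableType d2) m n
    (A : T2 -> 'M[R[i]]_(m, n)) (phi : T1 -> T2) :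
  measurable_fun setT phi -> mxm A -> mxm (fun x => A (phi x)).
Proof.
move=> mp mA i j; have [h1 h2] := mA i j; split.
  exact: (measurableT_comp h1 mp).
exact: (measurableT_comp h2 mp).
Qed.

Lemma measurable_kernel m (A A' : X -> 'M[R[i]]_m) : mxm A -> mxm A' ->
  measurable_fun setT (fun z : X * X => opnorm (A z.1 *m A' z.2)).
Proof.
move=> mA mA'; apply: measurable_opnorm; apply: mxmM.
  exact: mxm_comp measurable_fst mA.
exact: mxm_comp measurable_snd mA'.
Qed.

Lemma dual_exp_gt0 (p : R) : 1 < p -> 0 < dual_exp p.
Proof.
move=> p1; rewrite /dual_exp invr_gt0 subr_gt0 invf_lt1//.
exact: lt_trans p1.
Qed.

Lemma dual_exp_ge1 (p : R) : 1 < p -> 1 <= dual_exp p.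
Proof.
move=> p1; have p0 : 0 < p by exact: lt_trans p1.
have h : 0 < 1 - p^-1 by rewrite subr_gt0 invf_lt1.
by rewrite /dual_exp invf_ge1// gerBl invr_ge0 ltW.
Qed.

Lemma avg_le (f : X -> \bar R) c (r : R) : 0 < c.2 ->
  (avg (cset c) f <= r%:E)%E <-> (\int[mu]_(x in cset c) f x <= (r * vol c)%:E)%E.
Proof.
move=> c0; have v0 := vol_gt0 c0; rewrite /avg leb_cset//=.
by rewrite lee_pdivrMl// -EFinM mulrC.
Qed.

Lemma avgE (f : X -> \bar R) c : 0 < c.2 ->
  avg (cset c) f = ((vol c)^-1%:E * \int[mu]_(x in cset c) f x)%E.
Proof. by move=> c0; rewrite /avg leb_cset. Qed.

End weight_kernel.

(** * Matrix A_p weights on a fixed cube *)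

Section reducing.
Variables (R : realType) (d : nat).
Notation X := (Rspace R d).
Notation Cb := (Cb R d).
Notation mu := (@leb R d).
Implicit Types (c : Cb).

(** Each of the two functions is more than four times its mean on at most a
    quarter of the cube. *)
Lemma exists_below c (f1 f2 : X -> \bar R) (a1 a2 : R) (G : set X) : 0 < c.2 -> 0 < a1 -> 0 < a2 ->
  measurable_fun setT f1 -> measurable_fun setT f2 ->
  (forall x, (0 <= f1 x)%E) -> (forall x, (0 <= f2 x)%E) -> {ae mu, forall x, G x} ->
  (\int[mu]_(x in cset c) f1 x <= (a1 * vol c)%:E)%E ->
  (\int[mu]_(x in cset c) f2 x <= (a2 * vol c)%:E)%E ->
  exists y, [/\ cset c y, G y, (f1 y <= (4 * a1)%:E)%E & (f2 y <= (4 * a2)%:E)%E].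
Proof.
move=> c0 a10 a20 mf1 mf2 f10 f20 [N [mN N0 GN]] i1 i2.
have v0 := vol_gt0 c0; have mc := measurable_cset c.
have mA (f : X -> \bar R) (a : R) : measurable_fun setT f -> measurable (cset c `&` [set x | ((4 * a)%:E < f x)%E]).
  move=> mf; apply: measurableI => //; rewrite -[X in measurable X]setTI.
  exact: emeasurable_fun_o_infty.
have ch1 := chebyshev_vol mc a10 (ltW v0) mf1 f10 i1.
have ch2 := chebyshev_vol mc a20 (ltW v0) mf2 f20 i2.
apply/not_existsP => hno.
have sub : cset c `<=` (cset c `&` [set x | ((4 * a1)%:E < f1 x)%E]) `|`
   (cset c `&` [set x | ((4 * a2)%:E < f2 x)%E]) `|` N.
  move=> x cx.
  have [h1|h1] := leP (f1 x) (4 * a1)%:E; last by left; left.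
  have [h2|h2] := leP (f2 x) (4 * a2)%:E; last by left; right.
  right; apply: GN => Gx; exact: (hno x).
have h1 := le_measureU3 mc (mA _ _ mf1) (mA _ _ mf2) mN sub.
rewrite leb_cset// N0 adde0 in h1.
have := le_trans h1 (leeD ch1 ch2).
rewrite -EFinD lee_fin; lra.
Qed.

Lemma int_dom c (f g : X -> R) (k s a : R) : 0 <= k -> 0 <= s -> measurable_fun setT f -> measurable_fun setT g ->
  (forall x, 0 <= f x) -> (forall x, 0 <= g x) -> (forall x, f x <= k * g x) ->
  (int c (fun x => (g x) `^ s)%R <= a%:E)%E ->
  (int c (fun x => (f x) `^ s)%R <= (k `^ s * a)%:E)%E.
Proof.
move=> k0 s0 mf mg f0 g0 h hg.
have mp (u : X -> R) : measurable_fun setT u -> measurable_fun setT (fun x => (u x) `^ s).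
  by move=> mu'; exact: (measurableT_comp (measurable_powR _) mu').
apply: (@le_trans _ _ (int c (fun x => k `^ s * (g x) `^ s))).
  apply: int_mono; [exact: mp| |by move=> x; exact: powR_ge0| |].
  - by apply: measurable_funM => //; exact: mp.
  - by move=> x; rewrite mulr_ge0 ?powR_ge0.
  apply: aeW => x _; rewrite -powRM//; exact: powR_le.
rewrite intZ ?powR_ge0//; [|exact: mp|by move=> x; exact: powR_ge0].
by rewrite EFinM; apply: lee_wpmul2l => //; rewrite lee_fin powR_ge0.
Qed.

Section weight.
Variables (p : R) (m : nat).
Hypothesis p1 : 1 < p.
Let q := dual_exp p.
Let p0 : 0 < p. Proof. exact: lt_trans p1. Qed.
Let q0 : 0 < q. Proof. exact: dual_exp_gt0. Qed.

(** What the A_p condition says about A = V^(1/p) and its inverse A'.  By the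
    convention on powers, A is 0 where the weight is not positive definite. *)
Record ap_data (s : R) (A A' : X -> 'M[R[i]]_m) : Prop := ApData {
  adA : mxm A;
  adA' : mxm A';
  adG : {ae mu, forall x, posdefmx (A x) /\ A' x *m A x = 1%:M};
  adP : forall x, posdefmx (A x) \/ A x = 0;
  adI : forall c, 0 < c.2 ->
    (\int[mu]_(x in cset c) ((vol c)^-1%:E *
       \int[mu]_(y in cset c) ((opnorm (A x *m A' y)) `^ q)%R%:E) `^ (p / q)
     <= (s * vol c)%:E)%E }.

Lemma mulmx_insert m1 m2 m3 m4 (M1 : 'M[R[i]]_(m1, m2)) (M2 : 'M[R[i]]_(m2, m3)) (M3 : 'M[R[i]]_(m3, m2))
  (M4 : 'M[R[i]]_(m2, m4)) : M2 *m M3 = 1%:M -> M1 *m M4 = (M1 *m M2) *m (M3 *m M4).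
Proof. by move=> h; rewrite mulmxA -(mulmxA M1) h mulmx1. Qed.

Lemma ap_weight_data W s : Ap_weight p W -> (Ap_const p W <= s%:E)%E ->
  ap_data s (fun x => mxpow (W x) p^-1) (fun x => mxpow (W x) (- p^-1)).
Proof.
move=> [[mW pW] _] hs; split.
- exact: mxm_mxpow.
- exact: mxm_mxpow.
- apply: filterS pW => x px; split; first exact: mxpow_posdef.
  by rewrite mxpowD// addNr mxpow0.
- move=> x; have [px|px] := pselect (posdefmx (W x)); last by right; exact: mxpowN.
  by left; exact: mxpow_posdef.
- move=> c c0.
  have : (avg (cset c) (fun x => (avg (cset c) (fun y =>
      (opnorm (mxpow (W x) p^-1 *m mxpow (W y) (- p^-1)) `^ dual_exp p)%R%:E)
       `^ (p / dual_exp p))%E) <= s%:E)%E.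
    apply: le_trans hs; apply: ereal_sup_ubound => /=.
    by exists (cset c) => //; exact: cubes_cset.
  move/(avg_le _ _ c0); apply: le_trans; rewrite le_eqVlt; apply/orP; left; apply/eqP.
  by apply: eq_integral => x _; rewrite avgE.
Qed.

(** The matrix A(x0), at a point provided by [good_point], already normalises the
    weight on the cube; the average of A will be compared with it. *)
Lemma ap_point (s : R) : 0 <= s -> exists2 C, 0 <= C & forall A A',
  ap_data s A A' -> forall c, 0 < c.2 ->
  exists x0, [/\ A' x0 *m A x0 = 1%:M,
    (int c (fun x => ((fn (A x *m A' x0)) `^ p)%R) <= (C * vol c)%:E)%E &
    (int c (fun x => ((fn (A x0 *m A' x)) `^ q)%R) <= (C * vol c)%:E)%E].
Proof.
move=> s0; have [C C0 HC] := @good_point R d p q s p0 q0 s0.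
pose sq : R := Num.sqrt m%:R.
exists (sq `^ p * C + sq `^ q * C).
  by rewrite addr_ge0// mulr_ge0// powR_ge0.
move=> A A' ad c c0; have v0 := vol_gt0 c0.
have mA := adA ad; have mA' := adA' ad.
have := HC (fun z => opnorm (A z.1 *m A' z.2)) [set x | posdefmx (A x) /\ A' x *m A x = 1%:M] c
  (measurable_kernel mA mA') (fun z => opnorm_ge0 _) (adG ad).
move=> /(_ _ c0 (adI ad c0)) [].
  by move=> x y z [_ py] /=; rewrite (mulmx_insert (A x) (A' z) py); exact: opnormM.
move=> x0 [[_ px0] h1 h2]; exists x0.
have m1 := mxmM mA (mxm_cst (A' x0)).
have m2 := mxmM (mxm_cst (A x0)) mA'.
have sq0 : 0 <= sq by exact: sqrtr_ge0.
have e1 := int_dom sq0 (ltW p0) (measurable_fn m1) (measurable_opnorm m1)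
  (fun x => fn_ge0 _) (fun x => opnorm_ge0 _) (fun x => fn_le_opnorm _) h2.
have e2 := int_dom sq0 (ltW q0) (measurable_fn m2) (measurable_opnorm m2)
  (fun x => fn_ge0 _) (fun x => opnorm_ge0 _) (fun x => fn_le_opnorm _) h1.
split; first exact: px0.
  apply: (le_trans e1).
  rewrite lee_fin mulrA ler_wpM2r ?(ltW v0)// lerDl mulr_ge0// powR_ge0//.
apply: (le_trans e2).
by rewrite lee_fin mulrA ler_wpM2r ?(ltW v0)// lerDr mulr_ge0// powR_ge0.
Qed.

Lemma le1_powR (r t : R) : 0 <= r -> 1 <= t -> r <= 1 + r `^ t.
Proof.
move=> r0 t1; have [r1|r1] := leP r 1; first by rewrite ler_wpDr// powR_ge0.
rewrite ler_wpDl// -[leLHS](powRr1 r0); apply: ler_powR => //; exact: ltW.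
Qed.

Lemma mean_fn_powR c (F : X -> 'M[R[i]]_m) (t C : R) : 0 < c.2 -> 1 <= t -> MLS F ->
  (int c (fun x => ((fn (F x)) `^ t)%R) <= (C * vol c)%:E)%E ->
  mean c (fun x => fn (F x)) <= 1 + C.
Proof.
move=> c0 t1 hF h; have v0 := vol_gt0 c0.
rewrite /mean ler_pdivrMr// -lee_fin -intE//; last exact: LI_fn.
have mF := measurable_fn (mxm_MLS hF).
have mp : measurable_fun setT (fun x => (fn (F x)) `^ t).
  exact: (measurableT_comp (measurable_powR _) mF).
apply: (@le_trans _ _ (int c (fun x => 1 + (fn (F x)) `^ t))).
  apply: int_mono => //.
  - exact: measurable_funD.
  - by move=> x; exact: fn_ge0.
  - by move=> x; rewrite addr_ge0// powR_ge0.
  by apply: aeW => x _; apply: le1_powR => //; exact: fn_ge0.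
rewrite intD//; last by move=> x; exact: powR_ge0.
rewrite mulrDl EFinD; apply: leeD => //.
by rewrite intE ?I_cst//; exact: LI_cst.
Qed.

End weight.
End reducing.

(** * Averages as reducing matrices *)

Section mean_posdef.
Variables (R : realType) (d : nat).
Notation X := (Rspace R d).
Notation Cb := (Cb R d).
Notation mu := (@leb R d).
Implicit Types (c : Cb).

Lemma CLS_conj (f : X -> R[i]) : CLS f -> CLS (fun x => Num.conj (f x)).
Proof.
move=> [f1 f2]; split.
  rewrite (_ : (fun x => _) = (fun x => complex.Re (f x)))//.
  by apply/funext => x; case: (f x).
rewrite (_ : (fun x => _) = (fun x => -1 * complex.Im (f x))); first exact: LSZ.
by apply/funext => x; case: (f x) => a b /=; rewrite mulN1r.
Qed.

Lemma cmean_conj c (f : X -> R[i]) : 0 < c.2 -> CLS f ->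
  cmean c (fun x => Num.conj (f x)) = Num.conj (cmean c f).
Proof.
move=> c0 [f1 f2]; apply/eqP; rewrite eq_complex /=; apply/andP; split; apply/eqP.
  by congr mean; apply/funext => x; case: (f x).
rewrite /mean -mulNr; congr (_ * _); rewrite -mulN1r -IS_Z//; congr I_.
by apply/funext => x; case: (f x) => a b /=; rewrite mulN1r.
Qed.

Lemma MLS_tr m n (F : X -> 'M[R[i]]_(m, n)) : MLS F -> MLS (fun x => (F x) ^t*).
Proof.
move=> hF i j; rewrite (_ : (fun x => _) = (fun x => Num.conj (F x j i))).
  exact: CLS_conj.
by apply/funext => x; rewrite !mxE.
Qed.

(** Averages commute with adjoints, which transfers estimates between a weight
    and its dual. *)
Lemma mxmean_tr m n c (F : X -> 'M[R[i]]_(m, n)) : 0 < c.2 -> MLS F ->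
  mxmean c (fun x => (F x) ^t*) = (mxmean c F) ^t*.
Proof.
move=> c0 hF; apply/matrixP => i j; rewrite !mxE -(cmean_conj c0 (hF j i)).
by congr cmean; apply/funext => x; rewrite !mxE.
Qed.

Lemma int_eq0 c (f : X -> R) : measurable_fun setT f -> (forall x, 0 <= f x) ->
  int c f = 0%E -> {ae mu, forall x, cset c x -> f x = 0}.
Proof.
move=> mf f0 i1.
have ia : (\int[mu]_(x in cset c) `| (f x)%:E | = 0)%E.
  by rewrite -[RHS]i1; apply: eq_integral => x _; rewrite /= ger0_norm.
have := (ae_eq_integral_abs mu (measurable_cset c) (mEFin mf)).1 ia.
by apply: filterS => x h cx; have [] := h cx.
Qed.

Lemma I_gt0 c f : 0 < c.2 -> LI f -> {ae mu, forall x, 0 < f x} -> 0 < I_ c f.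
Proof.
move=> c0 hf fp; have [mf f0 _] := hf; have v0 := vol_gt0 c0.
rewrite lt_neqAle I_ge0// andbT; apply/eqP => i0.
have i1 : int c f = 0%E by rewrite intE// -i0.
have [N [mN N0 hN]] := int_eq0 mf f0 i1.
have [M [mM M0 hM]] := fp.
have : (mu (cset c) <= mu (N `|` M))%E.
  apply: le_measure; rewrite ?inE//; [exact: measurable_cset|exact: measurableU|].
  move=> x cx; have [fx|fx] := pselect (0 < f x); last by right; apply: hM.
  by left; apply: hN => /= /(_ cx) fx0; rewrite fx0 ltxx in fx.
rewrite leb_cset// measureU0// N0 lee_fin; lra.
Qed.

Lemma form_mxmean m c (A : X -> 'M[R[i]]_m) (e : 'cV[R[i]]_m) : 0 < c.2 -> MLS A ->
  (e ^t* *m mxmean c A *m e) 0 0 = cmean c (fun x => (e ^t* *m A x *m e) 0 0).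
Proof.
move=> c0 hA; rewrite -mxmean_mulL// -mxmean_mulR//; last exact: MLS_mulL.
by rewrite mxE.
Qed.

Lemma posdef_mxmean m c (A : X -> 'M[R[i]]_m) : 0 < c.2 -> MLS A ->
  (forall x, posdefmx (A x) \/ A x = 0) -> {ae mu, forall x, posdefmx (A x)} ->
  posdefmx (mxmean c A).
Proof.
move=> c0 hA h0 hp; split.
  apply/hermE; rewrite -mxmean_tr//; congr mxmean; apply/funext => x.
  have [px|->] := h0 x; first exact: posdef_tr.
  by apply/matrixP => i j; rewrite !mxE rmorph0.
move=> e e0; rewrite form_mxmean//.
have hf : CLS (fun x => (e ^t* *m A x *m e) 0 0) by apply: MLS_mulR; exact: MLS_mulL.
have f0 x : 0 <= (e ^t* *m A x *m e) 0 0.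
  have [[_ /(_ _ e0)/ltW//]|->] := h0 x.
  by rewrite mulmx0 mul0mx mxE.
have fp : {ae mu, forall x, 0 < (e ^t* *m A x *m e) 0 0}.
  by apply: filterS hp => x [_ /(_ _ e0)].
rewrite ltcE /=; apply/andP; split.
  apply/eqP; rewrite -[RHS](mean_cst 0 c0); congr mean; apply/funext => x.
  by have := f0 x; rewrite lecE => /andP[/eqP].
apply: divr_gt0; last exact: vol_gt0.
apply: I_gt0 => //.
  have [[mf1 hf1] _] := hf.
  apply: (LI_ext _ hf1) => x; rewrite ger0_norm//.
  by have := f0 x; rewrite lecE => /andP[].
by apply: filterS fp => x; rewrite ltcE => /andP[].
Qed.
End mean_posdef.

Section ap_reducing.
Variables (R : realType) (d : nat) (p : R) (m : nat).
Notation X := (Rspace R d).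
Notation Cb := (Cb R d).
Notation mu := (@leb R d).
Implicit Types (c : Cb).
Hypothesis p1 : 1 < p.
Let q := dual_exp p.
Let p0 : 0 < p. Proof. exact: lt_trans p1. Qed.
Let q0 : 0 < q. Proof. exact: dual_exp_gt0. Qed.
Let q1 : 1 <= q. Proof. exact: dual_exp_ge1. Qed.

Lemma measurable_fn_powR n1 n2 (F : X -> 'M[R[i]]_(n1, n2)) t : mxm F ->
  measurable_fun setT (fun x => (fn (F x)) `^ t).
Proof.
by move=> mF; exact: (measurableT_comp (measurable_powR _) (measurable_fn mF)).
Qed.

Lemma LI_of_int (f : X -> R) : measurable_fun setT f -> (forall x, 0 <= f x) ->
  (forall c, 0 < c.2 -> exists k : R, (int c f <= k%:E)%E) -> LI f.
Proof.
move=> mf f0 h; split => // c c0; have [k hk] := h c c0.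
exact: (le_lt_trans hk (ltry _)).
Qed.

Lemma ap_MLS s (A A' : X -> 'M[R[i]]_m) : 0 <= s -> ap_data p s A A' -> MLS A.
Proof.
move=> s0 ad; have [C C0 HC] := ap_point d m p1 s0.
have mA := adA ad.
apply: MLS_fn => //; apply: LI_of_int; [exact: measurable_fn|by move=> x; exact: fn_ge0|].
move=> c c0; have [x0 [h0 h1 _]] := HC _ _ ad c c0.
have mAA : mxm (fun x => A x *m A' x0) by apply: mxmM => //; exact: mxm_cst.
pose g x := (fn (A x *m A' x0)) `^ p.
have g0 x : 0 <= g x by exact: powR_ge0.
have mg : measurable_fun setT g by exact: measurable_fn_powR.
exists (fn (A x0) * (vol c + C * vol c)).
apply: (@le_trans _ _ (int c (fun x => fn (A x0) * (1 + g x)))).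
  apply: int_mono.
  - exact: measurable_fn.
  - by apply: measurable_funM => //; exact: measurable_funD.
  - by move=> x; exact: fn_ge0.
  - by move=> x; rewrite mulr_ge0 ?fn_ge0// addr_ge0.
  apply: aeW => x _.
  have -> : A x = (A x *m A' x0) *m A x0 by rewrite -mulmxA h0 mulmx1.
  apply: le_trans (fnM _ _) _; rewrite mulrC ler_wpM2l ?fn_ge0//.
  apply: le1_powR; [exact: fn_ge0|exact: ltW].
rewrite intZ ?fn_ge0//; first last.
- by move=> x; rewrite addr_ge0.
- exact: measurable_funD.
rewrite EFinM; apply: lee_wpmul2l; first by rewrite lee_fin fn_ge0.
rewrite intD// EFinD; apply: leeD => //.
by rewrite intE ?I_cst ?mul1r//; exact: LI_cst.
Qed.

Lemma posdef_sqrt_inv (v : 'M[R[i]]_m) : posdefmx v ->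
  exists2 S : 'M[R[i]]_m, S ^t* = S & S *m v *m S = 1%:M.
Proof.
move=> hv; exists (mxpow v (- 2^-1)); first exact: mxpow_tr.
rewrite -[X in _ *m X *m _](mxpow1 hv) (mxpowD _ _ hv) (mxpowD _ _ hv).
rewrite (_ : _ + _ = 0) ?mxpow0//; lra.
Qed.

Lemma posdef_tr_ge0 (N : 'M[R[i]]_m) : posdefmx N -> 0 <= complex.Re (\tr N).
Proof.
move=> hN; rewrite (herm_udiag (posdef_tr hN)) trace_udiag ?spV//=.
by apply: sumr_ge0 => i _; exact/ltW/posdef_sd.
Qed.

Lemma MLS_tr_CLS (F : X -> 'M[R[i]]_m) : MLS F -> CLS (fun x => \tr (F x)).
Proof. by move=> hF; apply: CLS_sum => i; exact: hF. Qed.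

Lemma cmean_tr c (F : X -> 'M[R[i]]_m) : 0 < c.2 -> MLS F ->
  cmean c (fun x => \tr (F x)) = \tr (mxmean c F).
Proof.
move=> c0 hF; rewrite cmean_sum//; apply: eq_bigr => i _; by rewrite mxE.
Qed.

(** Writing S for v^(-1/2), this only uses multiplicativity and S v S = 1. *)
Lemma det_factor (A0 A'y Ay v S : 'M[R[i]]_m) : A'y *m Ay = 1%:M -> S *m v *m S = 1%:M ->
  v \in unitmx ->
  \det (A0 *m invmx v) = \det (A0 *m A'y) * \det (S *m Ay *m S).
Proof.
move=> h1 h2 hv; rewrite !det_mulmx.
have e1 : \det A'y * \det Ay = 1 by rewrite -det_mulmx h1 det1.
have e2 : \det S * \det v * \det S = 1 by rewrite -!det_mulmx h2 det1.
have e3 : \det v * \det (invmx v) = 1 by rewrite -det_mulmx mulmxV// det1.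
have e4 : \det (invmx v) = \det S * \det S.
  rewrite -[LHS]mul1r -e2 -[RHS]mulr1 -e3; ring.
rewrite e4 -[\det A0 * _]mulr1 -[in LHS]e1; ring.
Qed.

(** The mean v of A normalises A as well as A(x0) does.  That v A(x0)^-1
    is bounded follows by averaging.  For its inverse, it is enough by
    [inv_bound] to bound the determinant of A(x0) v^-1, which factors at a
    point y as det(A(x0) A(y)^-1) det(S A(y) S) with S = v^(-1/2).  The
    matrices S A S have mean 1, so at most points y the second factor is
    bounded through the trace, and the first one is bounded by the choice of
    x0. *)
Lemma ap_reducing s : 0 <= s -> exists2 K, 0 < K &
  forall A A' : X -> 'M[R[i]]_m, ap_data p s A A' ->
  forall c, 0 < c.2 -> [/\ posdefmx (mxmean c A),
    (int c (fun x => (fn (A x *m invmx (mxmean c A)) `^ p)%R) <= (K * vol c)%:E)%E &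
    (int c (fun x => (fn (mxmean c A *m A' x) `^ q)%R) <= (K * vol c)%:E)%E].
Proof.
move=> s0; have [C C0 HC] := ap_point d m p1 s0.
pose t1 : R := (m * m).*2%:R * (1 + C).
pose t2 : R := (4 * (C + 1)) `^ q^-1.
pose a1 : R := m%:R + 1.
pose dl : R := (m`!)%:R * t2 ^+ m * (4 * a1) ^+ m.
pose t3 : R := (m * m)%:R * (dl * ((m.-1`!)%:R * t1 ^+ m.-1)).
have C1 : 0 < C + 1 by rewrite ltr_wpDl.
have a10 : 0 < a1 by rewrite ltr_wpDl.
have t10 : 0 <= t1 by rewrite mulr_ge0// addr_ge0.
have t20 : 0 <= t2 by exact: powR_ge0.
have dl0 : 0 <= dl by rewrite !mulr_ge0// exprn_ge0// ltW// mulr_gt0.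
have t30 : 0 <= t3.
  by apply: mulr_ge0 => //; apply: (mulr_ge0 dl0); apply: mulr_ge0 => //; exact: exprn_ge0.
exists (t1 `^ q * C + t3 `^ p * C + 1).
  by rewrite ltr_wpDl// addr_ge0// mulr_ge0// powR_ge0.
move=> A A' ad c c0; have v0 := vol_gt0 c0.
have hA := ap_MLS s0 ad; have mA := adA ad; have mA' := adA' ad.
have [x0 [h0 h1 h2]] := HC _ _ ad c c0.
have pA : {ae mu, forall x, posdefmx (A x)} by apply: filterS (adG ad) => x [].
have hv : posdefmx (mxmean c A) := posdef_mxmean c0 hA (adP ad) pA.
have mvE : mxmean c (fun x => A x *m A' x0) = mxmean c A *m A' x0 by exact: mxmean_mulR.
have hAA : MLS (fun x => A x *m A' x0) by exact: MLS_mulR.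
have bX : fn (mxmean c (fun x => A x *m A' x0)) <= t1.
  apply: le_trans (fn_mxmean c0 hAA) _.
  by rewrite ler_wpM2l//; exact: (mean_fn_powR c0 (ltW p1) hAA h1).
move: bX; rewrite mvE; set v := mxmean c A in hv *; move=> bX.
have [S hS hSv] := posdef_sqrt_inv hv.
pose N x := S *m A x *m S.
have hN : MLS N by apply: MLS_mulR; exact: MLS_mulL.
have mN1 : mxmean c N = 1%:M.
  by rewrite -hSv -mxmean_mulL// -mxmean_mulR//; exact: MLS_mulL.
have Sinj (e : 'cV[R[i]]_m) : S *m e = 0 -> e = 0.
  have [Su _] : S \in unitmx /\ v \in unitmx.
    by split; [by have [] := mulmx1_unit hSv|exact: posdef_unit].
  by move=> h; rewrite -(mul1mx e) -(mulVmx Su) -mulmxA h mulmx0.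
have pN x : posdefmx (A x) -> posdefmx (N x).
  by move=> px; rewrite /N -{1}hS; exact: posdef_congr.
pose r x := complex.Re (\tr (N x)).
have r0 x : 0 <= r x.
  have [/pN/posdef_tr_ge0//|h] := adP ad x.
  by rewrite /r /N h mulmx0 mul0mx mxtrace0.
have hr : LI r.
  have [[mr hr] _] := MLS_tr_CLS hN.
  by apply: (LI_ext _ hr) => x; rewrite (ger0_norm (r0 x)).
have Ir : (int c r <= (a1 * vol c)%:E)%E.
  rewrite intE// lee_fin -ler_pdivrMr//.
  have <- : complex.Re (cmean c (fun x => \tr (N x))) = I_ c r / vol c by [].
  by rewrite cmean_tr// mN1 mxtrace1 -(rmorph_nat (real_complex R)) /= lerDl.
pose g x := (fn (A x0 *m A' x)) `^ q.
have mg : measurable_fun setT g.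
  by apply: measurable_fn_powR; apply: mxmM => //; exact: mxm_cst.
have Ig : (\int[mu]_(x in cset c) (g x)%:E <= ((C + 1) * vol c)%:E)%E.
  by apply: le_trans h2 _; rewrite lee_fin ler_pM2r// lerDl.
have mr : measurable_fun setT r by case: hr.
(* a point where S A S is bounded by its trace and A(x0) A' is bounded *)
have [y [cy [py Gy] ry gy]] := exists_below c0 a10 C1 (mEFin mr) (mEFin mg)
  (fun x => r0 x) (fun x => powR_ge0 _ _) (adG ad) Ir Ig.
rewrite lee_fin in ry; rewrite lee_fin in gy.
have b2 : fn (A x0 *m A' y) <= t2.
  rewrite -[leLHS](powRr1 (fn_ge0 _)) -(divff (lt0r_neq0 q0)) powRrM.
  by apply: powR_le gy; rewrite ?powR_ge0// invr_ge0 ltW.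
have bdet : normc (\det (A x0 *m invmx v)) <= dl.
  rewrite (det_factor _ Gy hSv (posdef_unit hv)) normcM; apply: ler_pM.
  - exact: normc_ge0.
  - exact: normc_ge0.
  - by apply: normc_det_le => i j; exact: le_trans (fn_entry _ _ _) b2.
  apply: le_trans (posdef_det_trace (pN _ py)) _.
  by apply: lerXn2r ry; rewrite nnegrE// ?r0// ltW// mulr_gt0.
have bY : fn (A x0 *m invmx v) <= t3.
  apply: (@inv_bound _ _ (v *m A' x0)) => //.
  by rewrite -(mulmx_insert _ _ h0) mulmxV// posdef_unit.
have h0' : A x0 *m A' x0 = 1%:M by exact: mulmx1C.
have b (F G : X -> 'M[R[i]]_m) t1' t' : mxm F -> mxm G -> 0 <= t1' -> 0 <= t' ->
    (forall x, fn (F x) <= t1' * fn (G x)) -> 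
    (int c (fun x => ((fn (G x)) `^ t')%R) <= (C * vol c)%:E)%E ->
    (int c (fun x => ((fn (F x)) `^ t')%R) <= ((t1' `^ t' * C) * vol c)%:E)%E.
  move=> mF mG ht1 ht h hG; rewrite -mulrA.
  apply: (int_dom ht1 ht (measurable_fn mF) (measurable_fn mG) _ _ h hG) => x; exact: fn_ge0.
split=> //.
- apply: (@le_trans _ _ ((t3 `^ p * C) * vol c)%:E).
    apply: (b _ (fun x => A x *m A' x0)) => //; [by apply: mxmM => //; exact: mxm_cst|exact: mxm_MLS|exact: ltW|].
    move=> x; rewrite (mulmx_insert _ _ h0) mulrC; apply: le_trans (fnM _ _) _.
    by apply: ler_wpM2l => //; exact: fn_ge0.
  rewrite lee_fin ler_pM2r// -addrA ler_wpDl ?mulr_ge0 ?powR_ge0// lerDl//.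
- apply: (@le_trans _ _ ((t1 `^ q * C) * vol c)%:E).
    apply: (b _ (fun x => A x0 *m A' x)) => //.
    + by apply: mxmM => //; exact: mxm_cst.
    + by apply: mxmM => //; exact: mxm_cst.
    + exact: ltW.
    move=> x; rewrite (mulmx_insert _ _ h0); apply: le_trans (fnM _ _) _.
    by apply: ler_wpM2r => //; exact: fn_ge0.
  by rewrite lee_fin ler_pM2r// -addrA lerDl addr_ge0 ?mulr_ge0 ?powR_ge0.
Qed.

End ap_reducing.

(** * Off-diagonal bounds *)

Lemma trC_mul (R : realType) m n l (M : 'M[R[i]]_(m, n)) (N : 'M[R[i]]_(n, l)) :
  (M *m N) ^t* = N ^t* *m M ^t*.
Proof. by rewrite trmx_mul map_mxM. Qed.

Lemma trC1 (R : realType) n : (1%:M : 'M[R[i]]_n) ^t* = 1%:M.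
Proof. by rewrite trmx1 map_mx1. Qed.

Lemma trCB (R : realType) m n (M N : 'M[R[i]]_(m, n)) : (M - N) ^t* = M ^t* - N ^t*.
Proof. by apply/matrixP => i j; rewrite !mxE rmorphB. Qed.

Section reduced.
Variables (R : realType) (d : nat) (p : R) (m : nat).
Notation X := (Rspace R d).
Notation Cb := (Cb R d).
Notation mu := (@leb R d).
Notation MX := (X -> 'M[R[i]]_m).
Implicit Types (c : Cb) (A B : MX).
Hypothesis p1 : 1 < p.
Let q := dual_exp p.
Let p0 : 0 < p. Proof. exact: lt_trans p1. Qed.
Let q0 : 0 < q. Proof. exact: dual_exp_gt0. Qed.
Let q1 : 1 <= q. Proof. exact: dual_exp_ge1. Qed.

(** The conclusion of [ap_reducing], together with what is used of the
    weight itself. *)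
Record reduced (K : R) A A' : Prop := Reduced {
  rdA : mxm A;
  rdA' : mxm A';
  rdI : {ae mu, forall x, A' x *m A x = 1%:M};
  rdV : forall c, 0 < c.2 -> mxmean c A \in unitmx;
  rdp : forall c, 0 < c.2 ->
    (int c (fun x => (fn (A x *m invmx (mxmean c A)) `^ p)%R) <= (K * vol c)%:E)%E;
  rdq : forall c, 0 < c.2 ->
    (int c (fun x => (fn (mxmean c A *m A' x) `^ q)%R) <= (K * vol c)%:E)%E }.

(** The BMO norm of B with respect to the averages of A and E is at most 1. *)
Definition bmo_le A E B := forall c, 0 < c.2 ->
  I_ c (fun x => fn (mxmean c A *m (B x - mxmean c B) *m invmx (mxmean c E))) <= vol c.

Lemma reduced_upper K A A' : reduced K A A' ->
  upper_reducing K p A (fun c => invmx (mxmean c A)).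
Proof. by case. Qed.

Lemma fn_trM (M N : 'M[R[i]]_m) : fn (M ^t* *m N ^t*) = fn (N *m M).
Proof. by rewrite -fn_tr trC_mul !trmxCK. Qed.

Lemma fn_trM3 (P M N Q : 'M[R[i]]_m) :
  fn (P ^t* *m (M ^t* - N ^t*) *m Q ^t*) = fn (Q *m (M - N) *m P).
Proof. by rewrite -trCB -mulmxA -trC_mul fn_trM. Qed.

Lemma reduced_upper' K A A' : reduced K A A' ->
  upper_reducing K q (fun x => (A' x) ^t*) (fun c => (mxmean c A) ^t*).
Proof.
case=> _ mA' _ _ _ h; split=> [|c c0]; first exact: mxm_tr.
apply: le_trans (h c c0); rewrite le_eqVlt; apply/orP; left; apply/eqP.
by congr int; apply/funext => x; congr (_ `^ _); exact: fn_trM.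
Qed.

(** The second estimate is the first one for the adjoint of B, with the
    dual weights E'^* and A'^* at the dual exponent; passing to adjoints leaves
    the normalised oscillation unchanged. *)
Lemma offdiag_bounds (K : R) : 0 < K -> exists2 C, 0 <= C &
  forall A A' E E' B, reduced K A A' -> reduced K E E' -> MLS B -> bmo_le A E B ->
  forall c, 0 < c.2 ->
  (int c (fun x => (fn (A x *m (B x - mxmean c B) *m invmx (mxmean c E)) `^ p)%R) <= (C * vol c)%:E)%E /\
  (int c (fun x => (fn (mxmean c A *m (B x - mxmean c B) *m E' x) `^ q)%R) <= (C * vol c)%:E)%E.
Proof.
move=> K0; have [C1 C10 H1] := @john_nirenberg R d m p q K (ltW p1) q0 K0.
have [C2 C20 H2] := @john_nirenberg R d m q p K q1 p0 K0.
exists ((C1 + C2) * K); first by rewrite mulr_ge0 ?addr_ge0// ltW.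
move=> A A' E E' B rA rE hB bmo c c0; have v0 := vol_gt0 c0.
have inv F F' : reduced K F F' -> forall c', 0 < c'.2 -> invmx (mxmean c' F) *m mxmean c' F = 1%:M.
  by move=> rF c' c'0; rewrite mulVmx//; exact: (rdV rF).
have j1 : jn_data p q K A E E' B (fun c => mxmean c A) (fun c => invmx (mxmean c A))
    (fun c => mxmean c E) (fun c => invmx (mxmean c E)).
  split=> //; [exact: reduced_upper rA|exact: reduced_upper rE|exact: reduced_upper' rE|
    exact: inv rA|exact: inv rE|exact: rdI rE].
have inv' F F' : reduced K F F' -> forall c', 0 < c'.2 ->
    (mxmean c' F) ^t* *m (invmx (mxmean c' F)) ^t* = 1%:M.
  by move=> rF c' c'0; rewrite -trC_mul (inv _ _ rF)// trC1.
have j2 : jn_data q p K (fun x => (E' x) ^t*) (fun x => (A' x) ^t*) (fun x => (A x) ^t*)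
    (fun x => (B x) ^t*) (fun c => (invmx (mxmean c E)) ^t*) (fun c => (mxmean c E) ^t*)
    (fun c => (invmx (mxmean c A)) ^t*) (fun c => (mxmean c A) ^t*).
  split.
  - exact: reduced_upper' rE.
  - exact: reduced_upper' rA.
  - have [h1 h2] := reduced_upper rA; split=> [|c' c'0].
      by move=> i j; under eq_fun do rewrite trmxCK; exact: h1.
    by under eq_fun do rewrite !trmxCK; exact: h2.
  - exact: inv' rE.
  - exact: inv' rA.
  - apply: filterS (rdI rA) => x h; by rewrite -trC_mul h trC1.
  - exact: MLS_tr.
  move=> c' c'0; apply: le_trans (bmo c' c'0); rewrite le_eqVlt; apply/orP; left; apply/eqP.
  apply: I_eq => x _; rewrite (mxmean_tr c'0 hB); exact: fn_trM3.
have le1 (r k : R) : r <= K * vol c -> 0 <= k -> k <= C1 + C2 -> k * r <= (C1 + C2) * K * vol c.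
  move=> hr k0 hk; apply: (@le_trans _ _ (k * (K * vol c))); first exact: ler_wpM2l.
  by rewrite -mulrA ler_wpM2r// mulr_ge0// ltW.
split.
  apply: le_trans (H1 _ _ _ _ _ _ _ _ j1 c _ c0) _; rewrite lee_fin.
  apply: le1; rewrite ?lerDl//.
  by apply: (I_upper p0 (reduced_upper rE) (inv _ _ rE) c0).
have := H2 _ _ _ _ _ _ _ _ j2 c ((mxmean c A) ^t*) c0.
rewrite (_ : int c _ = int c (fun x => (fn (mxmean c A *m (B x - mxmean c B) *m E' x) `^ q)%R)); last first.
  congr int; apply/funext => x; congr (_ `^ _).
  by rewrite (mxmean_tr c0 hB) fn_trM3.
move=> h; apply: le_trans h _; rewrite lee_fin.
apply: le1; rewrite ?lerDr//.
exact: (I_upper q0 (reduced_upper' rA) (inv' _ _ rA) c0).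
Qed.

End reduced.

(** * The A_p functional of a kernel *)

Section kernel_functional.
Variables (R : realType) (d : nat) (p : R).
Notation X := (Rspace R d).
Notation Cb := (Cb R d).
Notation mu := (@leb R d).
Implicit Types (c : Cb) (k : X * X -> R).
Hypothesis p1 : 1 < p.
Let q := dual_exp p.
Let p0 : 0 < p. Proof. exact: lt_trans p1. Qed.
Let q0 : 0 < q. Proof. exact: dual_exp_gt0. Qed.
Let q1 : 1 <= q. Proof. exact: dual_exp_ge1. Qed.
Let pq0 : 0 <= p / q. Proof. by rewrite divr_ge0// ltW. Qed.

(** The inner mean in the definition of the A_p constant, for a kernel k in
    place of the norm of W^(1/p)(x) W^(-1/p)(y). *)
Definition kin c k (x : X) : \bar R :=
  ((vol c)^-1%:E * \int[mu]_(y in cset c) ((k (x, y)) `^ q)%R%:E)%E.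

Definition kint c k : \bar R := (\int[mu]_(x in cset c) (kin c k x) `^ (p / q))%E.

Definition kern k := measurable_fun setT k /\ forall z, 0 <= k z.

Lemma kin_ge0 c k x : 0 < c.2 -> (0 <= kin c k x)%E.
Proof.
move=> c0; apply: mule_ge0; first by rewrite lee_fin invr_ge0 ltW// vol_gt0.
by apply: integral_ge0 => y _; rewrite lee_fin powR_ge0.
Qed.

Lemma measurable_kpow k : kern k -> measurable_fun setT (fun z => (k z) `^ q).
Proof. by move=> [mk _]; exact: (measurableT_comp (measurable_powR _) mk). Qed.

Lemma measurable_kpow2 k x D : kern k -> measurable_fun D (fun y => ((k (x, y)) `^ q)%R%:E).
Proof.
move=> hk; apply: measurable_funTS; apply/measurable_EFinP.
exact: (measurable_fun_pair2 x (measurable_kpow hk)).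
Qed.

Lemma measurable_kin c k D : kern k -> measurable_fun D (fun x => (kin c k x `^ (p / q))%E).
Proof.
move=> hk; apply: measurable_funTS.
apply: (measurableT_comp (measurable_poweR _)).
apply: emeasurable_funM => //.
apply: (@measurable_int2_set _ _ (fun z => (k z) `^ q)) => //.
- exact: measurable_cset.
- exact: measurable_kpow.
- by move=> z; exact: powR_ge0.
Qed.

Lemma kin_mono c k1 k2 x (l : R) : 0 < c.2 -> 0 <= l -> kern k1 -> kern k2 ->
  {ae mu, forall y, cset c y -> k1 (x, y) <= l * k2 (x, y)} ->
  (kin c k1 x <= (l `^ q)%:E * kin c k2 x)%E.
Proof.
move=> c0 l0 h1 h2 h; have mc := measurable_cset c.
have v0 : 0 <= (vol c)^-1 by rewrite invr_ge0 ltW// vol_gt0.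
rewrite /kin muleCA; apply: lee_wpmul2l; first by rewrite lee_fin.
rewrite -(@ge0_integralZl_EFin _ _ _ mu _ mc (fun y => ((k2 (x, y)) `^ q)%R%:E)); last first.
- exact: powR_ge0.
- exact: measurable_kpow2.
- by move=> y _; rewrite lee_fin powR_ge0.
apply: (@ae_ge0_le_integral _ _ _ mu _ mc).
- by move=> y _; rewrite lee_fin powR_ge0.
- exact: measurable_kpow2.
- by move=> y _; rewrite mule_ge0// lee_fin powR_ge0.
- apply: emeasurable_funM => //; exact: measurable_kpow2.
apply: filterS h => y hy cy; rewrite -EFinM lee_fin -powRM//; last by case: h2.
apply: powR_le; [exact: ltW|by case: h1|exact: hy].
Qed.

Lemma kint_mono_ae c k1 k2 (l : R) : 0 < c.2 -> 0 <= l -> kern k1 -> kern k2 ->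
  {ae mu, forall x, cset c x -> (kin c k1 x <= (l `^ q)%:E * kin c k2 x)%E} ->
  (kint c k1 <= (l `^ p)%:E * kint c k2)%E.
Proof.
move=> c0 l0 h1 h2 h; have mc := measurable_cset c.
rewrite -(@ge0_integralZl_EFin _ _ _ mu _ mc (fun x => (kin c k2 x `^ (p / q))%E)); last first.
- exact: powR_ge0.
- exact: measurable_kin.
- by move=> x _; exact: poweR_ge0.
apply: (@ae_ge0_le_integral _ _ _ mu _ mc).
- by move=> y _; exact: poweR_ge0.
- exact: measurable_kin.
- by move=> y _; rewrite mule_ge0// ?lee_fin ?powR_ge0 ?poweR_ge0.
- apply: emeasurable_funM => //; exact: measurable_kin.
apply: filterS h => x hx cx.
have -> : ((l `^ p)%:E = (l `^ q)%:E `^ (p / q))%E.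
  by rewrite poweR_EFin -powRrM mulrC divfK// gt_eqF.
rewrite -poweRM ?lee_fin ?powR_ge0 ?kin_ge0//.
apply: le_poweR => //; [exact: kin_ge0|exact: hx].
Qed.

Lemma kint_mono c k1 k2 (l : R) : 0 < c.2 -> 0 <= l -> kern k1 -> kern k2 ->
  (forall z, k1 z <= l * k2 z) -> (kint c k1 <= (l `^ p)%:E * kint c k2)%E.
Proof.
move=> c0 l0 h1 h2 h; apply: kint_mono_ae => //; apply: aeW => x _.
by apply: kin_mono => //; apply: aeW => y _; exact: h.
Qed.

(** If the kernel is dominated by a product, the double integral splits. *)
Lemma kint_prod c k (g h : X -> R) (G H : R) : 0 < c.2 -> kern k ->
  measurable_fun setT g -> measurable_fun setT h -> (forall x, 0 <= g x) -> (forall x, 0 <= h x) ->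
  (forall z, k z <= g z.1 * h z.2) ->
  (int c (fun x => ((g x) `^ p)%R) <= (G * vol c)%:E)%E ->
  (int c (fun x => ((h x) `^ q)%R) <= (H * vol c)%:E)%E ->
  0 <= H -> (kint c k <= (H `^ (p / q) * (G * vol c))%:E)%E.
Proof.
move=> c0 hk mg mh g0 h0 kgh hG hH H0; have mc := measurable_cset c; have v0 := vol_gt0 c0.
have mgp : measurable_fun setT (fun x => (g x) `^ p).
  exact: (measurableT_comp (measurable_powR _) mg).
apply: (@le_trans _ _ (\int[mu]_(x in cset c) ((H `^ (p / q))%:E * ((g x) `^ p)%R%:E))%E).
  have mhq : measurable_fun setT (fun x => (h x) `^ q).
    exact: (measurableT_comp (measurable_powR _) mh).
  apply: (@ge0_le_integral _ _ _ mu _ mc).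
  - by move=> y _; exact: poweR_ge0.
  - exact: measurable_kin.
  - by apply: emeasurable_funM => //; exact: mEFin.
  move=> x cx.
  have kx : (kin c k x <= (g x `^ q * H)%:E)%E.
    rewrite /kin muleC lee_pdivrMr//.
    apply: (@le_trans _ _ (int c (fun y => (g x) `^ q * (h y) `^ q))).
      apply: int_mono.
      + have h3 := measurable_kpow2 (D := setT) x hk; exact/measurable_EFinP.
      + exact: measurable_funM.
      + by move=> y; exact: powR_ge0.
      + by move=> y; rewrite mulr_ge0// powR_ge0.
      apply: aeW => y _; rewrite -powRM//; apply: powR_le; [exact: ltW|by case: hk|exact: (kgh (x, y))].
    rewrite intZ ?powR_ge0//; last by move=> y; exact: powR_ge0.
    rewrite -EFinM -mulrA EFinM; apply: lee_wpmul2l => //; by rewrite lee_fin powR_ge0.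
  apply: le_trans (le_poweR pq0 (kin_ge0 _ _ c0) kx) _.
  rewrite poweR_EFin powRM ?powR_ge0// -powRrM -EFinM lee_fin mulrC.
  by rewrite [q * _]mulrC divfK// gt_eqF.
rewrite (@ge0_integralZl_EFin _ _ _ mu _ mc (fun x => ((g x) `^ p)%R%:E)); last first.
- exact: powR_ge0.
- exact: (mEFin mgp).
- by move=> x _; rewrite lee_fin powR_ge0.
by rewrite EFinM; apply: lee_wpmul2l => //; rewrite lee_fin powR_ge0.
Qed.

(** The kernel of the A_p condition. *)
Definition wker n (W : X -> 'M[R[i]]_n) (z : X * X) : R :=
  opnorm (mxpow (W z.1) p^-1 *m mxpow (W z.2) (- p^-1)).

Lemma kern_wker n (W : X -> 'M[R[i]]_n) : mxm W -> kern (wker W).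
Proof.
move=> mW; split; last by move=> z; exact: opnorm_ge0.
exact: (measurable_kernel (mxm_mxpow p^-1 mW) (mxm_mxpow (- p^-1) mW)).
Qed.

Lemma Ap_constE n (W : X -> 'M[R[i]]_n) (s : R) :
  (Ap_const p W <= s%:E)%E <-> forall c, 0 < c.2 -> (kint c (wker W) <= (s * vol c)%:E)%E.
Proof.
have E c : 0 < c.2 -> avg (cset c) (fun x => (avg (cset c) (fun y =>
      (opnorm (mxpow (W x) p^-1 *m mxpow (W y) (- p^-1)) `^ dual_exp p)%R%:E)
       `^ (p / dual_exp p))%E) = avg (cset c) (fun x => (kin c (wker W) x `^ (p / q))%E).
  by move=> c0; congr avg; apply/funext => x; rewrite avgE.
split=> [h c c0|h].
  apply/(avg_le _ _ c0); rewrite -E//; apply: le_trans h.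
  by apply: ereal_sup_ubound => /=; exists (cset c) => //; exact: cubes_cset.
apply/ereal_supP => _ [Q /cubesP[c c0 ->] <-].
rewrite E//; apply/(avg_le _ _ c0); exact: h.
Qed.

Lemma Ap_const_ge0 n (W : X -> 'M[R[i]]_n) : (0 <= Ap_const p W)%E.
Proof.
pose c : Cb := (point, 1); have c0 : 0 < c.2 by exact: ltr01.
pose f Q := avg Q (fun x : X => (avg Q (fun y =>
  (opnorm (mxpow (W x) p^-1 *m mxpow (W y) (- p^-1)) `^ dual_exp p)%R%:E)
  `^ (p / dual_exp p))%E).
apply: (@le_trans _ _ (f (cset c))); last first.
  by apply: ereal_sup_ubound => /=; exists (cset c) => //; exact: cubes_cset.
rewrite /f avgE//; apply: mule_ge0; first by rewrite lee_fin invr_ge0 ltW// vol_gt0.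
by apply: integral_ge0 => y _; exact: poweR_ge0.
Qed.
End kernel_functional.

(** * Norms of block matrices *)

Section block_norms.
Variable R : realType.

Lemma fn_col_sq m1 m2 n (a : 'M[R[i]]_(m1, n)) (b : 'M[R[i]]_(m2, n)) :
  fn (col_mx a b) ^+ 2 = fn a ^+ 2 + fn b ^+ 2.
Proof.
rewrite !fn_sq big_split_ord /=; congr (_ + _); apply: eq_bigr => i _; apply: eq_bigr => j _.
  by rewrite col_mxEu.
by rewrite col_mxEd.
Qed.

Lemma fn_row_sq m n1 n2 (a : 'M[R[i]]_(m, n1)) (b : 'M[R[i]]_(m, n2)) :
  fn (row_mx a b) ^+ 2 = fn a ^+ 2 + fn b ^+ 2.
Proof.
rewrite !fn_sq -big_split /=; apply: eq_bigr => i _; rewrite big_split_ord /=.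
by congr (_ + _); apply: eq_bigr => j _; rewrite ?row_mxEl ?row_mxEr.
Qed.

Lemma fn_block_sq m1 m2 n1 n2 (a : 'M[R[i]]_(m1, n1)) (b : 'M[R[i]]_(m1, n2))
  (c : 'M[R[i]]_(m2, n1)) (e : 'M[R[i]]_(m2, n2)) :
  fn (block_mx a b c e) ^+ 2 = fn a ^+ 2 + fn b ^+ 2 + fn c ^+ 2 + fn e ^+ 2.
Proof. by rewrite fn_col_sq !fn_row_sq addrA. Qed.

Lemma fn_block_le m1 m2 n1 n2 (a : 'M[R[i]]_(m1, n1)) (b : 'M[R[i]]_(m1, n2))
  (c : 'M[R[i]]_(m2, n1)) (e : 'M[R[i]]_(m2, n2)) :
  fn (block_mx a b c e) <= fn a + fn b + fn c + fn e.
Proof.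
have h := fn_block_sq a b c e.
have := fn_ge0 a; have := fn_ge0 b; have := fn_ge0 c; have := fn_ge0 e => *.
rewrite -(@ler_pXn2r _ 2)// ?nnegrE ?addr_ge0 ?fn_ge0// h; nra.
Qed.

Lemma fn_block_ur m1 m2 n1 n2 (a : 'M[R[i]]_(m1, n1)) (b : 'M[R[i]]_(m1, n2))
  (c : 'M[R[i]]_(m2, n1)) (e : 'M[R[i]]_(m2, n2)) :
  fn b <= fn (block_mx a b c e).
Proof.
rewrite -(@ler_pXn2r _ 2)// ?nnegrE ?fn_ge0// fn_block_sq -!addrA addrCA lerDl.
by rewrite !addr_ge0// sqr_ge0.
Qed.

Definition stretch m (l : R) : 'M[R[i]]_(m + m) := block_mx ((l%:C)%C%:M) 0 0 1%:M.

Lemma stretch_block m (l l' : R) (a b e : 'M[R[i]]_m) : l * l' = 1 ->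
  stretch m l *m block_mx a b 0 e *m stretch m l' = block_mx a ((l%:C)%C *: b) 0 e.
Proof.
move=> h; rewrite /stretch !mulmx_block.
rewrite !(mulmx0, mul0mx, addr0, add0r, mulmx1, mul1mx).
rewrite !mul_scalar_mx mul_mx_scalar scalerA.
have -> : (l'%:C * l%:C)%C = 1 :> R[i] by rewrite -rmorphM mulrC h.
by rewrite scale1r; congr block_mx.
Qed.

Lemma opnorm_stretch m (l : R) : 0 <= l -> opnorm (stretch m l) <= Num.max l 1.
Proof.
move=> l0; have M0 : 0 <= Num.max l 1 by rewrite le_max l0.
apply: opnorm_le => // v; rewrite -[v]vsubmxK /stretch.
rewrite mul_block_col !mul0mx addr0 add0r mul1mx mul_scalar_mx !vnormE.
rewrite -(@ler_pXn2r _ 2)// ?nnegrE ?mulr_ge0 ?fn_ge0// exprMn !fn_col_sq mulrDr.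
apply: lerD.
  rewrite fnZ normc_real ger0_norm// exprMn ler_wpM2r ?sqr_ge0//.
  by rewrite ler_pXn2r ?nnegrE// le_max lexx.
by rewrite ler_peMl ?sqr_ge0// exprn_ege1// le_max lexx orbT.
Qed.

(** One has F S^-1 = (F G^-1) (G S^-1) with S for Sy, and G S^-1 is an isometry since
    S and G have the same modulus. *)
Lemma gram_opnorm n (Sx Sy Sy' F G G' : 'M[R[i]]_n) :
  (forall v : 'cV_n, vnorm (Sx *m v) = vnorm (F *m v)) ->
  (forall v : 'cV_n, vnorm (Sy *m v) = vnorm (G *m v)) ->
  Sy *m Sy' = 1%:M -> G' *m G = 1%:M -> opnorm (Sx *m Sy') <= opnorm (F *m G').
Proof.
move=> h1 h2 h3 h4; apply: opnorm_le => [|v]; first exact: opnorm_ge0.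
rewrite -mulmxA h1.
have -> : F *m (Sy' *m v) = (F *m G') *m (G *m (Sy' *m v)).
  by rewrite [RHS]mulmxA -(mulmxA F) h4 mulmx1.
apply: le_trans (opnorm_ub _ _) _.
by rewrite -h2 mulmxA h3 mul1mx.
Qed.

Lemma gram_opnorm_eq n (Sx Sy Sy' F G G' : 'M[R[i]]_n) :
  (forall v : 'cV_n, vnorm (Sx *m v) = vnorm (F *m v)) ->
  (forall v : 'cV_n, vnorm (Sy *m v) = vnorm (G *m v)) ->
  Sy *m Sy' = 1%:M -> G' *m G = 1%:M -> opnorm (Sx *m Sy') = opnorm (F *m G').
Proof.
move=> hx hy hS hG; apply/eqP; rewrite eq_le; apply/andP; split; first exact: (gram_opnorm hx hy hS hG).
have hx' v := esym (hx v); have hy' v := esym (hy v).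
exact: (gram_opnorm hx' hy' (mulmx1C hG) (mulmx1C hS)).
Qed.

Lemma opnorm_mul_eq0 n (M N : 'M[R[i]]_n) : M = 0 \/ N = 0 -> opnorm (M *m N) = 0.
Proof.
move=> h; apply/eqP; rewrite eq_le opnorm_ge0 andbT; apply: opnorm_le => // v.
have -> : M *m N = 0 by case: h => ->; rewrite ?mul0mx ?mulmx0.
by rewrite mul0mx vnormE fn0 mul0r.
Qed.

Lemma vnorm_gram n (S F : 'M[R[i]]_n) v : S ^t* *m S = F ^t* *m F ->
  vnorm (S *m v) = vnorm (F *m v).
Proof.
move=> h; apply/eqP; rewrite -(@eqrXn2 _ 2) ?vnormE ?fn_ge0// -!vnormE; apply/eqP.
have : ((vnorm (S *m v) ^+ 2)%:C)%C = ((vnorm (F *m v) ^+ 2)%:C)%C.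
  have E (T : 'M[R[i]]_n) : (T *m v) ^t* *m (T *m v) = v ^t* *m (T ^t* *m T) *m v.
    by rewrite trC_mul !mulmxA.
  by rewrite !vnorm_sq (E S) (E F) h.
by case.
Qed.
End block_norms.

(** * The block weight *)

Section block_weight.
Variables (R : realType) (d m : nat) (p : R).
Notation X := (Rspace R d).
Notation Cb := (Cb R d).
Notation mu := (@leb R d).
Hypothesis p1 : 1 < p.
Hypothesis m0 : (0 < m)%N.
Let q := dual_exp p.
Let p0 : 0 < p. Proof. exact: lt_trans p1. Qed.
Let q0 : 0 < q. Proof. exact: dual_exp_gt0. Qed.
Let q1 : 1 <= q. Proof. exact: dual_exp_ge1. Qed.
Variables V U : X -> 'M[R[i]]_m.
Implicit Types (c : Cb) (B : X -> 'M[R[i]]_m).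

Let A x := mxpow (V x) p^-1.
Let A' x := mxpow (V x) (- p^-1).
Let E x := mxpow (U x) p^-1.
Let E' x := mxpow (U x) (- p^-1).

(** The set where both weights are positive definite; its complement is a
    null set, on which the block weight and its powers vanish. *)
Definition good_at (x : X) := posdefmx (V x) /\ posdefmx (U x).

(** The triangular matrix whose modulus is W^(1/p), for the block weight W;
    [Psi] is its inverse. *)
Definition Phi B x : 'M[R[i]]_(m + m) := block_mx (A x) (A x *m B x) 0 (E x).
Definition Psi B x : 'M[R[i]]_(m + m) := block_mx (A' x) (- (B x *m E' x)) 0 (E' x).
(** The Gram matrix of [Phi] is W^(2/p). *)
Definition bweight B x : 'M[R[i]]_(m + m) := mxpow ((Phi B x) ^t* *m Phi B x) (p / 2).

Lemma inv_pow (M : 'M[R[i]]_m) s : posdefmx M -> mxpow M (- s) *m mxpow M s = 1%:M.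
Proof. by move=> h; rewrite mxpowD// addNr mxpow0. Qed.

Lemma PsiPhi B x : good_at x -> Psi B x *m Phi B x = 1%:M.
Proof.
move=> [hV hU]; have hA : A' x *m A x = 1%:M by exact: inv_pow.
have hE : E' x *m E x = 1%:M by exact: inv_pow.
rewrite /Psi /Phi; move: (A x) (A' x) (E x) (E' x) (B x) hA hE => a a' e e' b hA hE.
rewrite mulmx_block !(mulmx0, mul0mx, addr0, add0r) hA hE.
by rewrite mulmxA hA mul1mx mulNmx -mulmxA hE mulmx1 subrr -scalar_mx_block.
Qed.

(** The only place where B enters is the corner, through B(x) - B(y). *)
Lemma PhiPsi B x y : Phi B x *m Psi B y =
  block_mx (A x *m A' y) (A x *m (B x - B y) *m E' y) 0 (E x *m E' y).
Proof.
rewrite /Psi /Phi.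
move: (A x) (A' y) (E x) (E' y) (B x) (B y) => a a' e e' b b'.
rewrite mulmx_block !(mulmx0, mul0mx, addr0, add0r).
by rewrite mulmxN mulmxBr mulmxBl addrC !mulmxA.
Qed.

(** At the points where one weight degenerates, A or E vanishes by the
    convention on powers, and [Phi] has a nonzero kernel. *)
Lemma bweight_gram B x : ~ good_at x -> ~ posdefmx ((Phi B x) ^t* *m Phi B x).
Proof.
move=> nx [_ h].
have w0 : (const_mx 1 : 'cV[R[i]]_m) != 0.
  apply/eqP => /matrixP/(_ (Ordinal m0) 0)/eqP; rewrite !mxE oner_eq0//.
have kill (v : 'cV[R[i]]_(m + m)) : Phi B x *m v = 0 -> v = 0.
  move=> hv; apply/eqP; apply/negP => /negP /h.
  by rewrite -mulmxA -mulmxA hv !mulmx0 mxE ltxx.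
have [hV|hV] := pselect (posdefmx (V x)).
  have hU : ~ posdefmx (U x) by move=> hU; apply: nx.
  have E0 : E x = 0 by exact: mxpowN.
  have : col_mx (- (B x *m const_mx 1)) (const_mx 1) = 0 :> 'cV[R[i]]_(m + m).
    apply: kill; rewrite /Phi E0 mul_block_col !mul0mx addr0.
    by rewrite mulmxN mulmxA addNr col_mx0.
  by move/eqP; rewrite col_mx_eq0 (negbTE w0) andbF.
have A0 : A x = 0 by exact: mxpowN.
have : col_mx (const_mx 1) 0 = 0 :> 'cV[R[i]]_(m + m).
  by apply: kill; rewrite /Phi A0 mul_block_col !mul0mx !mulmx0 !addr0 col_mx0.
by move/eqP; rewrite col_mx_eq0 (negbTE w0).
Qed.

Lemma Phi_unit B x : good_at x -> Phi B x \in unitmx.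
Proof. by move=> /(PsiPhi B) h; have [] := mulmx1_unit h. Qed.

Lemma bweight_posdef B x : good_at x -> posdefmx (bweight B x).
Proof. by move=> gx; apply/mxpow_posdef/posdef_gram/Phi_unit. Qed.

Lemma posdef0F n : (0 < n)%N -> ~ posdefmx (0 : 'M[R[i]]_n).
Proof.
move=> n0 [_ /(_ (const_mx 1))].
have w0 : (const_mx 1 : 'cV[R[i]]_n) != 0.
  by apply/eqP => /matrixP/(_ (Ordinal n0) 0)/eqP; rewrite !mxE oner_eq0.
by move=> /(_ w0); rewrite mulmx0 mul0mx mxE ltxx.
Qed.

Lemma bweight_bad B x s : ~ good_at x -> mxpow (bweight B x) s = 0.
Proof.
move=> bx; have h := bweight_gram (B := B) bx.
have -> : bweight B x = 0 by exact: (mxpowN _ h).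
by apply: mxpowN; apply: posdef0F; rewrite addn_gt0 m0.
Qed.

Lemma bweight_norm B x (v : 'cV[R[i]]_(m + m)) : good_at x ->
  vnorm (mxpow (bweight B x) p^-1 *m v) = vnorm (Phi B x *m v).
Proof.
move=> gx; have hG : posdefmx ((Phi B x) ^t* *m Phi B x) by apply/posdef_gram/Phi_unit.
rewrite /bweight; move: hG; move: (Phi B x) => F hG.
rewrite (mxpowM _ _ hG); apply: vnorm_gram.
rewrite mxpow_tr (mxpowD _ _ hG) (_ : _ + _ = 1) ?mxpow1//.
by field; rewrite gt_eqF.
Qed.

Lemma wker_bweight B x y : good_at x -> good_at y ->
  wker p (bweight B) (x, y) = opnorm (Phi B x *m Psi B y).
Proof.
move=> gx gy; have hw : mxpow (bweight B y) p^-1 *m mxpow (bweight B y) (- p^-1) = 1%:M.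
  by apply: mxpowNK; exact: bweight_posdef.
exact: (gram_opnorm_eq (fun v => @bweight_norm B x v gx) (fun v => @bweight_norm B y v gy)
  hw (PsiPhi B gy)).
Qed.

Lemma wker_bad B z : ~ (good_at z.1 /\ good_at z.2) -> wker p (bweight B) z = 0.
Proof.
move=> h; apply: opnorm_mul_eq0.
have [g1|b1] := pselect (good_at z.1); last by left; exact: bweight_bad.
by right; apply: bweight_bad => g2; apply: h.
Qed.

Lemma mxm_bweight B : mxm V -> mxm U -> mxm B -> mxm (bweight B).
Proof.
move=> mV mU mB; apply: mxm_mxpow.
have mPhi : mxm (Phi B).
  have mA : mxm A by exact: mxm_mxpow.
  have mE : mxm E by exact: mxm_mxpow.
  have mAB := mxmM mA mB.
  move=> i j; rewrite /Phi; case: (split_ordP i) => i' ->; case: (split_ordP j) => j' ->.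
  - by under eq_fun do rewrite block_mxEul; exact: mA.
  - by under eq_fun do rewrite block_mxEur; exact: mAB.
  - by under eq_fun do rewrite block_mxEdl mxE; exact: cm_cst.
  - by under eq_fun do rewrite block_mxEdr; exact: mE.
by apply: mxmM => //; exact: mxm_tr.
Qed.

End block_weight.

(** * The A_p constant of the block weight *)

Lemma powR_add3 (R : realType) (s a b c : R) : 0 <= s -> 0 <= a -> 0 <= b -> 0 <= c ->
  (a + b + c) `^ s <= 3 `^ s * (a `^ s + b `^ s + c `^ s).
Proof.
move=> s0 a0 b0 c0; have [pa pb pc] : [/\ 0 <= a `^ s, 0 <= b `^ s & 0 <= c `^ s].
  by split; exact: powR_ge0.
have key t : 0 <= t -> a <= t -> b <= t -> c <= t ->
    t `^ s <= a `^ s + b `^ s + c `^ s -> (a + b + c) `^ s <= 3 `^ s * (a `^ s + b `^ s + c `^ s).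
  move=> t0 ha hb hc ht; apply: (@le_trans _ _ ((3 * t) `^ s)).
    by apply: powR_le => //; [rewrite !addr_ge0|lra].
  by rewrite powRM//; apply: ler_wpM2l => //; exact: powR_ge0.
have [ab|ba] := leP a b; have [bc|cb] := leP b c; have [ac|ca] := leP a c;
  (apply: (key c) => //; lra) || (apply: (key b) => //; lra) || (apply: (key a) => //; lra).
Qed.

Section block_Ap.
Variables (R : realType) (d m : nat) (p : R).
Notation X := (Rspace R d).
Notation Cb := (Cb R d).
Notation mu := (@leb R d).
Hypothesis p1 : 1 < p.
Hypothesis m0 : (0 < m)%N.
Let q := dual_exp p.
Let p0 : 0 < p. Proof. exact: lt_trans p1. Qed.
Let q0 : 0 < q. Proof. exact: dual_exp_gt0. Qed.
Let q1 : 1 <= q. Proof. exact: dual_exp_ge1. Qed.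
Implicit Types (c : Cb) (V U B : X -> 'M[R[i]]_m).

Definition rt V (x : X) := mxpow (V x) p^-1.
Definition irt V (x : X) := mxpow (V x) (- p^-1).

Lemma int_add3 c s (f g h : X -> R) (a b e : R) : 0 <= s ->
  measurable_fun setT f -> measurable_fun setT g -> measurable_fun setT h ->
  (forall x, 0 <= f x) -> (forall x, 0 <= g x) -> (forall x, 0 <= h x) ->
  (int c (fun x => ((f x) `^ s)%R) <= a%:E)%E ->
  (int c (fun x => ((g x) `^ s)%R) <= b%:E)%E ->
  (int c (fun x => ((h x) `^ s)%R) <= e%:E)%E ->
  (int c (fun x => ((f x + g x + h x) `^ s)%R) <= (3 `^ s * (a + b + e))%:E)%E.
Proof.
move=> s0 mf mg mh f0 g0 h0 hf hg hh.
have mp (u : X -> R) : measurable_fun setT u -> measurable_fun setT (fun x => (u x) `^ s).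
  by move=> mu'; exact: (measurableT_comp (measurable_powR _) mu').
have pp (u : X -> R) x : 0 <= (u x) `^ s by exact: powR_ge0.
have m2 : measurable_fun setT (fun x => f x `^ s + g x `^ s).
  by apply: measurable_funD; exact: mp.
have m3 : measurable_fun setT (fun x => f x `^ s + g x `^ s + h x `^ s).
  by apply: measurable_funD => //; exact: mp.
apply: (@le_trans _ _ (int c (fun x => 3 `^ s * (f x `^ s + g x `^ s + h x `^ s)))).
  apply: int_mono.
  - by apply: mp; apply: measurable_funD => //; exact: measurable_funD.
  - exact: measurable_funM.
  - by move=> x; exact: powR_ge0.
  - by move=> x; rewrite mulr_ge0 ?powR_ge0// !addr_ge0.
  by apply: aeW => x _; exact: powR_add3.
rewrite intZ ?powR_ge0//; last by move=> x; rewrite !addr_ge0.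
rewrite EFinM; apply: lee_wpmul2l; first by rewrite lee_fin powR_ge0.
have p2 x : 0 <= f x `^ s + g x `^ s by rewrite addr_ge0.
rewrite (intD _ m2 (mp _ mh) p2 (pp h)) (intD _ (mp _ mf) (mp _ mg) (pp f) (pp g)).
by rewrite !EFinD; apply: leeD => //; exact: leeD.
Qed.

(** Writing b = B(x) - M and b' = B(y) - M, the corner A (b - b') E' splits into a
    part with b and a part with b'; inserting v and u turns each of the four terms
    into a function of x times a function of y. *)
Lemma wker_le V U B x y (v u M : 'M[R[i]]_m) : v \in unitmx -> u \in unitmx ->
  wker p (bweight p V U B) (x, y) <=
  (fn (rt V x *m invmx v) + fn (rt U x *m invmx u) + fn (rt V x *m (B x - M) *m invmx u)) *
  (fn (v *m irt V y) + fn (u *m irt U y) + fn (v *m (B y - M) *m irt U y)).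
Proof.
move=> hv hu.
have [[gx gy]|b] := pselect (good_at V U x /\ good_at V U y); last first.
  by rewrite (wker_bad p m0 B (z := (x, y)) b) mulr_ge0// !addr_ge0// fn_ge0.
rewrite (wker_bweight p1 B gx gy) PhiPsi -/(rt V x) -/(rt U x) -/(irt V y) -/(irt U y).
apply: le_trans (opnorm_le_fn _) _; apply: le_trans (fn_block_le _ _ _ _) _.
move: (rt V x) (rt U x) (irt V y) (irt U y) (B x) (B y) => a e a' e' b b'.
rewrite fn0 addr0.
have iv : invmx v *m v = 1%:M by exact: mulVmx.
have iu : invmx u *m u = 1%:M by exact: mulVmx.
have h1 : fn (a *m a') <= fn (a *m invmx v) * fn (v *m a').
  by rewrite (mulmx_insert a a' iv); exact: fnM.
have h2 : fn (e *m e') <= fn (e *m invmx u) * fn (u *m e').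
  by rewrite (mulmx_insert e e' iu); exact: fnM.
have h3 : fn (a *m (b - b') *m e') <=
    fn (a *m (b - M) *m invmx u) * fn (u *m e') + fn (a *m invmx v) * fn (v *m (b' - M) *m e').
  have -> : a *m (b - b') *m e' = (a *m (b - M)) *m e' - a *m ((b' - M) *m e').
    by rewrite mulmxA -mulmxBl -mulmxBr opprB addrA subrK.
  apply: le_trans (fnB _ _) _; apply: lerD.
    by rewrite (mulmx_insert (a *m (b - M)) e' iu); exact: fnM.
  by rewrite (mulmx_insert a ((b' - M) *m e') iv) (mulmxA v); exact: fnM.
move: h1 h2 h3.
have := fn_ge0 (a *m invmx v); have := fn_ge0 (e *m invmx u).
have := fn_ge0 (a *m (b - M) *m invmx u); have := fn_ge0 (v *m a').
have := fn_ge0 (u *m e'); have := fn_ge0 (v *m (b' - M) *m e').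
move: (fn (a *m a')) (fn (e *m e')) (fn (a *m (b - b') *m e')) => w1 w2 w3.
move: (fn _) (fn _) (fn _) (fn _) (fn _) (fn _) => f1 f2 f3 f4 f5 f6.
move=> *; nra.
Qed.

(** The kernel is dominated by g(x) h(y), where g is bounded in L^p means and
    h in L^p' means by the reducing properties of the averages and by
    [offdiag_bounds]. *)
Lemma bweight_upper (K : R) : 0 < K -> exists2 F, 0 <= F & forall V U B,
  mxm V -> mxm U -> reduced p K (rt V) (irt V) -> reduced p K (rt U) (irt U) ->
  MLS B -> bmo_le (rt V) (rt U) B -> (Ap_const p (bweight p V U B) <= F%:E)%E.
Proof.
move=> K0; have [C C0 HC] := @offdiag_bounds R d p m p1 K K0.
pose G s : R := 3 `^ s * (K + K + C).
have G0 s : 0 <= G s by rewrite mulr_ge0 ?powR_ge0// !addr_ge0// ltW.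
exists ((G q) `^ (p / q) * G p); first by rewrite mulr_ge0// powR_ge0.
move=> V U B mV mU rV rU hB bmo; apply: (iffRL (Ap_constE _ _ _)) => c c0.
have [h1 h2] := HC _ _ _ _ _ rV rU hB bmo c c0; have v0 := vol_gt0 c0.
have mW := mxm_bweight p mV mU (mxm_MLS hB).
have hk := kern_wker p mW.
have [mA mA' mE mE'] := And4 (rdA rV) (rdA' rV) (rdA rU) (rdA' rU).
have mBc := mxm_MLS (MLS_Bc (mxmean c B) hB).
have uv := rdV rV c0; have uu := rdV rU c0.
pose v := mxmean c (rt V); pose u := mxmean c (rt U).
pose M := mxmean c B.
have cv (N : 'M[R[i]]_m) : mxm (fun _ : X => N) := mxm_cst N.
have mg1 := measurable_fn (mxmM mA (cv (invmx v))).
have mg2 := measurable_fn (mxmM mE (cv (invmx u))).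
have mg3 := measurable_fn (mxmM (mxmM mA mBc) (cv (invmx u))).
have mh1 := measurable_fn (mxmM (cv v) mA').
have mh2 := measurable_fn (mxmM (cv u) mE').
have mh3 := measurable_fn (mxmM (mxmM (cv v) mBc) mE').
have fx n (F : X -> 'M[R[i]]_n) x : 0 <= fn (F x) by exact: fn_ge0.
have Gv s : G s * vol c = 3 `^ s * (K * vol c + K * vol c + C * vol c).
  by rewrite /G -mulrA !mulrDl.
pose g x := fn (rt V x *m invmx v) + fn (rt U x *m invmx u) + fn (rt V x *m (B x - M) *m invmx u).
pose h y := fn (v *m irt V y) + fn (u *m irt U y) + fn (v *m (B y - M) *m irt U y).
have mg : measurable_fun setT g := measurable_funD (measurable_funD mg1 mg2) mg3.
have mh : measurable_fun setT h := measurable_funD (measurable_funD mh1 mh2) mh3.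
have g0 x : 0 <= g x by rewrite !addr_ge0 ?fn_ge0.
have h0 x : 0 <= h x by rewrite !addr_ge0 ?fn_ge0.
have kgh (z : X * X) : wker p (bweight p V U B) z <= g z.1 * h z.2.
  case: z => x y; exact (@wker_le V U B x y v u M uv uu).
have hg : (int c (fun x => ((g x) `^ p)%R) <= (G p * vol c)%:E)%E.
  rewrite Gv; exact: (int_add3 (ltW p0) mg1 mg2 mg3 (fx _ _) (fx _ _) (fx _ _) (rdp rV c0) (rdp rU c0) h1).
have hh : (int c (fun x => ((h x) `^ q)%R) <= (G q * vol c)%:E)%E.
  rewrite Gv; exact: (int_add3 (ltW q0) mh1 mh2 mh3 (fx _ _) (fx _ _) (fx _ _) (rdq rV c0) (rdq rU c0) h2).
rewrite -mulrA.
exact: (kint_prod p1 c0 hk mg mh g0 h0 kgh hg hh (G0 q)).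
Qed.

End block_Ap.

(** * Dilating the symbol *)

Section dilation.
Variables (R : realType) (d m : nat) (p : R).
Notation X := (Rspace R d).
Notation Cb := (Cb R d).
Notation mu := (@leb R d).
Hypothesis p1 : 1 < p.
Hypothesis m0 : (0 < m)%N.
Let q := dual_exp p.
Let p0 : 0 < p. Proof. exact: lt_trans p1. Qed.
Let q0 : 0 < q. Proof. exact: dual_exp_gt0. Qed.
Implicit Types (c : Cb) (B : X -> 'M[R[i]]_m).
Variables V U : X -> 'M[R[i]]_m.
Hypothesis (mV : mxm V) (mU : mxm U).

(** Dilation by e^s: the additive parameter s makes the dependence of the A_p
    constant Lipschitz on a logarithmic scale. *)
Definition bscale (s : R) B x : 'M[R[i]]_m := ((expR s)%:C)%C *: B x.

Lemma bscaleD s t B : bscale (s + t) B = bscale s (bscale t B).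
Proof. by apply/funext => x; rewrite /bscale scalerA -rmorphM expRD. Qed.

Lemma mxm_bscale s B : mxm B -> mxm (bscale s B).
Proof. by move=> mB; apply: mxmZ => //; exact: cm_cst. Qed.

Lemma scale_corner (a e : 'M[R[i]]_m) (b b' : 'M[R[i]]_m) z :
  a *m (z *: b - z *: b') *m e = z *: (a *m (b - b') *m e).
Proof. by rewrite -scalerBr -scalemxAr -scalemxAl. Qed.

Lemma maxe (r : R) : Num.max (expR r) 1 * Num.max (expR (- r)) 1 = expR `|r|.
Proof.
have [r0|r0] := leP 0 r.
  have h1 : 1 <= expR r by rewrite -expR0 ler_expR.
  have h2 : expR (- r) <= 1 by rewrite expR_le1 oppr_le0.
  by rewrite ger0_norm// (max_idPl h1) (max_idPr h2) mulr1.
have h1 : expR r <= 1 by rewrite expR_le1 ltW.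
have h2 : 1 <= expR (- r) by rewrite -expR0 ler_expR oppr_ge0 ltW.
by rewrite ltr0_norm// (max_idPr h1) (max_idPl h2) mul1r.
Qed.

(** Dilating the corner is conjugation by diag(e^s, 1); the norms of this
    matrix and of its inverse have product e^|s|. *)
Lemma wker_bscale B s z : wker p (bweight p V U (bscale s B)) z <=
  expR `|s| * wker p (bweight p V U B) z.
Proof.
case: z => x y.
have [[gx gy]|b] := pselect (good_at V U x /\ good_at V U y); last first.
  rewrite (wker_bad p m0 (bscale s B) (z := (x, y)) b) mulr_ge0 ?expR_ge0//; exact: opnorm_ge0.
rewrite (wker_bweight p1 (bscale s B) gx gy) (wker_bweight p1 B gx gy) !PhiPsi.
rewrite /bscale scale_corner.
rewrite -(@stretch_block _ _ (expR s) (expR (- s))); last by rewrite -expRD subrr expR0.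
apply: le_trans (opnormM _ _) _.
apply: (@le_trans _ _ (opnorm (stretch m (expR s)) * opnorm
  (block_mx (mxpow (V x) p^-1 *m mxpow (V y) (- p^-1))
     (mxpow (V x) p^-1 *m (B x - B y) *m mxpow (U y) (- p^-1)) 0
     (mxpow (U x) p^-1 *m mxpow (U y) (- p^-1))) * opnorm (stretch m (expR (- s))))).
  by apply: ler_wpM2r; [exact: opnorm_ge0|exact: opnormM].
rewrite -maxe mulrAC; apply: ler_wpM2r; first exact: opnorm_ge0.
by apply: ler_pM; rewrite ?opnorm_ge0// opnorm_stretch ?expR_ge0.
Qed.

Lemma bweight_lip B s t a : mxm B ->
  (Ap_const p (bweight p V U (bscale s B)) <= a%:E)%E ->
  (Ap_const p (bweight p V U (bscale t B)) <= ((expR `|t - s|) `^ p * a)%:E)%E.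
Proof.
move=> mB h; apply: (iffRL (Ap_constE _ _ _)) => c c0.
have mW r : mxm (bweight p V U (bscale r B)) by apply: mxm_bweight => //; exact: mxm_bscale.
have kl z : wker p (bweight p V U (bscale t B)) z <=
    expR `|t - s| * wker p (bweight p V U (bscale s B)) z.
  have -> : bscale t B = bscale (t - s) (bscale s B) by rewrite -bscaleD subrK.
  exact (wker_bscale (bscale s B) (t - s) z).
have := kint_mono p1 c0 (expR_ge0 _) (kern_wker p (mW t)) (kern_wker p (mW s)) kl.
move=> /le_trans; apply; rewrite -mulrA EFinM; apply: lee_wpmul2l.
  by rewrite lee_fin powR_ge0.
exact: (iffLR (Ap_constE _ _ _) h).
Qed.

Definition goodb (x : X) : bool := `[< posdefmx (V x) >] && `[< posdefmx (U x) >].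

Lemma goodbP x : goodb x <-> good_at V U x.
Proof.
split=> [/andP[/asboolP ? /asboolP ?]//|[h1 h2]].
by apply/andP; split; exact/asboolP.
Qed.

(** The value 0 at the bad points keeps it below the kernel of the block weight,
    which vanishes there. *)
Definition ker0 B (z : X * X) : R :=
  fn (if goodb z.1 && goodb z.2 then rt p V z.1 *m (B z.1 - B z.2) *m irt p U z.2 else 0).

Lemma kern_ker0 B : mxm B -> kern (ker0 B).
Proof.
move=> mB; split; last by move=> z; exact: fn_ge0.
have mb : measurable_fun setT goodb.
  by apply: measurable_and; exact: measurable_posdef.
apply: measurable_fn; apply: mxm_if; last exact: mxm_cst.
  apply: measurable_and.
    exact: (measurableT_comp mb measurable_fst).
  exact: (measurableT_comp mb measurable_snd).
have m1 : mxm (rt p V) by exact: mxm_mxpow.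
have m2 : mxm (irt p U) by exact: mxm_mxpow.
apply: mxmM; last exact: (mxm_comp measurable_snd m2).
apply: mxmM; first exact: (mxm_comp measurable_fst m1).
apply: mxmB; [exact: (mxm_comp measurable_fst mB)|exact: (mxm_comp measurable_snd mB)].
Qed.

Lemma ker0_le B s z : ker0 B z <=
  Num.sqrt (m + m)%:R * expR (- s) * wker p (bweight p V U (bscale s B)) z.
Proof.
rewrite /ker0; case: ifPn => [/andP[/goodbP g1 /goodbP g2]|_]; last first.
  by rewrite fn0 mulr_ge0 ?opnorm_ge0// mulr_ge0 ?sqrtr_ge0 ?expR_ge0.
case: z g1 g2 => x y /= gx gy; rewrite (wker_bweight p1 (bscale s B) gx gy) PhiPsi.
rewrite /bscale scale_corner -/(rt p V x) -/(irt p U y).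
set b := _ *m _ *m _.
rewrite mulrAC expRN ler_pdivlMr ?expR_gt0//.
have -> : fn b * expR s = fn (((expR s)%:C)%C *: b).
  by rewrite fnZ normc_real ger0_norm ?expR_ge0// mulrC.
apply: le_trans (fn_block_ur _ _ _ _) _; exact: fn_le_opnorm.
Qed.

Lemma ker0_eq0 B x y s t : ker0 B (x, y) = 0 ->
  wker p (bweight p V U (bscale s B)) (x, y) = wker p (bweight p V U (bscale t B)) (x, y).
Proof.
rewrite /ker0 /=.
have [[gx gy]|b] := pselect (good_at V U x /\ good_at V U y); last first.
  have e1 := wker_bad p m0 (bscale s B) (z := (x, y)) b.
  have e2 := wker_bad p m0 (bscale t B) (z := (x, y)) b.
  by move=> _; exact: (etrans e1 (esym e2)).
have -> : goodb x && goodb y by apply/andP; split; exact/goodbP.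
move=> /fn_eq0 h.
have e r : Phi p V U (bscale r B) x *m Psi p V U (bscale r B) y =
    block_mx (rt p V x *m irt p V y) 0 0 (rt p U x *m irt p U y).
  by rewrite PhiPsi /bscale scale_corner -/(rt p V x) -/(irt p U y) h scaler0.
have e1 := wker_bweight p1 (bscale s B) gx gy.
have e2 := wker_bweight p1 (bscale t B) gx gy.
have e3 := congr1 (@opnorm R (m + m) (m + m)) (etrans (e s) (esym (e t))).
exact (etrans e1 (etrans e3 (esym e2))).
Qed.

Lemma kint_eq0 c k : 0 < c.2 -> kern k -> kint p c k = 0%E ->
  {ae mu, forall x, cset c x -> {ae mu, forall y, cset c y -> k (x, y) = 0}}.
Proof.
move=> c0 hk h; have mc := measurable_cset c; have v0 := vol_gt0 c0.
have ia : (\int[mu]_(x in cset c) `| kin p c k x `^ (p / q) | = 0)%E.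
  by rewrite -[RHS]h; apply: eq_integral => x _; rewrite gee0_abs// poweR_ge0.
have := (ae_eq_integral_abs mu mc (measurable_kin p (D := cset c) c hk)).1 ia.
apply: filterS => x hx cx; have {}hx := poweR_eq0_eq0 (kin_ge0 p k x c0) (hx cx).
have hi : (\int[mu]_(y in cset c) ((k (x, y)) `^ q)%R%:E = 0)%E.
  move/eqP: hx; rewrite mule_eq0 => /orP[|/eqP//].
  by rewrite eqe invr_eq0 gt_eqF.
have m2 : measurable_fun setT (fun y => (k (x, y)) `^ q).
  have h3 := measurable_kpow2 p (D := setT) x hk; exact/measurable_EFinP.
have := int_eq0 m2 (fun y => powR_ge0 _ _) hi.
apply: filterS => y hy cy; move: (hy cy) => /eqP.
by rewrite powR_eq0 => /andP[/eqP].
Qed.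

Lemma decay_eq0 (r C : R) : 0 <= r -> 0 <= C -> (forall s : R, r <= C * expR (- s)) -> r = 0.
Proof.
move=> r0 C0 h; apply/eqP; rewrite eq_le r0 andbT leNgt; apply/negP => rp.
have := h (C / r); rewrite expRN ler_pdivlMr ?expR_gt0// leNgt => /negP; apply.
apply: (@lt_le_trans _ _ (r * (1 + C / r))); last first.
  by apply: ler_wpM2l => //; exact: expR_ge1Dx.
by rewrite mulrDr mulr1 mulrC divfK ?gt_eqF// ltrDr.
Qed.

(** The dilated kernels dominate e^s times the corner, and their A_p
    functionals are bounded uniformly in s. *)
Lemma ker0_kint B a c : 0 <= a -> mxm B -> 0 < c.2 ->
  (forall s, Ap_const p (bweight p V U (bscale s B)) <= a%:E)%E -> kint p c (ker0 B) = 0%E.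
Proof.
move=> a0 mB c0 h; have v0 := vol_gt0 c0.
have mW r : mxm (bweight p V U (bscale r B)) by apply: mxm_bweight => //; exact: mxm_bscale.
pose sq : R := Num.sqrt (m + m)%:R.
have hb s : (kint p c (ker0 B) <= ((sq * expR (- s)) `^ p * (a * vol c))%:E)%E.
  have l0 : 0 <= sq * expR (- s) by rewrite mulr_ge0 ?sqrtr_ge0 ?expR_ge0.
  have := kint_mono p1 c0 l0 (kern_ker0 mB) (kern_wker p (mW s)) (@ker0_le B s).
  move=> /le_trans; apply; rewrite EFinM; apply: lee_wpmul2l.
    by rewrite lee_fin powR_ge0.
  exact: (iffLR (Ap_constE _ _ _) (h s)).
have k0 : (0 <= kint p c (ker0 B))%E by apply: integral_ge0 => x _; exact: poweR_ge0.
move: k0 hb; case: (kint p c (ker0 B)) => [r| |]//; last by move=> _ /(_ 0).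
rewrite lee_fin => r0 hb; congr EFin.
apply: (@decay_eq0 _ (sq `^ p * (a * vol c))) => //.
  by rewrite mulr_ge0 ?powR_ge0// mulr_ge0// ltW.
move=> s; have := hb (s / p); rewrite lee_fin powRM ?sqrtr_ge0 ?expR_ge0//.
by rewrite -expRM mulNr divfK ?gt_eqF// mulrAC.
Qed.

(** If the A_p constant stays bounded under all dilations, then the corner
    vanishes almost everywhere, and the dilations do not act at all. *)
Lemma bweight_rigid B a s t e : 0 <= a -> mxm B ->
  (forall s, Ap_const p (bweight p V U (bscale s B)) <= a%:E)%E ->
  (Ap_const p (bweight p V U (bscale s B)) <= e%:E)%E ->
  (Ap_const p (bweight p V U (bscale t B)) <= e%:E)%E.
Proof.
move=> a0 mB h hs; apply: (iffRL (Ap_constE _ _ _)) => c c0.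
have mW r : mxm (bweight p V U (bscale r B)) by apply: mxm_bweight => //; exact: mxm_bscale.
apply: le_trans (iffLR (Ap_constE _ _ _) hs c c0).
have hz := kint_eq0 c0 (kern_ker0 mB) (ker0_kint a0 mB c0 h).
have ks := kern_wker p (mW s); have kt := kern_wker p (mW t).
have := kint_mono_ae p1 c0 ler01 kt ks; rewrite powR1 mul1e; apply.
apply: filterS hz => x hx cx.
have k1 := kin_mono p1 (x := x) c0 ler01 kt ks.
rewrite powR1 in k1; apply: k1.
have L (r r' : R) : r = r' -> r <= 1 * r' by move=> ->; rewrite mul1r.
apply: filterS (hx cx) => y hy cy; exact (L _ _ (ker0_eq0 t s (hy cy))).
Qed.

End dilation.

(** Where phi is positive the hypothesis says that its logarithm is Lipschitz; in
    this multiplicative form it gives continuity without excluding zeros. *)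
Lemma quasi_lipschitz_IVT (R : realType) (phi : R -> R) (p s0 s1 v : R) :
  (forall s, 0 <= phi s) ->
  (forall s t, phi t <= (expR `|t - s|) `^ p * phi s) ->
  phi s0 <= v -> v <= phi s1 -> exists s, phi s = v.
Proof.
move=> phi0 lip h0 h1.
have E r : (expR r) `^ p = expR (r * p) by rewrite expRM.
have cphi : continuous phi.
  move=> s.
  have lip1 t : expR (- (`|t - s| * p)) * phi s <= phi t.
    rewrite expRN mulrC ler_pdivrMr ?expR_gt0// mulrC -E distrC; exact: lip.
  have cc (g : R -> R) : g t @[t --> s] --> (0 : R) -> expR (g t) * phi s @[t --> s] --> phi s.
    move=> cg; rewrite -[X in _ --> X]mul1r -expR0.
    apply: cvgM; last exact: cvg_cst.
    by apply: continuous_cvg; [exact: continuous_expR|exact: cg].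
  have cd : `|t - s| * p @[t --> s] --> (0 : R).
    rewrite -(mul0r p) -[X in X * p](normr0 R) -(subrr s).
    apply: cvgM; last exact: cvg_cst.
    by apply: cvg_norm; apply: cvgB; [exact: cvg_id|exact: cvg_cst].
  apply: (@squeeze_cvgr _ _ _ _ (fun t => expR (- (`|t - s| * p)) * phi s)
     (fun t => expR (`|t - s| * p) * phi s)).
  - by apply: nearW => t; rewrite lip1 -E lip.
  - by apply: cc; rewrite -[X in _ --> X]oppr0; exact: cvgN.
  - exact: cc.
have [s01|s10] := leP s0 s1.
  have [c _ hc] := @IVT _ phi s0 s1 v s01 (continuous_subspaceT cphi) ltac:(by rewrite ge_min le_max h0 h1 orbT).
  by exists c.
have [c _ hc] := @IVT _ phi s1 s0 v (ltW s10) (continuous_subspaceT cphi) ltac:(by rewrite ge_min le_max h0 h1 orbT).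
by exists c.
Qed.

(** * The commutator as a corner of a diagonal operator *)

Section operator_part.
Variables (R : realType) (d m : nat) (p : R).
Notation X := (Rspace R d).
Notation mu := (@leb R d).
Hypothesis p1 : 1 < p.
Hypothesis m0 : (0 < m)%N.
Let p0 : 0 < p. Proof. exact: lt_trans p1. Qed.

Lemma LpW_norm_le n n' (W : X -> 'M[R[i]]_n) (W' : X -> 'M[R[i]]_n') f g (l : R) : 0 <= l ->
  mxm W -> mxm W' -> mxm f -> mxm g ->
  {ae mu, forall x, vnorm (mxpow (W x) p^-1 *m f x) <= l * vnorm (mxpow (W' x) p^-1 *m g x)} ->
  (LpW_norm p W f <= l%:E * LpW_norm p W' g)%E.
Proof.
move=> l0 mW mW' mf mg h; rewrite /LpW_norm.
have mp k (M : X -> 'M[R[i]]_k) v : mxm M -> mxm v ->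
    measurable_fun setT (fun x => ((vnorm (mxpow (M x) p^-1 *m v x)) `^ p)%:E).
  move=> mM mv; apply/measurable_EFinP.
  have mMv : mxm (fun x => mxpow (M x) p^-1 *m v x).
    by apply: mxmM => //; exact: mxm_mxpow.
  apply: (measurableT_comp (measurable_powR _)).
  by under eq_fun do rewrite vnormE; exact: measurable_fn.
have i0 k (M : X -> 'M[R[i]]_k) v :
    (0 <= \int[mu]_x ((vnorm (mxpow (M x) p^-1 *m v x)) `^ p)%:E)%E.
  by apply: integral_ge0 => x _; rewrite lee_fin powR_ge0.
have -> : (l%:E = ((l `^ p)%:E) `^ p^-1)%E.
  by rewrite poweR_EFin -powRrM divff ?gt_eqF// powRr1.
rewrite -poweRM ?lee_fin ?powR_ge0//; apply: le_poweR => //.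
  by rewrite invr_ge0 ltW.
rewrite -(@ge0_integralZl_EFin _ _ _ mu _ measurableT
   (fun x => ((vnorm (mxpow (W' x) p^-1 *m g x)) `^ p)%:E)); last first.
- exact: powR_ge0.
- exact: mp.
- by move=> x _; rewrite lee_fin powR_ge0.
apply: (@ae_ge0_le_integral _ _ _ mu _ measurableT).
- by move=> x _; rewrite lee_fin powR_ge0.
- exact: mp.
- by move=> x _; rewrite mule_ge0// lee_fin powR_ge0.
- by apply: emeasurable_funM => //; exact: mp.
apply: filterS h => x hx _; rewrite -EFinM lee_fin -powRM ?vnormE ?fn_ge0//.
apply: powR_le; [exact: ltW|exact: fn_ge0|by rewrite -!vnormE].
Qed.

Lemma op_zero (T : operator (X -> R[i]) (X -> R[i])) : op_linear T ->
  {ae mu, forall x, T (fun=> 0) x = 0}.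
Proof.
move=> [d0 hl]; have [_] := hl 1 _ _ d0 d0.
apply: filterS => x; rewrite (_ : (fun x => _) = (fun=> 0)).
  by rewrite mul1r => h; apply: (@addrI _ (T (fun=> 0) x)); rewrite addr0 -h.
by apply/funext => y; rewrite mul1r addr0.
Qed.

(** Homogeneity holds only almost everywhere, and T 0 = 0 also has to be
    deduced from linearity up to null sets. *)
Lemma op_scale (T : operator (X -> R[i]) (X -> R[i])) f (a : R[i]) : op_linear T ->
  op_dom T f -> {ae mu, forall x, T (fun x => a * f x) x = a * T f x}.
Proof.
move=> hT df; have [d0 hl] := hT; have [_ h] := hl a _ _ df d0.
apply: filterS2 h (op_zero hT) => x h1 h2; move: h1; rewrite h2 addr0 => <-.
by congr (op_fun T _ _); apply/funext => y; rewrite addr0.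
Qed.

Lemma corner_cancel (a b : 'M[R[i]]_m) (t : 'cV[R[i]]_m) z : z != 0 ->
  a *m (z *: b) *m (- z^-1 *: t) = - (a *m b *m t).
Proof.
move=> z0; rewrite -scalemxAr -scalemxAr -scalemxAl scalerA mulNr mulVf//.
by rewrite scaleN1r.
Qed.

(** This is where the vector (B g, - g / z) is annihilated by the first row of
    [Phi]. *)
Lemma corner_cancel_w (a b e : 'M[R[i]]_m) (t : 'cV[R[i]]_m) z w : z != 0 ->
  col_mx (a *m (w *: (b *m t)) + a *m (z *: b) *m (- (w / z) *: t)) (e *m (- (w / z) *: t)) =
  col_mx 0 (- (w / z) *: (e *m t)).
Proof.
move=> z0; rewrite -!scalemxAr -scalemxAl scalerA mulmxA -scalerDl mulNr divfK//.
by rewrite subrr scale0r.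
Qed.

(** The vector f w is w (B g, - g / z), with z = e^s.  Its first use, with w = 1,
    gives the estimate.  For w = - z the second component is g itself, which
    shows that g is in the domain and that T g is measurable; almost everywhere
    homogeneity would not give these exactly. *)
Lemma comm_op_bound (T : operator (X -> R[i]) (X -> R[i])) (V U B : X -> 'M[R[i]]_m) (s M : R) :
  op_linear T -> mxm V -> mxm U -> mxm B -> {ae mu, forall x, good_at V U x} -> 0 <= M ->
  (forall f, LpW p (bweight p V U (bscale s B)) f ->
    [/\ op_dom (op_tensor (m + m) T) f,
        LpW p (bweight p V U (bscale s B)) (op_tensor (m + m) T f) &
        (LpW_norm p (bweight p V U (bscale s B)) (op_tensor (m + m) T f) <=
          M%:E * LpW_norm p (bweight p V U (bscale s B)) f)%E]) ->
  forall g, LpW p U g ->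
    [/\ op_dom (commutator (op_mul B) (op_tensor m T)) g,
        LpW p V (commutator (op_mul B) (op_tensor m T) g) &
        (LpW_norm p V (commutator (op_mul B) (op_tensor m T) g) <=
           (M * expR (- s))%:E * LpW_norm p U g)%E].
Proof.
move=> hT mV mU mB gVU M0 hM g [mg ng].
pose W := bweight p V U (bscale s B).
have mW : mxm W by apply: mxm_bweight => //; exact: mxm_bscale.
pose z : R[i] := ((expR s)%:C)%C.
have z0 : z != 0 by apply/eqP => -[] /eqP; rewrite gt_eqF ?expR_gt0.
pose f w x : 'cV[R[i]]_(m + m) := col_mx (w *: (B x *m g x)) (- (w / z) *: g x).
have mf w : mxm (f w).
  have m1 : mxm (fun x => w *: (B x *m g x)) by apply: mxmZ; [exact: cm_cst|exact: mxmM].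
  have m2 : mxm (fun x => - (w / z) *: g x) by apply: mxmZ; [exact: cm_cst|exact: mg].
  move=> i j; rewrite /f; case: (split_ordP i) => i' ->.
    by under eq_fun do rewrite col_mxEu; exact: m1.
  by under eq_fun do rewrite col_mxEd; exact: m2.
have Phif w x : Phi p V U (bscale s B) x *m f w x = col_mx 0 (- (w / z) *: (rt p U x *m g x)).
  rewrite /Phi /f /bscale -/z mul_block_col mul0mx add0r -/(rt p V x) -/(rt p U x).
  by rewrite corner_cancel_w.
have nf w : (LpW_norm p W (f w) <= (normc (w / z))%:E * LpW_norm p U g)%E.
  apply: (LpW_norm_le (normc_ge0 _) mW mU (mf w) mg).
  apply: filterS gVU => x gx; rewrite (bweight_norm p1 _ _ gx) Phif !vnormE.
  have h := fn_col_sq (0 : 'cV[R[i]]_m) (- (w / z) *: (rt p U x *m g x)).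
  move: h; rewrite fn0 expr0n add0r => /eqP; rewrite eqrXn2 ?fn_ge0// => /eqP ->.
  by rewrite fnZ (_ : normc (- (w / z)) = normc (w / z))// normcN.
have Lf w : LpW p W (f w).
  split; first exact: mf.
  apply: (le_lt_trans (nf w)).
  have : (0 <= LpW_norm p U g)%E by exact: poweR_ge0.
  by move: ng; case: (LpW_norm p U g) => [r| |]// _ _; rewrite -EFinM ltry.
(* w = - z serves for the domain of g and the measurability of T g *)
have [df1 [mT1 _] nT1] := hM _ (Lf 1); have [df2 [mT2 _] _] := hM _ (Lf (- z)).
have eBg j : (fun x => f 1 x (lshift m j) 0) = (fun x => (B x *m g x) j 0).
  by apply/funext => x; rewrite /f col_mxEu scale1r.
have eg j : (fun x => f (- z) x (rshift m j) 0) = (fun x => g x j 0).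
  by apply/funext => x; rewrite /f col_mxEd mulNr divff// opprK scale1r.
have dBg j : op_dom T (fun x => (B x *m g x) j 0) by rewrite -eBg; exact: df1.
have dg j : op_dom T (fun x => g x j 0) by rewrite -eg; exact: df2.
have mTBg : mxm (op_tensor m T (fun x => B x *m g x)).
  move=> j k; rewrite (ord1 k).
  have <- : (fun x => op_tensor (m + m) T (f 1) x (lshift m j) 0) =
      (fun x => op_tensor m T (fun x => B x *m g x) x j 0).
    by apply/funext => x; rewrite !mxE eBg.
  exact: mT1.
have mTg : mxm (op_tensor m T g).
  move=> j k; rewrite (ord1 k).
  have <- : (fun x => op_tensor (m + m) T (f (- z)) x (rshift m j) 0) =
      (fun x => op_tensor m T g x j 0).
    by apply/funext => x; rewrite !mxE eg.
  exact: mT2.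
pose cg := commutator (op_mul B) (op_tensor m T) g.
have cgE x : cg x = B x *m op_tensor m T g x - op_tensor m T (fun x => B x *m g x) x by [].
have mcg : mxm cg by apply: mxmB => //; exact: mxmM.
have Tf2 : {ae mu, forall x, forall j, T (fun x => f 1 x (rshift m j) 0) x = - z^-1 * T (fun x => g x j 0) x}.
  apply: filter_forall => j; have := op_scale (- z^-1) hT (dg j).
  apply: filterS => x <-; congr (op_fun T _ _); apply/funext => y.
  by rewrite /f col_mxEd mul1r mxE.
have nc : (LpW_norm p V cg <= 1%:E * LpW_norm p W (op_tensor (m + m)%N T (f 1%R)))%E.
  apply: (LpW_norm_le ler01 mV mW mcg mT1).
  apply: filterS2 gVU Tf2 => x gx hx; rewrite (bweight_norm p1 _ _ gx) mul1r.
  have -> : op_tensor (m + m) T (f 1) x =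
      col_mx (op_tensor m T (fun x => B x *m g x) x) (- z^-1 *: op_tensor m T g x).
    apply/colP => i; case: (split_ordP i) => j ->.
      by rewrite col_mxEu !mxE eBg.
    by rewrite col_mxEd !mxE hx.
  rewrite /Phi mul_block_col -/(rt p V x).
  have -> : rt p V x *m op_tensor m T (fun x => B x *m g x) x +
      rt p V x *m bscale s B x *m (- z^-1 *: op_tensor m T g x) = - (rt p V x *m cg x).
    rewrite cgE /bscale -/z (corner_cancel _ _ _ z0).
    by rewrite mulmxBr opprB mulmxA.
  rewrite !vnormE -fnN -(@ler_pXn2r _ 2)// ?nnegrE ?fn_ge0// fn_col_sq lerDl.
  exact: sqr_ge0.
have hn : (LpW_norm p V cg <= (M * expR (- s))%:E * LpW_norm p U g)%E.
  apply: (le_trans nc); rewrite mul1e; apply: (le_trans nT1).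
  rewrite EFinM -muleA; apply: lee_wpmul2l; first by rewrite lee_fin.
  have := nf 1; rewrite mul1r (_ : normc z^-1 = expR (- s))//.
  by rewrite /z -fmorphV normc_real ger0_norm ?invr_ge0 ?expR_ge0// expRN.
split; [by split; split|split; first exact: mcg|exact: hn].
apply: (le_lt_trans hn).
have : (0 <= LpW_norm p U g)%E by exact: poweR_ge0.
by move: ng; case: (LpW_norm p U g) => [r| |]// _ _; rewrite -EFinM ltry.
Qed.

Lemma op_norm_ge0 n (W W' : X -> 'M[R[i]]_n) S : (0 <= op_norm p W W' S)%E.
Proof. by apply: le_ereal_inf_tmp => _ [M [M0 _] <-]; rewrite lee_fin. Qed.

(** The operator norm is an infimum, hence the additional 1. *)
Lemma op_norm_comm (T : operator (X -> R[i]) (X -> R[i])) (V U B : X -> 'M[R[i]]_m) (s K : R) :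
  op_linear T -> mxm V -> mxm U -> mxm B -> {ae mu, forall x, good_at V U x} ->
  (op_norm p (bweight p V U (bscale s B)) (bweight p V U (bscale s B)) (op_tensor (m + m) T)
    <= K%:E)%E ->
  (op_norm p U V (commutator (op_mul B) (op_tensor m T)) <= ((`|K| + 1) * expR (- s))%:E)%E.
Proof.
move=> hT mV mU mB gVU hK.
have K1 : (K%:E < (`|K| + 1)%:E)%E.
  by rewrite lte_fin; apply: (le_lt_trans (ler_norm K)); rewrite ltrDl.
have [_ [M [M0 hM] <-] MK] := ereal_inf_lt (le_lt_trans hK K1).
apply: (@le_trans _ _ (M * expR (- s))%:E); last first.
  by rewrite lee_fin ler_wpM2r ?expR_ge0// -lee_fin ltW.
have hc := comm_op_bound hT mV mU mB gVU M0 hM.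
apply: ereal_inf_lbound; exists (M * expR (- s)); last exact: erefl.
split; [by rewrite mulr_ge0 ?expR_ge0|exact hc].
Qed.

End operator_part.

(** * The commutator estimate *)

Section bmo_link.
Variables (R : realType) (d : nat).
Notation X := (Rspace R d).
Notation Cb := (Cb R d).
Notation mu := (@leb R d).
Implicit Types (c : Cb).

Lemma avg_mean c (f : X -> R) : 0 < c.2 -> LS f ->
  fine (avg (cset c) (fun x => (f x)%:E)) = mean c f.
Proof.
move=> c0 hf; rewrite avgE// /mean mulrC fineM//.
exact: (integrable_fin_num (measurable_cset c) (LS_integrable c0 hf)).
Qed.

(** The averages in the statement of the theorem are computed in the extended
    reals, those of [mxmean] in the reals. *)
Lemma mxavg_mean m n c (F : X -> 'M[R[i]]_(m, n)) : 0 < c.2 -> MLS F ->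
  mxavg (cset c) F = mxmean c F.
Proof.
move=> c0 hF; apply/matrixP => i j; rewrite !mxE; have [h1 h2] := hF i j.
by rewrite /cmean -(avg_mean c0 h1) -(avg_mean c0 h2).
Qed.

Lemma loc_int_MLS m n (F : X -> 'M[R[i]]_(m, n)) : mx_locally_integrable F -> MLS F.
Proof.
move=> [mF hF] i j; have [m1 m2] := mF i j.
have h f : measurable_fun setT f ->
    (forall c, 0 < c.2 -> mu.-integrable (cset c) (fun x => (f x)%:E)) -> LS f.
  move=> mf hf; split=> //; split=> //.
    exact: measurableT_comp.
  by move=> c c0; have /integrableP[_] := hf c c0.
by split; apply: h => // c c0; have [] := hF _ (cubes_cset c0) i j.
Qed.

Lemma bscale_MLS m s (B : X -> 'M[R[i]]_m) : MLS B -> MLS (bscale s B).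
Proof. by move=> hB i j; under eq_fun do rewrite mxE; apply: CLS_Z; exact: hB. Qed.

Lemma mxmean_bscale m s c (B : X -> 'M[R[i]]_m) : 0 < c.2 -> MLS B ->
  mxmean c (bscale s B) = ((expR s)%:C)%C *: mxmean c B.
Proof.
move=> c0 hB; apply/matrixP => i j; rewrite !mxE -(cmean_Z _ c0 (hB i j)).
by congr cmean; apply/funext => x; rewrite mxE.
Qed.

Lemma BMO_norm_ge0 p m (V U B : X -> 'M[R[i]]_m) : (0 <= BMO_norm p V U B)%E.
Proof.
pose c : Cb := (point, 1); have c0 : 0 < c.2 by exact: ltr01.
pose f Q := avg Q (fun x : X => (opnorm (mxavg Q (fun y => mxpow (V y) p^-1) *m (B x - mxavg Q B)
               *m invmx (mxavg Q (fun y => mxpow (U y) p^-1))))%:E).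
apply: (@le_trans _ _ (f (cset c))); last first.
  by apply: ereal_sup_ubound => /=; exists (cset c) => //; exact: cubes_cset.
rewrite /f avgE//; apply: mule_ge0; first by rewrite lee_fin invr_ge0 ltW// vol_gt0.
by apply: integral_ge0 => y _; rewrite lee_fin opnorm_ge0.
Qed.

(** The operator norm in the definition of BMO is replaced by the Frobenius
    norm, at the cost of the square root of m. *)
Lemma bmo_bscale p m (V U B : X -> 'M[R[i]]_m) (b s : R) :
  MLS (rt p V) -> MLS (rt p U) -> MLS B -> (BMO_norm p V U B <= b%:E)%E ->
  expR s * (Num.sqrt m%:R * b) <= 1 -> bmo_le (rt p V) (rt p U) (bscale s B).
Proof.
move=> hV hU hB hb hs c c0; have v0 := vol_gt0 c0.
pose F x := mxmean c (rt p V) *m (B x - mxmean c B) *m invmx (mxmean c (rt p U)).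
have hF : MLS F by apply: MLS_mulR; apply: MLS_mulL; exact: MLS_Bc.
have mF := mxm_MLS hF.
have iF : (\int[mu]_(x in cset c) (opnorm (F x))%:E <= (b * vol c)%:E)%E.
  apply/(avg_le _ _ c0); apply: le_trans hb.
  apply: ereal_sup_ubound => /=; exists (cset c); first exact: cubes_cset.
  by rewrite /F -(mxavg_mean c0 hV) -(mxavg_mean c0 hU) -(mxavg_mean c0 hB).
rewrite (@I_eq _ _ _ _ (fun x => expR s * fn (F x))); last first.
  move=> x _; rewrite mxmean_bscale// /bscale /F -scalerBr -scalemxAr -scalemxAl.
  by rewrite fnZ normc_real ger0_norm ?expR_ge0.
rewrite (I_Z c0 (expR_ge0 s) (LI_fn hF)).
have h : I_ c (fun x => fn (F x)) <= Num.sqrt m%:R * b * vol c.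
  rewrite -lee_fin -intE//; last exact: LI_fn.
  apply: (@le_trans _ _ (int c (fun x => Num.sqrt m%:R * opnorm (F x)))).
    apply: int_mono.
    - exact: measurable_fn.
    - by apply: measurable_funM => //; exact: measurable_opnorm.
    - by move=> x; exact: fn_ge0.
    - by move=> x; rewrite mulr_ge0 ?sqrtr_ge0 ?opnorm_ge0.
    by apply: aeW => x _; exact: fn_le_opnorm.
  rewrite intZ ?sqrtr_ge0//; [|exact: measurable_opnorm|by move=> x; exact: opnorm_ge0].
  by rewrite -mulrA EFinM; apply: lee_wpmul2l; rewrite ?lee_fin ?sqrtr_ge0.
apply: (@le_trans _ _ (expR s * (Num.sqrt m%:R * b * vol c))).
  by apply: ler_wpM2l h; exact: expR_ge0.
by rewrite mulrA -[leRHS]mul1r ler_wpM2r// ltW.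
Qed.

End bmo_link.

Section main.
Variables (R : realType) (d m : nat) (p : R).
Notation X := (Rspace R d).
Notation mu := (@leb R d).
Hypothesis p1 : 1 < p.
Hypothesis m0 : (0 < m)%N.

Lemma ap_reduced s : 0 <= s -> exists2 K, 0 < K & forall V : X -> 'M[R[i]]_m,
  Ap_weight p V -> (Ap_const p V <= s%:E)%E -> reduced p K (rt p V) (irt p V) /\ MLS (rt p V).
Proof.
move=> s0; have [K K0 HK] := @ap_reducing R d p m p1 s s0; exists K => // V hV hs.
have ad := ap_weight_data hV hs; split; last exact: (ap_MLS p1 s0 ad).
split.
- exact: adA ad.
- exact: adA' ad.
- by apply: filterS (adG ad) => x [].
- by move=> c c0; have [h _ _] := HK _ _ ad c c0; exact: posdef_unit.
- by move=> c c0; have [_ h _] := HK _ _ ad c c0.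
- by move=> c c0; have [_ _ h] := HK _ _ ad c c0.
Qed.

Lemma bweight_Ap_weight (V U B : X -> 'M[R[i]]_m) a : mxm V -> mxm U -> mxm B ->
  {ae mu, forall x, good_at V U x} -> (Ap_const p (bweight p V U B) <= a%:E)%E ->
  Ap_weight p (bweight p V U B).
Proof.
move=> mV mU mB gVU h; split; last exact: le_lt_trans h (ltry _).
split; first exact: mxm_bweight.
by apply: filterS gVU => x; exact: bweight_posdef.
Qed.

Variable T : operator (X -> R[i]) (X -> R[i]).
Hypothesis hT : op_linear T.
Variable K : nat -> R -> R.
Hypothesis hK : forall n : nat, (0 < n)%N ->
  forall W : X -> 'M[R[i]]_n, Ap_weight p W ->
    (op_norm p W W (op_tensor n T) <= (K n (fine (Ap_const p W)))%:E)%E.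

(** The dichotomy on whether the A_p constant of the dilated block weights
    takes the value F + 1. *)
Lemma commutator_bound s : 0 <= s -> exists2 C, 0 < C & forall U V B : X -> 'M[R[i]]_m,
  Ap_weight p U -> Ap_weight p V -> mx_locally_integrable B ->
  (Ap_const p U <= s%:E)%E -> (Ap_const p V <= s%:E)%E ->
  (op_norm p U V (commutator (op_mul B) (op_tensor m T)) <= C%:E * BMO_norm p V U B)%E.
Proof.
move=> s0; have [Kr Kr0 HK] := ap_reduced s0.
have [F F0 HF] := @bweight_upper R d m p p1 m0 Kr Kr0.
have sq0 : 0 < Num.sqrt m%:R :> R by rewrite sqrtr_gt0 ltr0n.
pose c0 := F + 1; pose N e : R := `|K (m + m) e| + 1.
have N0 e : 0 < N e by rewrite ltr_wpDl.
exists (N c0 * Num.sqrt m%:R); first exact: mulr_gt0.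
move=> U V B wU wV hB sU sV.
have [rV MV] := HK V wV sV; have [rU MU] := HK U wU sU.
have mV : mxm V by case: wV => [[]].
have mU : mxm U by case: wU => [[]].
have gVU : {ae mu, forall x, good_at V U x}.
  have [[_ gV] _] := wV; have [[_ gU] _] := wU.
  by apply: filterS2 gV gU => x ? ?; split.
have MB := loc_int_MLS hB; have mB := mxm_MLS MB.
have := BMO_norm_ge0 p V U B.
have := lexx (BMO_norm p V U B); move: {-1}(BMO_norm p V U B) => [b| |] //; last first.
  by move=> _ _; rewrite gt0_muley ?leey// lte_fin mulr_gt0.
move=> hb; rewrite lee_fin => b0.
pose W r := bweight p V U (bscale r B).
have mW r : mxm (W r) by apply: mxm_bweight => //; exact: mxm_bscale.
have small r : expR r * (Num.sqrt m%:R * b) <= 1 -> (Ap_const p (W r) <= F%:E)%E.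
  move=> hr; apply: HF => //; first exact: bscale_MLS.
  exact: (bmo_bscale MV MU MB hb hr).
have sb1 : 0 < Num.sqrt m%:R * b + 1 by rewrite ltr_wpDl// mulr_ge0// ltW.
pose r0 := - ln (Num.sqrt m%:R * b + 1).
have h0 : (Ap_const p (W r0) <= F%:E)%E.
  by apply: small; rewrite expRN lnK ?posrE// mulrC ler_pdivrMr// mul1r lerDl.
have lip := @bweight_lip R d m p p1 m0 V U mV mU B.
pose phi r := fine (Ap_const p (W r)).
have fin r : Ap_const p (W r) \is a fin_num.
  rewrite ge0_fin_numE; last exact: Ap_const_ge0.
  exact: (le_lt_trans (lip r0 r F mB h0) (ltry _)).
have phiE r : Ap_const p (W r) = (phi r)%:E by rewrite fineK.
clearbody phi; have phi0 r : 0 <= phi r by rewrite -lee_fin -phiE; exact: Ap_const_ge0.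
have philip r t : phi t <= (expR `|t - r|) `^ p * phi r.
  rewrite -lee_fin -phiE; apply: lip => //; rewrite -/(W r) phiE; exact: lexx.
have comm r : (op_norm p U V (commutator (op_mul B) (op_tensor m T))
    <= (N (phi r) * expR (- r))%:E)%E.
  have -> : phi r = fine (Ap_const p (W r)) by rewrite phiE.
  apply: (op_norm_comm p1 hT mV mU mB gVU).
  apply: hK; first by rewrite addn_gt0 m0.
  apply: (@bweight_Ap_weight _ _ _ (phi r)) => //; first exact: mxm_bscale.
  by rewrite -/(W r) phiE; exact: lexx.
(* the value F + 1 exceeds the bound available for small dilations *)
have [[r hr]|hno] := pselect (exists r, phi r = c0).
  apply: (le_trans (comm r)); rewrite hr -EFinM lee_fin -mulrA ler_pM2l//.
  have : 1 < expR r * (Num.sqrt m%:R * b).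
    rewrite ltNge; apply/negP => /small; rewrite phiE hr lee_fin /c0; lra.
  by rewrite expRN -[leLHS]mul1r ler_pdivrMr ?expR_gt0// mulrC => /ltW.
(* c0 is never reached, so phi stays below it by continuity *)
have lt r : phi r <= c0.
  rewrite leNgt; apply/negP => hr; apply: hno.
  apply: (@quasi_lipschitz_IVT _ phi p r0 r c0 phi0 philip); last exact: ltW.
  by apply: (@le_trans _ _ F); [rewrite -lee_fin -phiE|rewrite /c0 lerDl].
have c00 : 0 <= c0 by rewrite addr_ge0.
have all r : (Ap_const p (W r) <= c0%:E)%E by rewrite phiE lee_fin.
have const r t : phi t <= phi r.
  rewrite -lee_fin -(phiE t).
  apply: (@bweight_rigid _ _ _ _ p1 m0 _ _ mV mU B c0 r t _ c00 mB all).
  by rewrite -/(W r) phiE; exact: lexx.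
have phic r : phi r = phi 0 by apply/eqP; rewrite eq_le !const.
have : op_norm p U V (commutator (op_mul B) (op_tensor m T)) = 0%E.
  have := op_norm_ge0 p U V (commutator (op_mul B) (op_tensor m T)).
  move: comm; case: (op_norm p U V _) => [x| |]//; last by move=> /(_ 0).
  move=> h; rewrite lee_fin => x0; congr EFin.
  apply: (@decay_eq0 _ x (N (phi 0))) => //; first exact: ltW.
  by move=> r; have := h r; rewrite lee_fin phic.
move=> ->; apply: mule_ge0; rewrite lee_fin//; apply/ltW; exact: mulr_gt0.
Qed.

End main.

Theorem theorem1p1 (R : realType) (d : nat) (hd : (0 < d)%N)
    (p : R) (hp : 1 < p)
    (T : operator (Rspace R d -> R[i]) (Rspace R d -> R[i]))
    (hT : op_linear T)
    (hbound : exists K : nat -> R -> R,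
       forall n : nat, (0 < n)%N ->
       forall W : Rspace R d -> 'M[R[i]]_n, Ap_weight p W ->
         (op_norm p W W (op_tensor n T) <= (K n (fine (Ap_const p W)))%:E)%E)
    (m : nat) (hm : (0 < m)%N) :
  exists C : R -> R -> R,
    (forall s t : R, 0 < C s t) /\
    forall U V B : Rspace R d -> 'M[R[i]]_m,
      Ap_weight p U -> Ap_weight p V -> mx_locally_integrable B ->
      (op_norm p U V (commutator (op_mul B) (op_tensor m T))
         <= (C (fine (Ap_const p U)) (fine (Ap_const p V)))%:E
              * BMO_norm p V U B)%E.
Proof.
have [K hK] := hbound.
have H (st : R * R) : exists C : R, 0 < C /\ forall U V B : Rspace R d -> 'M[R[i]]_m,
    Ap_weight p U -> Ap_weight p V -> mx_locally_integrable B ->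
    (Ap_const p U <= (`|st.1| + `|st.2|)%:E)%E -> (Ap_const p V <= (`|st.1| + `|st.2|)%:E)%E ->
    (op_norm p U V (commutator (op_mul B) (op_tensor m T)) <= C%:E * BMO_norm p V U B)%E.
  have [C C0 HC] := commutator_bound hp hm hT hK (addr_ge0 (normr_ge0 st.1) (normr_ge0 st.2)).
  by exists C.
have [C HC] := choice H.
exists (fun s t => C (s, t)); split=> [s t|U V B wU wV hB]; first by case: (HC (s, t)).
have fE (W : Rspace R d -> 'M[R[i]]_m) : Ap_weight p W -> Ap_const p W = (fine (Ap_const p W))%:E.
  by move=> [_ h]; rewrite fineK// ge0_fin_numE// Ap_const_ge0.
have [_] := HC (fine (Ap_const p U), fine (Ap_const p V)); apply=> //.
  by rewrite {1}(fE U wU) lee_fin /= ler_wpDr// ler_norm.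
by rewrite {1}(fE V wV) lee_fin /= ler_wpDl// ler_norm.
Qed.
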